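(* For every axiom $\varphi$ of $\mathsf{IKP}^{-\mathrm{Inf}}$, $\mathsf{IKP}^{-\mathrm{Inf}}\vdash\varphi^{\mathbb L}$. Moreover, $\mathsf{IKP}^{-\mathrm{Inf}}+\text{Strong Infinity}\vdash(\text{Strong Infinity})^{\mathbb L}$.
   Context: $\mathsf{IKP}^{-\mathrm{Inf}}$: intuitionistic logic; axioms Extensionality, Empty Set, Pairing, Unions, Set Induction scheme, $\Sigma_0$-Separation scheme, $\Sigma_0$-Collection scheme (no Infinity). Strong Infinity: $\exists a\,(\mathrm{Ind}(a)\wedge\forall b\,(\mathrm{Ind}(b)\to\forall x\in a\,(x\in b)))$ where $\mathrm{Ind}(a)$ means $\emptyset\in a\wedge\forall x\in a\,(x\cup\{x\}\in a)$. An ordinal is a transitive set of transitive sets. The fundamental operations $\mathcal F_i$, $i\in\mathcal I$ (finite index set) are the binary operations: $\{x,y\}$; $x\cap\bigcap y$; $\bigcup x$; $x\setminus y$; $x\times y$; $x\cap\{z: y\text{ is an ordered pair}\wedge(z\in 1^{st}(y)\to z\in 2^{nd}(y))\}$; $\{\{u:\langle z,u\rangle\in x\}:z\in y\}$; $\mathrm{dom}(x)$; $\mathrm{ran}(x)$; $\{\langle u,v,w\rangle:\langle u,v\rangle\in x\wedge w\in y\}$; $\{\langle u,w,v\rangle:\langle u,v\rangle\in x\wedge w\in y\}$; $\{\langle v,u\rangle\in y\times x:u=v\}$; $\{\langle v,u\rangle\in y\times x:u\in v\}$ (Kuratowski pairs, $\langle a,b,c\rangle=\langle a,\langle b,c\rangle\rangle$).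 $\mathrm{cl}_0(b)=b\cup\{\mathcal F_i(x,y):x,y\in b,\ i\in\mathcal I\}$, $\mathrm{cl}(b)=\mathrm{cl}_0(b\cup\{b\})$, $\mathbb L_\alpha=\bigcup_{\beta\in\alpha}\mathrm{cl}(\mathbb L_\beta)$, $\mathbb L=\bigcup_{\alpha\in\mathrm{Ord}}\mathbb L_\alpha$; $\varphi^{\mathbb L}$ is the relativization of $\varphi$ to $\mathbb L$. *)

(* Defs.v *)
From Stdlib Require Import Arith List.
Import ListNotations.

(** * Intuitionistic first-order logic with equality over the signature {∈}

    Variables are de Bruijn indices.  As the signature is relational, the only
    terms are variables, and substitution is renaming. *)

Inductive form : Type :=
| Mem : nat -> nat -> form
| Eq  : nat -> nat -> form
| Bot : form
| And : form -> form -> form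
| Or  : form -> form -> form
| Imp : form -> form -> form
| All : form -> form
| Ex  : form -> form.

Declare Scope form_scope.
Delimit Scope form_scope with form.
Bind Scope form_scope with form.

Notation "x ∈ y" := (Mem x y) (at level 70, no associativity) : form_scope.
Notation "x ≐ y" := (Eq x y) (at level 70, no associativity) : form_scope.
Notation "⊥" := Bot : form_scope.
Notation "A ∧ B" := (And A B) (at level 80, right associativity) : form_scope.
Notation "A ∨ B" := (Or A B) (at level 85, right associativity) : form_scope.
Notation "A ⇒ B" := (Imp A B) (at level 90, right associativity) : form_scope.
Notation "A ⇔ B" := (And (Imp A B) (Imp B A)) (at level 91, no associativity) : form_scope.
Notation "'∀' A" := (All A) (at level 75, right associativity) : form_scope.
Notation "'∃' A" := (Ex A) (at level 75, right associativity) : form_scope.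

(* Bounded quantifiers: [x] lives outside the new binder, hence the shift. *)
Notation "'∀∈' x , A" := (All (Imp (Mem 0 (S x)) A))
  (at level 75, x at level 9, A at level 75, right associativity) : form_scope.
Notation "'∃∈' x , A" := (Ex (And (Mem 0 (S x)) A))
  (at level 75, x at level 9, A at level 75, right associativity) : form_scope.

Local Open Scope form_scope.

(* Extend a renaming under a binder. *)
Definition up (r : nat -> nat) (n : nat) : nat :=
  match n with 0 => 0 | S m => S (r m) end.

Fixpoint ren (r : nat -> nat) (A : form) : form :=
  match A with
  | Mem x y => Mem (r x) (r y)
  | Eq x y => Eq (r x) (r y)
  | Bot => Bot
  | And A B => And (ren r A) (ren r B)
  | Or A B => Or (ren r A) (ren r B)
  | Imp A B => Imp (ren r A) (ren r B)
  | All A => All (ren (up r) A)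
  | Ex A => Ex (ren (up r) A)
  end.

(* [inst x A] substitutes the variable [x] for index 0 of [A]. *)
Definition inst (x : nat) : form -> form :=
  ren (fun n => match n with 0 => x | S m => m end).

(* Natural deduction from the theory [T] under the hypotheses [G].  The rule
   [Ax] is not restricted in the scope of a binder, so [T] is meant to consist
   of sentences. *)
Inductive prv (T : form -> Prop) : list form -> form -> Prop :=
| Ax G A : T A -> prv T G A
| Hyp G A : In A G -> prv T G A
| BotE G A : prv T G ⊥ -> prv T G A
| AndI G A B : prv T G A -> prv T G B -> prv T G (A ∧ B)
| AndE1 G A B : prv T G (A ∧ B) -> prv T G A
| AndE2 G A B : prv T G (A ∧ B) -> prv T G B
| OrI1 G A B : prv T G A -> prv T G (A ∨ B)
| OrI2 G A B : prv T G B -> prv T G (A ∨ B)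
| OrE G A B C :
    prv T G (A ∨ B) -> prv T (A :: G) C -> prv T (B :: G) C -> prv T G C
| ImpI G A B : prv T (A :: G) B -> prv T G (A ⇒ B)
| ImpE G A B : prv T G (A ⇒ B) -> prv T G A -> prv T G B
| AllI G A : prv T (map (ren S) G) A -> prv T G (∀ A)
| AllE G A x : prv T G (∀ A) -> prv T G (inst x A)
| ExI G A x : prv T G (inst x A) -> prv T G (∃ A)
| ExE G A C :
    prv T G (∃ A) -> prv T (A :: map (ren S) G) (ren S C) -> prv T G C
| EqI G x : prv T G (x ≐ x)
| EqE G A x y : prv T G (x ≐ y) -> prv T G (inst x A) -> prv T G (inst y A).

Definition proves (T : form -> Prop) (A : form) : Prop := prv T [] A.

(* The least [n] such that all free variables of the formula are below [n]. *)
Fixpoint fvbound (A : form) : nat :=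
  match A with
  | Mem x y | Eq x y => Nat.max (S x) (S y)
  | Bot => 0
  | And A B | Or A B | Imp A B => Nat.max (fvbound A) (fvbound B)
  | All A | Ex A => Nat.pred (fvbound A)
  end.

Definition closure (A : form) : form := Nat.iter (fvbound A) All A.

Inductive Sigma0 : form -> Prop :=
| Sigma0_Mem x y : Sigma0 (x ∈ y)
| Sigma0_Eq x y : Sigma0 (x ≐ y)
| Sigma0_Bot : Sigma0 ⊥
| Sigma0_And A B : Sigma0 A -> Sigma0 B -> Sigma0 (A ∧ B)
| Sigma0_Or A B : Sigma0 A -> Sigma0 B -> Sigma0 (A ∨ B)
| Sigma0_Imp A B : Sigma0 A -> Sigma0 B -> Sigma0 (A ⇒ B)
| Sigma0_All x A : Sigma0 A -> Sigma0 (∀∈ x, A)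
| Sigma0_Ex x A : Sigma0 A -> Sigma0 (∃∈ x, A).

(** * The theory IKP without Infinity

    Below, comments name the variables bound at each index. *)

Definition Extensionality : form :=
  ∀ ∀ ((∀ (0 ∈ 2 ⇔ 0 ∈ 1)) ⇒ 1 ≐ 0).

Definition EmptySet : form := ∃ ∀∈ 0, ⊥.

Definition Pairing : form := ∀ ∀ ∃ ∀ (0 ∈ 1 ⇔ (0 ≐ 3 ∨ 0 ≐ 2)).

Definition Unions : form := ∀ ∃ ∀ (0 ∈ 1 ⇔ ∃∈ 2, 1 ∈ 0).

(* ∀a (∀x∈a A(x) → A(a)) → ∀a A(a); index 0 of [A] is the set, the other
   indices are parameters. *)
Definition SetInduction (A : form) : form :=
  (∀ ((∀∈ 0, ren (up S) A) ⇒ A)) ⇒ ∀ A.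

(* ∀a ∃y ∀x (x ∈ y ↔ x ∈ a ∧ A(x,a)); index 0 of [A] is x, index 1 is a, the
   other indices are parameters. *)
Definition Separation (A : form) : form :=
  ∀ ∃ ∀ (0 ∈ 1 ⇔ (0 ∈ 2 ∧ ren (up S) A)).

(* ∀a (∀x∈a ∃y A(y,x,a) → ∃b ∀x∈a ∃y∈b A(y,x,a)); index 0 of [A] is y, index
   1 is x, index 2 is a, the other indices are parameters. *)
Definition Collection (A : form) : form :=
  ∀ ((∀∈ 0, ∃ A) ⇒ ∃ ∀∈ 1, ∃∈ 1, ren (up (up S)) A).

Inductive IKP_noInf : form -> Prop :=
| ax_ext : IKP_noInf Extensionality
| ax_empty : IKP_noInf EmptySet
| ax_pair : IKP_noInf Pairing
| ax_union : IKP_noInf Unions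
| ax_ind A : IKP_noInf (closure (SetInduction A))
| ax_sep A : Sigma0 A -> IKP_noInf (closure (Separation A))
| ax_coll A : Sigma0 A -> IKP_noInf (closure (Collection A)).

(** * Set-theoretic notions as formulas

    The arguments are variables of the ambient context; they are shifted by
    the number of binders crossed. *)

(* s = x ∪ {x} *)
Definition is_succ (s x : nat) : form :=
  ∀ (0 ∈ S s ⇔ (0 ∈ S x ∨ 0 ≐ S x)).

(* ∅ ∈ a ∧ ∀x∈a (x ∪ {x} ∈ a) *)
Definition is_Ind (a : nat) : form :=
  (∃∈ a, ∀∈ 0, ⊥) ∧ (∀∈ a, ∃∈ (S a), is_succ 0 1).

Definition StrongInfinity : form :=
  ∃ (is_Ind 0 ∧ ∀ (is_Ind 0 ⇒ ∀∈ 1, 0 ∈ 1)).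

Definition add_axiom (T : form -> Prop) (A : form) : form -> Prop :=
  fun B => T B \/ B = A.

Definition is_trans (a : nat) : form := ∀∈ a, ∀∈ 0, 0 ∈ 2 + a.

Definition is_ord (a : nat) : form := is_trans a ∧ ∀∈ a, is_trans 0.

(* p = {a, b} *)
Definition is_upair (p a b : nat) : form :=
  ∀ (0 ∈ S p ⇔ (0 ≐ S a ∨ 0 ≐ S b)).

(* p = ⟨a, b⟩ = {{a}, {a, b}} *)
Definition is_opair (p a b : nat) : form :=
  ∃ ∃ (is_upair 1 (2 + a) (2 + a) ∧ is_upair 0 (2 + a) (2 + b)
       ∧ is_upair (2 + p) 1 0).

(* p = ⟨a, b, c⟩ = ⟨a, ⟨b, c⟩⟩ *)
Definition is_otriple (p a b c : nat) : form :=
  ∃ (is_opair 0 (S b) (S c) ∧ is_opair (S p) (S a) 0).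

(* ⟨a, b⟩ ∈ x *)
Definition opair_in (a b x : nat) : form := ∃∈ x, is_opair 0 (S a) (S b).

(** * The fundamental operations *)

Inductive fundop : Type :=
| F_pair | F_inter | F_union | F_diff | F_prod | F_imp | F_all
| F_dom | F_ran | F_123 | F_132 | F_eq | F_mem.

Definition fundops : list fundop :=
  [F_pair; F_inter; F_union; F_diff; F_prod; F_imp; F_all;
   F_dom; F_ran; F_123; F_132; F_eq; F_mem].

(* u ∈ F_i(x, y) *)
Definition in_fundop (i : fundop) (u x y : nat) : form :=
  match i with
  | F_pair => (* {x, y} *)
      u ≐ x ∨ u ≐ y
  | F_inter => (* x ∩ ⋂y *)
      u ∈ x ∧ ∀∈ y, S u ∈ 0
  | F_union => (* ⋃x *)
      ∃∈ x, S u ∈ 0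
  | F_diff => (* x \ y *)
      u ∈ x ∧ (u ∈ y ⇒ ⊥)
  | F_prod => (* x × y *)
      ∃∈ x, ∃∈ (S y), is_opair (2 + u) 1 0
  | F_imp => (* x ∩ {z : y is an ordered pair ∧ (z ∈ 1st(y) → z ∈ 2nd(y))} *)
      u ∈ x ∧ ∃ ∃ (is_opair (2 + y) 1 0 ∧ (2 + u ∈ 1 ⇒ 2 + u ∈ 0))
  | F_all => (* {{v : ⟨z, v⟩ ∈ x} : z ∈ y} *)
      ∃∈ y, ∀ (0 ∈ 2 + u ⇔ opair_in 1 0 (2 + x))
  | F_dom => (* dom(x) *)
      ∃ opair_in (S u) 0 (S x)
  | F_ran => (* ran(x) *)
      ∃ opair_in 0 (S u) (S x)
  | F_123 => (* {⟨a, b, c⟩ : ⟨a, b⟩ ∈ x ∧ c ∈ y} *)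
      ∃ ∃ ∃ (is_otriple (3 + u) 2 1 0 ∧ opair_in 2 1 (3 + x) ∧ 0 ∈ 3 + y)
  | F_132 => (* {⟨a, c, b⟩ : ⟨a, b⟩ ∈ x ∧ c ∈ y} *)
      ∃ ∃ ∃ (is_otriple (3 + u) 2 0 1 ∧ opair_in 2 1 (3 + x) ∧ 0 ∈ 3 + y)
  | F_eq => (* {⟨v, w⟩ ∈ y × x : w = v} *)
      ∃∈ y, ∃∈ (S x), (is_opair (2 + u) 1 0 ∧ 0 ≐ 1)
  | F_mem => (* {⟨v, w⟩ ∈ y × x : w ∈ v} *)
      ∃∈ y, ∃∈ (S x), (is_opair (2 + u) 1 0 ∧ 0 ∈ 1)
  end.

(* z = F_i(x, y) *)
Definition is_fundop (i : fundop) (z x y : nat) : form :=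
  ∀ (0 ∈ S z ⇔ in_fundop i 0 (S x) (S y)).

(** * The constructible universe *)

(* z ∈ cl_0(b) *)
Definition in_cl0 (z b : nat) : form :=
  z ∈ b ∨ ∃∈ b, ∃∈ (S b),
    fold_right Or Bot (map (fun i => is_fundop i (2 + z) 1 0) fundops).

(* z ∈ cl(b) = cl_0(b ∪ {b}) *)
Definition in_cl (z b : nat) : form := ∃ (is_succ 0 (S b) ∧ in_cl0 (S z) 0).

(* f is a function with domain a *)
Definition is_fun (f a : nat) : form :=
  (∀∈ f, ∃∈ (S a), ∃ is_opair 2 1 0)
  ∧ (∀∈ a, ∃ (opair_in 1 0 (2 + f) ∧ ∀ (opair_in 2 0 (3 + f) ⇒ 0 ≐ 1))).

(* z ∈ ⋃_{c ∈ a} cl(f(c)) *)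
Definition in_step (z f a : nat) : form :=
  ∃∈ a, ∃ (opair_in 1 0 (2 + f) ∧ in_cl (2 + z) 0).

(* y = ⋃_{c ∈ a} cl(f(c)) *)
Definition is_step (y f a : nat) : form :=
  ∀ (0 ∈ S y ⇔ in_step 0 (S f) (S a)).

(* f = ⟨L_b : b ∈ a⟩, for a transitive set a: f is a function with domain a
   and f(b) = ⋃_{c ∈ b} cl(f(c)) for all b ∈ a. *)
Definition is_Lseq (f a : nat) : form :=
  is_fun f a ∧ ∀∈ a, ∃ (opair_in 1 0 (2 + f) ∧ is_step 0 (2 + f) 1).

(* y = L_a, by recursion along the transitive set a *)
Definition is_Lstage (y a : nat) : form :=
  ∃ (is_Lseq 0 (S a) ∧ is_step (S y) 0 (S a)).

(* x ∈ L *)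
Definition in_L (x : nat) : form :=
  ∃ (is_ord 0 ∧ ∃ (is_Lstage 0 1 ∧ 2 + x ∈ 0)).

(* Relativization to the class given by C: [C x] states that the variable x
   belongs to the class. *)
Fixpoint relativize (C : nat -> form) (A : form) : form :=
  match A with
  | Mem x y => Mem x y
  | Eq x y => Eq x y
  | Bot => Bot
  | And A B => And (relativize C A) (relativize C B)
  | Or A B => Or (relativize C A) (relativize C B)
  | Imp A B => Imp (relativize C A) (relativize C B)
  | All A => All (Imp (C 0) (relativize C A))
  | Ex A => Ex (And (C 0) (relativize C A))
  end.

(* Main.v *)
From Stdlib Require Import Arith List Lia.
Require Import Defs.
Import ListNotations.

(** Derivability is replaced by forcing over the poset of contexts: the universe of
    discourse consists of the variables, a proposition is a set of contexts closed under
    the nucleus generated by derivability, and every formula is forced exactly at the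
    contexts that derive it.  Set theory is then carried out inside this semantics, where
    quantifiers and implications can be handled without de Bruijn indices.

    The sequence of the stages L_a exists by Sigma1 replacement and set induction.  L is
    closed under the fundamental operations because two members of L lie in a common stage
    L_(a ∪ b), for which no linearity of the ordinals is needed.  A single stage need not
    be transitive, but the class of all [u] that belong to a transitive set of members of
    L is closed under each operation, hence contains every stage by set induction.
    Bounded separation in L follows from closure under the operations by induction on
    formulas, for subsets of sets of coded tuples: implication and the bounded universal
    quantifier are given directly by the operations F_imp, F_all and F_inter.  For
    collection one collects ordinals and takes the stage of their union, and ω belongs to
    L since it is separated from a stage by a bounded formula. *)

Local Open Scope form_scope.

(** * Renamings and derivations *)

(** A Kripke reading of disjunction and existence would match derivability only at prime contexts
    with witnesses. Closing every proposition under the nucleus makes arbitrary finite contexts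
    suffice, and as the signature has no function symbols, variables are the only possible
    witnesses. The price is that the schemes still speak of formulas: a predicate of the
    metalanguage enters an axiom only after a formula for it has been exhibited. [D] and [S1] record
    such formulas together with their complexity. Complexity is the main constraint on the set
    theory: each notion receives a bounded or Sigma1 equivalent before separation or collection is
    applied to it. Stages can fail to be transitive because [F_prod] adds a product in one step,
    while its members, the ordered pairs, need further applications of [F_pair]. Classically,
    implication and the bounded universal quantifier reduce to complements and projections. This
    reduction fails intuitionistically, which is why the list of operations contains [F_imp] and
    [F_all]. *)

Definition scons (x : nat) (r : nat -> nat) (n : nat) : nat :=
  match n with 0 => x | S m => r m end.

Notation "x .: r" := (scons x r) (at level 55, right associativity).

Lemma ren_ext_fv A : forall r s,
  (forall n, n < fvbound A -> r n = s n) -> ren r A = ren s A.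
Proof.
  assert (Hup : forall r s k, (forall n, n < pred k -> r n = s n) ->
            forall n, n < k -> up r n = up s n).
  { intros r s k H [|n] Hn; simpl; [reflexivity|]. rewrite H by lia. reflexivity. }
  induction A as [x y|x y| |A IHA B IHB|A IHA B IHB|A IHA B IHB|A IHA|A IHA];
    intros r s H; cbn [ren fvbound] in *; f_equal; try reflexivity;
    try (apply H; lia);
    try (apply IHA; intros; apply H; lia);
    try (apply IHB; intros; apply H; lia);
    apply IHA; exact (Hup _ _ _ H).
Qed.

Lemma ren_ext A r s : (forall n, r n = s n) -> ren r A = ren s A.
Proof. intros H; apply ren_ext_fv; auto. Qed.

Lemma ren_ren A : forall r s, ren r (ren s A) = ren (fun n => r (s n)) A.
Proof.
  induction A; intros r s; simpl; f_equal; auto;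
    (rewrite IHA; apply ren_ext; intros [|n]; reflexivity).
Qed.

Lemma ren_id A r : (forall n, n < fvbound A -> r n = n) -> ren r A = A.
Proof.
  intros H. transitivity (ren (fun n => n) A); [now apply ren_ext_fv|].
  clear H r. induction A; simpl; f_equal; auto;
    (rewrite <- IHA at 2; apply ren_ext; intros [|n]; reflexivity).
Qed.

Lemma ren_inst r x A : ren r (inst x A) = inst (r x) (ren (up r) A).
Proof.
  unfold inst. rewrite !ren_ren. apply ren_ext. intros [|n]; reflexivity.
Qed.

Lemma inst_ren_up x r A : inst x (ren (up r) A) = ren (x .: r) A.
Proof.
  unfold inst. rewrite !ren_ren. apply ren_ext. intros [|n]; reflexivity.
Qed.

Lemma ren_ctx r s t u G :
  (forall n, r (s n) = t (u n)) ->
  map (ren r) (map (ren s) G) = map (ren t) (map (ren u) G).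
Proof.
  intros H. rewrite !map_map. apply map_ext. intros A.
  rewrite !ren_ren. now apply ren_ext.
Qed.

Lemma prv_weaken T G A : prv T G A -> forall G', incl G G' -> prv T G' A.
Proof.
  induction 1; intros G' HG.
  - now apply Ax.
  - apply Hyp; auto.
  - apply BotE; auto.
  - apply AndI; auto.
  - eapply AndE1; eauto.
  - eapply AndE2; eauto.
  - apply OrI1; auto.
  - apply OrI2; auto.
  - eapply OrE; [eauto| |]; [apply IHprv2|apply IHprv3];
      (intros B' [->|HB]; [left; reflexivity|right; auto]).
  - apply ImpI. apply IHprv. intros B' [->|HB]; [left; reflexivity|right; auto].
  - eapply ImpE; eauto.
  - apply AllI. apply IHprv. now apply incl_map.
  - apply AllE; auto.
  - eapply ExI; eauto.
  - eapply ExE; [eauto|]. apply IHprv2.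
    intros B' [->|HB]; [left; reflexivity|right; now apply (incl_map (ren S) HG)].
  - apply EqI.
  - eapply EqE; eauto.
Qed.

(** Axioms are sentences, hence fixed by every renaming; this keeps the rule [Ax] stable although it
    may be used under binders. *)
Lemma prv_ren T (HT : forall A, T A -> fvbound A = 0) G A :
  prv T G A -> forall r, prv T (map (ren r) G) (ren r A).
Proof.
  induction 1; intros r; simpl in *.
  - rewrite ren_id; [now apply Ax|]. intros n. rewrite HT by assumption. lia.
  - apply Hyp. now apply in_map.
  - apply BotE; auto.
  - apply AndI; auto.
  - eapply AndE1; eauto.
  - eapply AndE2; eauto.
  - apply OrI1; auto.
  - apply OrI2; auto.
  - eapply OrE; eauto.
  - apply ImpI; auto.
  - eapply ImpE; eauto.
  - apply AllI. rewrite (ren_ctx S r (up r) S) by reflexivity. apply IHprv.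
  - rewrite ren_inst. apply AllE. apply IHprv.
  - eapply ExI. rewrite <- ren_inst. apply IHprv.
  - eapply ExE; [apply IHprv1|].
    rewrite (ren_ctx S r (up r) S) by reflexivity.
    specialize (IHprv2 (up r)). rewrite ren_ren in IHprv2 |- *. exact IHprv2.
  - apply EqI.
  - rewrite ren_inst. eapply EqE; [apply IHprv1|]. rewrite <- ren_inst. apply IHprv2.
Qed.

Definition fresh (G : list form) : nat := list_max (map fvbound G).

Lemma fresh_le G A : In A G -> fvbound A <= fresh G.
Proof.
  intros HA. unfold fresh.
  assert (H := proj1 (list_max_le (map fvbound G) _) (le_n _)).
  rewrite Forall_forall in H. apply H. now apply in_map.
Qed.

(** * Generalization from instances at fresh variables *)

Section Generalization.

Variable T : form -> Prop.
Hypothesis HT : forall A, T A -> fvbound A = 0.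

(* Renaming [x] to the variable about to be bound and shifting all others. *)
Let gen (x n : nat) : nat := if n =? x then 0 else S n.

Let gen_shift x A : fvbound A <= x -> ren (gen x) A = ren S A.
Proof.
  intros H. apply ren_ext_fv. intros n Hn. unfold gen.
  destruct (Nat.eqb_spec n x); [lia|reflexivity].
Qed.

Let gen_ctx x G : fresh G <= x -> map (ren (gen x)) G = map (ren S) G.
Proof.
  intros H. apply map_ext_in. intros A HA. apply gen_shift.
  pose proof (fresh_le G A HA). lia.
Qed.

Let gen_inst x A : pred (fvbound A) <= x -> ren (gen x) (inst x A) = A.
Proof.
  intros H. unfold inst. rewrite ren_ren. apply ren_id.
  intros [|n] Hn; unfold gen.
  - now rewrite Nat.eqb_refl.
  - destruct (Nat.eqb_spec n x); [lia|reflexivity].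
Qed.

(** The instance at a variable fresh for [G] and [A] is generic: renaming by [gen x] turns that
    variable into the bound one and shifts the context, which is the premise of [AllI]. Quantifiers
    can thus be read pointwise over all variables. *)
Lemma prv_all_inst G A : (forall x, prv T G (inst x A)) -> prv T G (∀ A).
Proof.
  intros H. set (x := fresh ((∀ A) :: G)).
  assert (HA := fresh_le ((∀ A) :: G) (∀ A) (or_introl eq_refl)).
  assert (HG : fresh G <= x) by (unfold x, fresh; simpl; lia).
  specialize (H x). apply (prv_ren T HT) with (r := gen x) in H.
  rewrite gen_ctx, gen_inst in H by assumption.
  now apply AllI.
Qed.

Lemma prv_ex_inst G A C :
  prv T G (∃ A) -> (forall x, prv T (inst x A :: G) C) -> prv T G C.
Proof.
  intros HE H. set (x := fresh ((∃ A) :: C :: G)).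
  assert (HA := fresh_le ((∃ A) :: C :: G) (∃ A) (or_introl eq_refl)).
  assert (HC := fresh_le ((∃ A) :: C :: G) C (or_intror (or_introl eq_refl))).
  assert (HG : fresh G <= x) by (unfold x, fresh; simpl; lia).
  specialize (H x). apply (prv_ren T HT) with (r := gen x) in H.
  simpl in H. rewrite gen_ctx, gen_inst, gen_shift in H by assumption.
  eapply ExE; eassumption.
Qed.

End Generalization.

Lemma fvbound_iter_All n A : fvbound (Nat.iter n All A) = fvbound A - n.
Proof. induction n as [|n IH]; simpl; [|rewrite IH]; lia. Qed.

Lemma fvbound_closure A : fvbound (closure A) = 0.
Proof. unfold closure. rewrite fvbound_iter_All. lia. Qed.

Lemma IKP_noInf_closed A : IKP_noInf A -> fvbound A = 0.
Proof. destruct 1; try reflexivity; apply fvbound_closure. Qed.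

(** * Forcing *)

(** Everything is done for an arbitrary set of sentences extending IKP without Infinity, so that one
    development serves the theories with and without Strong Infinity. *)
Class theory := {
  ax : form -> Prop;
  ax_sentence : forall A, ax A -> fvbound A = 0;
  ax_ikp : forall A, IKP_noInf A -> ax A }.

(* Worlds are finite contexts ordered by inclusion.  Propositions are sets of
   worlds closed under the nucleus generated by derivability; disjunction and
   existence are encoded by their elimination rules. *)
Record hprop {T : theory} := mk_hprop {
  holds : list form -> Prop;
  hmono : forall w w', incl w w' -> holds w -> holds w';
  holds_closed : forall w,
    (forall C, (forall w', incl w w' -> holds w' -> prv ax w' C) -> prv ax w C) ->
    holds w }.
Arguments hprop : clear implicits.
Arguments hprop {T}.

Declare Scope hprop_scope.
Delimit Scope hprop_scope with H.
Bind Scope hprop_scope with hprop.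

Notation "w ⊩ P" := (holds P%H w) (at level 92, P at level 91, no associativity).

(** Iterated implication turns a larger context into a formula over the smaller one. The nucleus
    tests derivability of formulas only, so this is how the passage to a larger world enters such a
    test. *)
Lemma prv_fold_Imp T G u C : prv T (u ++ G) C -> prv T G (fold_right Imp C u).
Proof.
  revert G. induction u as [|A u IH]; intros G H; simpl; [exact H|].
  apply ImpI, IH. eapply prv_weaken; [exact H|].
  intros B. simpl. rewrite !in_app_iff. simpl. tauto.
Qed.

Lemma prv_fold_Imp_elim T G u C :
  prv T G (fold_right Imp C u) -> incl u G -> prv T G C.
Proof.
  induction u as [|A u IH]; intros H Hu; simpl in *; [exact H|].
  apply IH; [|intros B HB; apply Hu; now right].
  eapply ImpE; [exact H|]. apply Hyp, Hu. now left.
Qed.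

Section Connectives.
Context {T : theory}.

Program Definition hform (A : form) : hprop := {| holds w := prv ax w A |}.
Next Obligation. eapply prv_weaken; eassumption. Qed.

Program Definition hand (P Q : hprop) : hprop :=
  {| holds w := holds P w /\ holds Q w |}.
Next Obligation. split; eapply hmono; eassumption. Qed.
Next Obligation.
  split; apply holds_closed; intros C HC; apply H; intros w' Hw [HP HQ]; auto.
Qed.

Program Definition himp (P Q : hprop) : hprop :=
  {| holds w := forall w', incl w w' -> holds P w' -> holds Q w' |}.
Next Obligation. apply H0; [eapply incl_tran|]; eassumption. Qed.
Next Obligation.
  apply holds_closed. intros C HC.
  apply prv_fold_Imp_elim with w'; [|apply incl_refl].
  eapply prv_weaken; [|eassumption]. apply H. intros w'' Hw HPQ.
  apply prv_fold_Imp, HC; [apply incl_appl, incl_refl|].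
  apply HPQ; [apply incl_appr, incl_refl|].
  eapply hmono; [|eassumption]. apply incl_appl, incl_refl.
Qed.

Program Definition hall {I : Type} (F : I -> hprop) : hprop :=
  {| holds w := forall x, holds (F x) w |}.
Next Obligation. eapply hmono; eauto. Qed.
Next Obligation. apply holds_closed. intros C HC. apply H. auto. Qed.

Program Definition hex {I : Type} (F : I -> hprop) : hprop :=
  {| holds w := forall C,
       (forall x w', incl w w' -> holds (F x) w' -> prv ax w' C) -> prv ax w C |}.
Next Obligation.
  apply prv_fold_Imp_elim with w'; [|apply incl_refl].
  eapply prv_weaken; [|eassumption]. apply H0. intros x w'' Hw HF.
  apply prv_fold_Imp, H1 with x; [apply incl_appl, incl_refl|].
  eapply hmono; [|eassumption]. apply incl_appr, incl_refl.
Qed.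
Next Obligation.
  apply H. intros w' Hw H'. apply H'. intros x w'' Hw' HF.
  apply H0 with x; [eapply incl_tran|]; eassumption.
Qed.

Definition hor (P Q : hprop) : hprop := hex (fun b : bool => if b then P else Q).

Definition hbot : hprop := hform ⊥.

Lemma hex_intro {I} (F : I -> hprop) x w : holds (F x) w -> holds (hex F) w.
Proof. intros H C HC. exact (HC x w (incl_refl w) H). Qed.

(** By definition [hex] eliminates only into derivability of a formula; closure of [Q] under the
    nucleus extends this to all propositions. *)
Lemma hex_elim {I} (F : I -> hprop) (Q : hprop) w :
  holds (hex F) w ->
  (forall w', incl w w' -> forall x, holds (F x) w' -> holds Q w') -> holds Q w.
Proof.
  intros H HQ. apply holds_closed. intros C HC. apply H.
  intros x w' Hw HF. apply HC; eauto.
Qed.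

Lemma hor_introl (P Q : hprop) w : holds P w -> holds (hor P Q) w.
Proof. intros H. now apply (hex_intro _ true). Qed.

Lemma hor_intror (P Q : hprop) w : holds Q w -> holds (hor P Q) w.
Proof. intros H. now apply (hex_intro _ false). Qed.

Lemma hor_elim (P Q R : hprop) w :
  holds (hor P Q) w ->
  (forall w', incl w w' -> holds P w' -> holds R w') ->
  (forall w', incl w w' -> holds Q w' -> holds R w') -> holds R w.
Proof.
  intros H HP HQ. apply (hex_elim _ _ _ H). intros w' Hw [|]; auto.
Qed.

Lemma hbot_elim (P : hprop) w : holds hbot w -> holds P w.
Proof.
  intros H. apply holds_closed. intros C _. now apply BotE.
Qed.

Lemma himp_elim (P Q : hprop) w : holds (himp P Q) w -> holds P w -> holds Q w.
Proof. intros H. exact (H w (incl_refl w)). Qed.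

Definition mem (x y : nat) : hprop := hform (x ∈ y).
Definition eqs (x y : nat) : hprop := hform (x ≐ y).

Fixpoint sem (A : form) (r : nat -> nat) : hprop :=
  match A with
  | Mem x y => mem (r x) (r y)
  | Eq x y => eqs (r x) (r y)
  | Bot => hbot
  | And A B => hand (sem A r) (sem B r)
  | Or A B => hor (sem A r) (sem B r)
  | Imp A B => himp (sem A r) (sem B r)
  | All A => hall (fun x => sem A (x .: r))
  | Ex A => hex (fun x => sem A (x .: r))
  end.

(** The truth lemma. For disjunction and existence the encoded elimination is applied with the
    formula itself as goal; for the quantifiers, ranging over all variables amounts to the
    eigenvariable rules by [prv_all_inst] and [prv_ex_inst]. *)
Lemma sem_prv A : forall r w, holds (sem A r) w <-> prv ax w (ren r A).
Proof.
  induction A; intros r w; simpl.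
  - reflexivity.
  - reflexivity.
  - reflexivity.
  - rewrite IHA1, IHA2. split; [intros [H1 H2]; now apply AndI|].
    intros H; split; [eapply AndE1|eapply AndE2]; exact H.
  - split.
    + intros H. apply H. intros [|] w' _ H'.
      * apply OrI1. now apply IHA1.
      * apply OrI2. now apply IHA2.
    + intros H C HC. eapply OrE; [exact H| |].
      * apply ImpE with (ren r A1); [|apply Hyp; now left].
        apply prv_weaken with w; [|apply incl_tl, incl_refl]. apply ImpI.
        apply (HC true); [apply incl_tl, incl_refl|]. apply IHA1, Hyp. now left.
      * apply (HC false); [apply incl_tl, incl_refl|]. apply IHA2, Hyp. now left.
  - split.
    + intros H. apply ImpI, IHA2, H; [apply incl_tl, incl_refl|].
      apply IHA1, Hyp. now left.
    + intros H w' Hw HA. apply IHA2. eapply ImpE; [|apply IHA1; exact HA].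
      eapply prv_weaken; eassumption.
  - split.
    + intros H. apply (prv_all_inst _ ax_sentence). intros x.
      rewrite inst_ren_up. apply IHA, H.
    + intros H x. apply IHA. rewrite <- inst_ren_up. now apply AllE.
  - split.
    + intros H. apply H. intros x w' _ H'. apply ExI with x.
      rewrite inst_ren_up. now apply IHA.
    + intros H C HC. apply (prv_ex_inst _ ax_sentence _ _ _ H). intros x.
      apply HC with x; [apply incl_tl, incl_refl|]. apply IHA.
      rewrite <- inst_ren_up. apply Hyp. now left.
Qed.

Lemma sem_ext_fv A r s w :
  (forall n, n < fvbound A -> r n = s n) -> holds (sem A r) w -> holds (sem A s) w.
Proof. rewrite !sem_prv. intros H. now rewrite (ren_ext_fv A r s). Qed.

Lemma sem_ext A r s w :
  (forall n, r n = s n) -> holds (sem A r) w -> holds (sem A s) w.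
Proof. intros H. apply sem_ext_fv. auto. Qed.

Lemma sem_ren A r s w :
  holds (sem (ren r A) s) w <-> holds (sem A (fun n => s (r n))) w.
Proof. rewrite !sem_prv, ren_ren. reflexivity. Qed.

Lemma sem_iter_All n A : forall r w,
  holds (sem (Nat.iter n All A) r) w <->
  (forall s, (forall m, s (n + m) = r m) -> holds (sem A s) w).
Proof.
  induction n as [|n IH]; intros r w; simpl.
  - split; [intros H s Hs|intros H; now apply H].
    eapply sem_ext; [|exact H]. auto.
  - split.
    + intros H s Hs. apply (proj1 (IH (s n .: r) w) (H (s n)) s).
      intros [|m]; simpl; [f_equal; lia|]. rewrite <- Hs. f_equal. lia.
    + intros H x. apply IH. intros s Hs. apply H. intros m.
      rewrite <- (Hs (S m)) at 1. f_equal; lia.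
Qed.

Lemma sem_closure A r w : holds (sem (closure A) r) w -> holds (sem A r) w.
Proof.
  intros H. unfold closure in H. set (n := fvbound A) in *.
  (* Opening the [n] quantifiers leaves [r] in place from index [n] on, where [A] has no free
     variables; the first [n] values are chosen to be those of [r]. *)
  apply sem_ext_fv with (fun k => if k <? n then r k else r (k - n)).
  { intros k Hk. now rewrite (proj2 (Nat.ltb_lt k n) Hk). }
  revert H. rewrite sem_iter_All. intros H. apply H. intros m.
  replace (n + m <? n) with false by (symmetry; apply Nat.ltb_ge; lia).
  f_equal. lia.
Qed.

Lemma sem_ax A r w : ax A -> holds (sem A r) w.
Proof.
  intros H. apply sem_prv. rewrite ren_id; [now apply Ax|].
  intros n. rewrite ax_sentence by assumption. lia.
Qed.

Lemma eqs_refl x w : holds (eqs x x) w.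
Proof. apply EqI. Qed.

Lemma sem_eqs A x y r w :
  holds (eqs x y) w -> holds (sem A (x .: r)) w -> holds (sem A (y .: r)) w.
Proof.
  rewrite !sem_prv, <- !inst_ren_up. intros E. now apply EqE.
Qed.

End Connectives.

Notation "⊥" := hbot : hprop_scope.
Notation "P ∧ Q" := (hand P Q) : hprop_scope.
Notation "P ∨ Q" := (hor P Q) : hprop_scope.
Notation "P ⇒ Q" := (himp P Q) : hprop_scope.
Notation "P ⇔ Q" := (hand (himp P Q) (himp Q P)) : hprop_scope.
Notation "x ∈ y" := (mem x y) : hprop_scope.
Notation "x ≐ y" := (eqs x y) : hprop_scope.
Notation "'all' x , P" := (hall (fun x : nat => P%H))
  (at level 75, x name, P at level 91, right associativity) : hprop_scope.
Notation "'ex' x , P" := (hex (fun x : nat => P%H))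
  (at level 75, x name, P at level 91, right associativity) : hprop_scope.
Notation "'all' x ∈ a , P" := (hall (fun x : nat => himp (mem x a) P%H))
  (at level 75, x name, a at level 60, P at level 91, right associativity) : hprop_scope.
Notation "'ex' x ∈ a , P" := (hex (fun x : nat => hand (mem x a) P%H))
  (at level 75, x name, a at level 60, P at level 91, right associativity) : hprop_scope.

(** * Rules and tactics for reasoning inside the semantics *)

Section Rules.
Context {T : theory}.

Lemma hall_intro {I} (F : I -> hprop) w : (forall x, w ⊩ F x) -> w ⊩ hall F.
Proof. intros H. exact H. Qed.

Lemma hall_elim {I} (F : I -> hprop) w : w ⊩ hall F -> forall x, w ⊩ F x.
Proof. intros H. exact H. Qed.

Lemma himp_intro (P Q : hprop) w :
  (forall w', incl w w' -> w' ⊩ P -> w' ⊩ Q) -> w ⊩ P ⇒ Q.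
Proof. intros H. exact H. Qed.

Lemma hball_elim (a : nat) (F : nat -> hprop) w :
  w ⊩ all x ∈ a, F x -> forall x, w ⊩ x ∈ a -> w ⊩ F x.
Proof. intros H x. apply himp_elim. exact (H x). Qed.

Lemma hiff_l (P Q : hprop) w : w ⊩ P ⇔ Q -> w ⊩ P -> w ⊩ Q.
Proof. intros [H _]. now apply himp_elim. Qed.

Lemma hiff_r (P Q : hprop) w : w ⊩ P ⇔ Q -> w ⊩ Q -> w ⊩ P.
Proof. intros [_ H]. now apply himp_elim. Qed.

Lemma halliff_l {I} (F G : I -> hprop) w :
  w ⊩ hall (fun x => F x ⇔ G x)%H -> forall x, w ⊩ F x -> w ⊩ G x.
Proof. intros H x. exact (hiff_l _ _ _ (H x)). Qed.

Lemma halliff_r {I} (F G : I -> hprop) w :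
  w ⊩ hall (fun x => F x ⇔ G x)%H -> forall x, w ⊩ G x -> w ⊩ F x.
Proof. intros H x. exact (hiff_r _ _ _ (H x)). Qed.

Lemma hex_mono {I} (F G : I -> hprop) w :
  (forall w' x, incl w w' -> w' ⊩ F x -> w' ⊩ G x) -> w ⊩ hex F -> w ⊩ hex G.
Proof.
  intros H HF. apply (hex_elim _ _ _ HF). intros w' Hw x Hx.
  apply (hex_intro _ x). auto.
Qed.

Lemma hor_mono (P Q P' Q' : hprop) w :
  (forall w', incl w w' -> w' ⊩ P -> w' ⊩ P') ->
  (forall w', incl w w' -> w' ⊩ Q -> w' ⊩ Q') ->
  w ⊩ P ∨ Q -> w ⊩ P' ∨ Q'.
Proof. intros HP HQ. apply hex_mono. intros w' [|]; auto. Qed.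

End Rules.

Arguments hall_elim {T I F w} _ _.
Arguments himp_elim {T P Q w} _ _.
Arguments hball_elim {T a F w} _ _ _.
Arguments hiff_l {T P Q w} _ _.
Arguments hiff_r {T P Q w} _ _.
Arguments halliff_l {T I F G w} _ _ _.
Arguments halliff_r {T I F G w} _ _ _.

(* Move every hypothesis along an inclusion of worlds. *)
Ltac push L :=
  lazymatch type of L with
  | incl ?w ?w' =>
    repeat match goal with
    | H : holds ?P w |- _ =>
      let H' := fresh in
      pose proof (hmono P w w' L H) as H'; clear H; rename H' into H
    end;
    clear L; try (clear w; rename w' into w)
  end.

Ltac head t := lazymatch t with ?f _ => head f | _ => t end.

Ltac expose_in H :=
  cbv beta in H;
  lazymatch type of H with
  | holds (hand _ _) _ => idtac
  | holds (hor _ _) _ => idtac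
  | holds (himp _ _) _ => idtac
  | holds (hall _) _ => idtac
  | holds (hex _) _ => idtac
  | holds hbot _ => idtac
  | holds (sem ?A _) _ =>
    let A' := eval hnf in A in change A with A' in H; cbn [sem scons] in H
  | holds ?P _ => let f := head P in unfold f in H; expose_in H
  end.

Ltac expose :=
  cbv beta;
  lazymatch goal with
  | |- holds (hand _ _) _ => idtac
  | |- holds (hor _ _) _ => idtac
  | |- holds (himp _ _) _ => idtac
  | |- holds (hall _) _ => idtac
  | |- holds (hex _) _ => idtac
  | |- holds (sem ?A _) _ =>
    let A' := eval hnf in A in change A with A'; cbn [sem scons]
  | |- holds ?P _ => let f := head P in unfold f; expose
  end.

Ltac hintro1 :=
  expose;
  lazymatch goal with
  | |- holds (himp _ _) ?w =>
    let w' := fresh "w" in let L := fresh in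
    apply himp_intro; intros w' L; push L
  | |- holds (hall _) _ => apply hall_intro
  end.

Tactic Notation "hi" simple_intropattern(p) := hintro1; intros p; cbv beta.
Tactic Notation "hi" simple_intropattern(p) simple_intropattern(q) := hi p; hi q.
Tactic Notation "hi" simple_intropattern(p) simple_intropattern(q)
  simple_intropattern(r) := hi p; hi q r.
Tactic Notation "hi" simple_intropattern(p) simple_intropattern(q)
  simple_intropattern(r) simple_intropattern(s) := hi p; hi q r s.

Ltac elim_ex_then t k :=
  let H0 := fresh in pose proof t as H0; expose_in H0; try clear t;
  let w' := fresh "w" in let L := fresh in
  apply (hex_elim _ _ _ H0); clear H0; intros w' L; push L; k tt.

Tactic Notation "hex" constr(t) "as" simple_intropattern(x)
    simple_intropattern(p) :=
  elim_ex_then t ltac:(fun _ => intros x; cbv beta; intros p).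

Tactic Notation "hor" constr(t) "as" simple_intropattern(p) "|"
    simple_intropattern(q) :=
  let H0 := fresh in pose proof t as H0; expose_in H0; try clear t;
  let w' := fresh "w" in let L := fresh in
  apply (hor_elim _ _ _ _ H0); clear H0; intros w' L; push L;
  [intros p|intros q].

Tactic Notation "hv" constr(t) "as" simple_intropattern(p) :=
  let H0 := fresh in pose proof t as H0; cbv beta in H0; revert H0; intros p.

Ltac hexists x := expose; apply (hex_intro _ x); cbv beta.
Ltac hleft := expose; apply hor_introl.
Ltac hright := expose; apply hor_intror.
Ltac hbot H := apply (hbot_elim _ _ H).

Ltac hs :=
  cbv beta; repeat (lazymatch goal with |- holds (hand _ _) _ => split end);
  try assumption.

Ltac hap_core H :=
  first
  [ exact H
  | refine (himp_elim H _)
  | refine (hiff_l H _) | refine (hiff_r H _)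
  | refine (hall_elim H _)
  | refine (himp_elim (hall_elim H _) _)
  | refine (halliff_l H _ _) | refine (halliff_r H _ _)
  | refine (himp_elim (himp_elim (hall_elim H _) _) _)
  | refine (himp_elim (hall_elim (hall_elim H _) _) _)
  | refine (himp_elim (himp_elim (hall_elim (hall_elim H _) _) _) _)
  | refine (himp_elim (hall_elim (himp_elim (hall_elim H _) _) _) _) ].
Ltac hap H := hap_core H; cbv beta.

(** * Definable predicates *)

Section Definability.
Context {T : theory}.

(* Names beyond the first [n] variables are constants. *)
Definition good (n : nat) (r : nat -> nat) : Prop := forall c, r (n + c) = c.

Definition tm (n : nat) (t : (nat -> nat) -> nat) : Prop :=
  exists k, forall r, good n r -> t r = r k.

(** The link from semantic predicates back to the schemes; [b] asks for a bounded formula.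
    Parameters of [F] appear as constants, at index [n + c], and need no place among the [n]
    variables. *)
Definition D (b : bool) (n : nat) (F : (nat -> nat) -> hprop) : Prop :=
  exists A, (b = true -> Sigma0 A) /\
    forall r, good n r -> forall w, w ⊩ F r <-> w ⊩ sem A r.

Lemma good_scons n x r : good n r -> good (S n) (x .: r).
Proof. intros H c. apply H. Qed.

Lemma tm_var n k : tm n (fun r => r k).
Proof. exists k. reflexivity. Qed.

Lemma tm_const n c : tm n (fun _ => c).
Proof. exists (n + c). intros r H. now rewrite H. Qed.

Lemma D_equiv b n F G :
  (forall r w, w ⊩ F r <-> w ⊩ G r) -> D b n G -> D b n F.
Proof.
  intros H (A & H1 & H2). exists A. split; [exact H1|].
  intros r Hr w. rewrite H. now apply H2.
Qed.

Lemma D_weaken n F : D true n F -> D false n F.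
Proof. intros (A & _ & H). exists A. split; [discriminate|exact H]. Qed.

Lemma D_mem b n s t : tm n s -> tm n t -> D b n (fun r => mem (s r) (t r)).
Proof.
  intros [i Hi] [j Hj]. exists (Mem i j). split; [constructor|].
  intros r Hr w. rewrite Hi, Hj by assumption. reflexivity.
Qed.

Lemma D_eqs b n s t : tm n s -> tm n t -> D b n (fun r => eqs (s r) (t r)).
Proof.
  intros [i Hi] [j Hj]. exists (Eq i j). split; [constructor|].
  intros r Hr w. rewrite Hi, Hj by assumption. reflexivity.
Qed.

Lemma D_bot b n : D b n (fun r => hbot).
Proof. exists Bot. split; [constructor|]. reflexivity. Qed.

Lemma D_and b n F G : D b n F -> D b n G -> D b n (fun r => hand (F r) (G r)).
Proof.
  intros (A & HA & HF) (B & HB & HG). exists (And A B).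
  split; [intros; constructor; auto|]. intros r Hr w. simpl.
  rewrite HF, HG by assumption. reflexivity.
Qed.

Lemma D_or b n F G : D b n F -> D b n G -> D b n (fun r => hor (F r) (G r)).
Proof.
  intros (A & HA & HF) (B & HB & HG). exists (Or A B).
  split; [intros; constructor; auto|]. intros r Hr w. cbn [sem].
  split; apply hor_mono; intros w' _; (apply HF || apply HG); assumption.
Qed.

Lemma D_imp b n F G : D b n F -> D b n G -> D b n (fun r => himp (F r) (G r)).
Proof.
  intros (A & HA & HF) (B & HB & HG). exists (Imp A B).
  split; [intros; constructor; auto|]. intros r Hr w. cbn [sem].
  split; intros H w' Hw H'; apply HG; auto; apply H; auto; now apply HF.
Qed.

Lemma D_ball b n t F :
  tm n t -> D b (S n) (fun r => F (r 0) (fun k => r (S k))) ->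
  D b n (fun r => hall (fun x => himp (mem x (t r)) (F x r))).
Proof.
  intros [j Hj] (A & HA & HF). exists (All (Imp (Mem 0 (S j)) A)).
  split; [intros; constructor; auto|]. intros r Hr w. cbn [sem scons].
  rewrite <- Hj by assumption.
  split; intros H x w' Hw H'; apply (HF (x .: r)), (H x); auto using good_scons.
Qed.

Lemma D_bex b n t F :
  tm n t -> D b (S n) (fun r => F (r 0) (fun k => r (S k))) ->
  D b n (fun r => hex (fun x => hand (mem x (t r)) (F x r))).
Proof.
  intros [j Hj] (A & HA & HF). exists (Ex (And (Mem 0 (S j)) A)).
  split; [intros; constructor; auto|]. intros r Hr w. cbn [sem scons].
  rewrite <- Hj by assumption.
  split; apply hex_mono; intros w' x _ [Hx H]; (split; [exact Hx|]);
    apply (HF (x .: r)); auto using good_scons.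
Qed.

Lemma D_all n F :
  D false (S n) (fun r => F (r 0) (fun k => r (S k))) ->
  D false n (fun r => hall (fun x => F x r)).
Proof.
  intros (A & HA & HF). exists (All A). split; [discriminate|].
  intros r Hr w. cbn [sem].
  split; intros H x; apply (HF (x .: r)), (H x); auto using good_scons.
Qed.

Lemma D_ex n F :
  D false (S n) (fun r => F (r 0) (fun k => r (S k))) ->
  D false n (fun r => hex (fun x => F x r)).
Proof.
  intros (A & HA & HF). exists (Ex A). split; [discriminate|].
  intros r Hr w. cbn [sem].
  split; apply hex_mono; intros w' x _; apply (HF (x .: r)); auto using good_scons.
Qed.

(** Equality is a forced relation between variables, not identity of names, so rewriting is confined
    to definable predicates, where [EqE] applies. *)
Lemma eqs_subst (F : nat -> hprop) x y w :
  D false 1 (fun r => F (r 0)) -> w ⊩ x ≐ y -> w ⊩ F x -> w ⊩ F y.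
Proof.
  intros (A & _ & HA) E H.
  assert (Hg : forall z, good 1 (z .: fun n => n)) by (intros z c; reflexivity).
  apply (HA (y .: fun n => n)); [apply Hg|]. apply sem_eqs with x; [exact E|].
  apply (HA (x .: fun n => n)); [apply Hg|exact H].
Qed.

Lemma eqs_sym x y w : w ⊩ x ≐ y -> w ⊩ y ≐ x.
Proof.
  intros E. apply (eqs_subst (fun z => eqs z x) x y); [|exact E|apply eqs_refl].
  apply D_eqs; [apply tm_var|apply tm_const].
Qed.

Lemma Sigma0_ren A : Sigma0 A -> forall r, Sigma0 (ren r A).
Proof.
  induction 1; intros r; simpl; try constructor; auto.
Qed.

(** * The axioms *)

Let id_env : nat -> nat := fun n => n.

Lemma extensionality x y w : w ⊩ all z, z ∈ x ⇔ z ∈ y -> w ⊩ x ≐ y.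
Proof.
  intros H. assert (HE := sem_ax Extensionality id_env w (ax_ikp _ ax_ext)).
  exact (himp_elim (hall_elim (hall_elim HE x) y) H).
Qed.

Lemma empty_set w : w ⊩ ex x, all y ∈ x, ⊥.
Proof. exact (sem_ax EmptySet id_env w (ax_ikp _ ax_empty)). Qed.

Lemma pairing a b w : w ⊩ ex p, all x, x ∈ p ⇔ (x ≐ a ∨ x ≐ b).
Proof.
  assert (HE := sem_ax Pairing id_env w (ax_ikp _ ax_pair)).
  exact (hall_elim (hall_elim HE a) b).
Qed.

Lemma unions a w : w ⊩ ex u, all x, x ∈ u ⇔ (ex y ∈ a, x ∈ y).
Proof.
  assert (HE := sem_ax Unions id_env w (ax_ikp _ ax_union)).
  exact (hall_elim HE a).
Qed.

Lemma set_induction (F : nat -> hprop) :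
  D false 1 (fun r => F (r 0)) ->
  forall w, w ⊩ all a, (all x ∈ a, F x) ⇒ F a -> forall a, w ⊩ F a.
Proof.
  intros (A & _ & HA) w H a.
  assert (HF : forall x w, w ⊩ F x <-> w ⊩ sem A (x .: id_env)).
  { intros x v. apply (HA (x .: id_env)). intros c. reflexivity. }
  assert (HE := sem_closure _ id_env w (sem_ax _ id_env w (ax_ikp _ (ax_ind A)))).
  expose_in HE. apply HF. refine (hall_elim (himp_elim HE _) a). clear a.
  hi a Ha. apply HF. hap H. hi x Hx. apply HF.
  assert (Hx' := hball_elim Ha x Hx). apply -> sem_ren in Hx'.
  eapply sem_ext; [|exact Hx']. intros [|n]; reflexivity.
Qed.

Lemma separation (F : nat -> hprop) a :
  D true 1 (fun r => F (r 0)) ->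
  forall w, w ⊩ ex y, all x, x ∈ y ⇔ (x ∈ a ∧ F x).
Proof.
  intros (A & H0 & HA) w.
  assert (HF : forall x w, w ⊩ F x <-> w ⊩ sem A (x .: id_env)).
  { intros x v. apply (HA (x .: id_env)). intros c. reflexivity. }
  (* [up S] frees index 1, which the scheme reserves for the set [a]; the parameters of [F] are
     constants and lie beyond it. *)
  assert (HE := sem_closure _ id_env w (sem_ax _ id_env w
    (ax_ikp _ (ax_sep _ (Sigma0_ren _ (H0 eq_refl) (up S)))))).
  expose_in HE.
  assert (HR : forall x y w,
    w ⊩ sem (ren (up S) (ren (up S) A)) (x .: (y .: (a .: id_env))) <-> w ⊩ F x).
  { intros x y v. rewrite !sem_ren, HF.
    split; apply sem_ext; intros [|n]; reflexivity. }
  hex (hall_elim HE a) as y Hy. hexists y. hi x. split; hi Hx.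
  - destruct (halliff_l Hy x Hx) as [H1 H2]. split; [exact H1|]. now apply HR in H2.
  - destruct Hx as [H1 H2]. hap Hy. split; [exact H1|]. now apply HR.
Qed.

Lemma collection (R : nat -> nat -> hprop) a :
  D true 2 (fun r => R (r 1) (r 0)) ->
  forall w, w ⊩ all x ∈ a, ex y, R x y -> w ⊩ ex b, all x ∈ a, ex y ∈ b, R x y.
Proof.
  intros (A & H0 & HA) w H.
  assert (HF : forall x y w, w ⊩ R x y <-> w ⊩ sem A (y .: (x .: id_env))).
  { intros x y v. apply (HA (y .: (x .: id_env))). intros c. reflexivity. }
  assert (HE := sem_closure _ id_env w (sem_ax _ id_env w
    (ax_ikp _ (ax_coll _ (Sigma0_ren _ (H0 eq_refl) (up (up S))))))).
  expose_in HE. assert (HE' := hall_elim HE a).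
  cbv beta in HE'.
  lazymatch type of HE' with holds (himp ?P _) _ => assert (HP : holds P w) end.
  - hi x Hx. hex (hball_elim H x Hx) as y Hy. hexists y.
    apply HF in Hy. apply sem_ren. eapply sem_ext; [|exact Hy].
    intros [|[|n]]; reflexivity.
  - hex (himp_elim HE' HP) as b Hb. hexists b. hi x Hx.
    hex (hball_elim Hb x Hx) as y Hy.
    destruct Hy as [Hy1 Hy2]. hexists y. split; [exact Hy1|]. apply HF.
    apply -> sem_ren in Hy2. apply -> sem_ren in Hy2.
    eapply sem_ext; [|exact Hy2]. intros [|[|n]]; reflexivity.
Qed.

End Definability.

(** * Substitution of terms and finite quantifiers in definable predicates *)

Section Composition.
Context {T : theory}.

Lemma tm_choice n m (t : nat -> (nat -> nat) -> nat) :
  (forall i, i < m -> tm n (t i)) ->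
  exists f, forall i, i < m -> forall r, good n r -> t i r = r (f i).
Proof.
  induction m as [|m IH]; intros H.
  - exists (fun i => i). intros; lia.
  - destruct IH as [f Hf]; [intros; apply H; lia|].
    destruct (H m) as [k Hk]; [lia|].
    exists (fun i => if i =? m then k else f i). intros i Hi r Hr.
    destruct (Nat.eqb_spec i m) as [->|Hne]; [now apply Hk|apply Hf; [lia|exact Hr]].
Qed.

(** Definability is shown once for generic arguments and carried to arbitrary terms by a renaming,
    which also moves the constants from index [m + c] to [n + c]. *)
Lemma D_app b m n G t :
  D b m G -> (forall i, i < m -> tm n (t i)) ->
  D b n (fun r => G (fun i => if i <? m then t i r else i - m)).
Proof.
  intros (A & H0 & HA) Ht. destruct (tm_choice n m t Ht) as [f Hf].
  exists (ren (fun i => if i <? m then f i else n + (i - m)) A).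
  split; [intros Hb; now apply Sigma0_ren, H0|].
  intros r Hr w. rewrite sem_ren, HA.
  - split; apply sem_ext; intros i; destruct (Nat.ltb_spec i m) as [Hi|Hi];
      rewrite ?Hf by assumption; rewrite ?Hr; reflexivity.
  - intros c. destruct (Nat.ltb_spec (m + c) m); lia.
Qed.

Lemma D_app1 b n F s :
  D b 1 (fun r => F (r 0)) -> tm n s -> D b n (fun r => F (s r)).
Proof.
  intros H Hs. apply (D_app b 1 n _ (fun _ => s) H). auto.
Qed.

Lemma D_app2 b n F s t :
  D b 2 (fun r => F (r 0) (r 1)) -> tm n s -> tm n t ->
  D b n (fun r => F (s r) (t r)).
Proof.
  intros H Hs Ht.
  apply (D_app b 2 n _ (fun i => match i with 0 => s | _ => t end) H).
  intros [|i]; auto.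
Qed.

Lemma D_app3 b n F s t u :
  D b 3 (fun r => F (r 0) (r 1) (r 2)) -> tm n s -> tm n t -> tm n u ->
  D b n (fun r => F (s r) (t r) (u r)).
Proof.
  intros H Hs Ht Hu.
  apply (D_app b 3 n _ (fun i => match i with 0 => s | 1 => t | _ => u end) H).
  intros [|[|i]]; auto.
Qed.

Lemma D_app4 b n F s t u v :
  D b 4 (fun r => F (r 0) (r 1) (r 2) (r 3)) ->
  tm n s -> tm n t -> tm n u -> tm n v ->
  D b n (fun r => F (s r) (t r) (u r) (v r)).
Proof.
  intros H Hs Ht Hu Hv.
  apply (D_app b 4 n _
    (fun i => match i with 0 => s | 1 => t | 2 => u | _ => v end) H).
  intros [|[|[|i]]]; auto.
Qed.

Lemma in_fundops i : In i fundops.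
Proof. destruct i; simpl; tauto. Qed.

(** A quantifier over the thirteen operations belongs to the metalanguage; as a finite conjunction
    it becomes expressible, and costs no unbounded quantifier. [⊥ ⇒ ⊥] stands for truth. *)
Lemma hall_fundop_fold (F : fundop -> hprop) w :
  w ⊩ hall F <-> w ⊩ fold_right (fun i P => hand (F i) P) (⊥ ⇒ ⊥)%H fundops.
Proof.
  split.
  - intros H. generalize fundops. induction l as [|i l IH]; cbn [fold_right In].
    + hi H'. exact H'.
    + split; [exact (hall_elim H i)|exact IH].
  - intros H i. assert (Hi := in_fundops i). revert H Hi.
    generalize fundops. induction l as [|j l IH]; cbn [fold_right In]; [tauto|].
    intros [H1 H2] [->|Hi]; auto.
Qed.

Lemma hex_fundop_fold (F : fundop -> hprop) w :
  w ⊩ hex F <-> w ⊩ fold_right (fun i P => hor (F i) P) ⊥%H fundops.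
Proof.
  split.
  - intros H. hex H as i Hi. assert (Hl := in_fundops i). revert Hl.
    generalize fundops. induction l as [|j l IH]; cbn [fold_right In]; [tauto|].
    intros [->|Hl]; [hleft; exact Hi|hright; auto].
  - generalize fundops. intros l. revert w. induction l as [|i l IH]; cbn [fold_right In];
    intros w H.
    + hbot H.
    + hor H as H | H; [hexists i; exact H|exact (IH _ H)].
Qed.

Lemma D_hall_fundop b n (F : fundop -> (nat -> nat) -> hprop) :
  (forall i, D b n (F i)) -> D b n (fun r => hall (fun i => F i r)).
Proof.
  intros H. eapply D_equiv; [intros r w; apply hall_fundop_fold|].
  generalize fundops. induction l as [|i l IH]; cbn [fold_right In].
  - apply D_imp; apply D_bot.
  - apply D_and; [apply H|exact IH].
Qed.

Lemma D_hex_fundop b n (F : fundop -> (nat -> nat) -> hprop) :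
  (forall i, D b n (F i)) -> D b n (fun r => hex (fun i => F i r)).
Proof.
  intros H. eapply D_equiv; [intros r w; apply hex_fundop_fold|].
  generalize fundops. induction l as [|i l IH]; cbn [fold_right In].
  - apply D_bot.
  - apply D_or; [apply H|exact IH].
Qed.

Lemma D_any b n F : D true n F -> D b n F.
Proof. destruct b; [auto|apply D_weaken]. Qed.

End Composition.

Ltac tm_tac := cbv beta; first [assumption | apply tm_var | apply tm_const].

Create HintDb definable.
Hint Extern 1 (tm _ _) => tm_tac : definable.

Ltac d_hyp :=
  match goal with
  | H : D _ 1 _ |- D _ _ _ =>
    first [apply (D_app1 _ _ _ _ H)
          | apply (D_app1 _ _ _ _ (D_any _ _ _ H))]
  | H : D _ 2 _ |- D _ _ _ =>
    first [apply (D_app2 _ _ _ _ _ H)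
          | apply (D_app2 _ _ _ _ _ (D_any _ _ _ H))]
  | H : D _ 3 _ |- D _ _ _ =>
    first [apply (D_app3 _ _ _ _ _ _ H)
          | apply (D_app3 _ _ _ _ _ _ (D_any _ _ _ H))]
  end.

(** Bounded quantifiers are matched before unbounded ones, since only they preserve boundedness;
    constants are unfolded only when neither a registered nor an assumed definability result
    applies. *)
Ltac dtac :=
  cbv beta;
  lazymatch goal with
  | |- tm _ _ => tm_tac
  | |- D _ _ (fun r => mem _ _) => apply D_mem; tm_tac
  | |- D _ _ (fun r => eqs _ _) => apply D_eqs; tm_tac
  | |- D _ _ (fun r => hbot) => apply D_bot
  | |- D _ _ (fun r => hand _ _) => apply D_and; dtac
  | |- D _ _ (fun r => hor _ _) => apply D_or; dtac
  | |- D _ _ (fun r => himp _ _) => apply D_imp; dtac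
  | |- D _ _ (fun r => hall (fun x => himp (mem x _) _)) => apply D_ball; dtac
  | |- D _ _ (fun r => hex (fun x => hand (mem x _) _)) => apply D_bex; dtac
  | |- D _ _ (fun r => hall _) =>
    first [apply D_all; dtac | apply D_hall_fundop; intros; dtac]
  | |- D _ _ (fun r => hex _) =>
    first [apply D_ex; dtac | apply D_hex_fundop; intros; dtac]
  | |- D _ _ _ =>
    first [ solve [eauto 3 with definable nocore]
          | d_hyp; dtac
          | lazymatch goal with |- D _ _ ?F =>
              let P := eval cbv beta in (F (fun n => n)) in
              let f := head P in unfold f; dtac end ]
  end.

(* Replace [y] by [x] everywhere, for a hypothesis [E : w ⊩ x ≐ y]. *)
Ltac hsubst_goal x y E :=
  lazymatch goal with
  | |- holds ?P ?w =>
    lazymatch P with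
    | context [y] =>
      let F := lazymatch eval pattern y in P with ?F _ => F end in
      apply (eqs_subst F x y w ltac:(dtac) E); cbv beta
    | _ => idtac
    end
  end.

Ltac hsubst_hyps x y E :=
  repeat match goal with
  | H : holds ?P ?w |- _ =>
    lazymatch H with E => fail | _ => idtac end;
    lazymatch P with
    | context [y] =>
      let F := lazymatch eval pattern y in P with ?F _ => F end in
      let H' := fresh in
      pose proof (eqs_subst F y x w ltac:(dtac) (eqs_sym _ _ _ E) H) as H';
      cbv beta in H'; clear H; rename H' into H
    end
  end.

Ltac hsubst E :=
  lazymatch type of E with
  | holds (eqs ?x ?y) ?w =>
    hsubst_goal x y E; hsubst_hyps x y E; clear E; try clear y
  end.

Ltac hsubst_r E := apply eqs_sym in E; hsubst E.

Tactic Notation "heq" := apply eqs_refl.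

(** * Pairs, triples, successors and unions *)

Section Pairs.
Context {T : theory}.

Definition sub (x y : nat) : hprop := all z ∈ x, z ∈ y.
Definition is_empty (x : nat) : hprop := all y ∈ x, ⊥.
Definition upair (p a b : nat) : hprop := all x, x ∈ p ⇔ (x ≐ a ∨ x ≐ b).
Definition opair (p a b : nat) : hprop :=
  ex c, ex d, upair c a a ∧ upair d a b ∧ upair p c d.
Definition otriple (p a b c : nat) : hprop :=
  ex q, opair q b c ∧ opair p a q.
Definition opin (a b x : nat) : hprop := ex p ∈ x, opair p a b.
Definition succ (s x : nat) : hprop := all z, z ∈ s ⇔ (z ∈ x ∨ z ≐ x).
Definition union (u x : nat) : hprop := all z, z ∈ u ⇔ (ex y ∈ x, z ∈ y).

Lemma upair_l p a b w : w ⊩ upair p a b -> w ⊩ a ∈ p.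
Proof. intros H. hap H. hleft. heq. Qed.

Lemma upair_r p a b w : w ⊩ upair p a b -> w ⊩ b ∈ p.
Proof. intros H. hap H. hright. heq. Qed.

Lemma upair_inv p a b x w : w ⊩ upair p a b -> w ⊩ x ∈ p -> w ⊩ x ≐ a ∨ x ≐ b.
Proof. intros H Hx. exact (halliff_l H x Hx). Qed.

Lemma single_inv p a x w : w ⊩ upair p a a -> w ⊩ x ∈ p -> w ⊩ x ≐ a.
Proof. intros H Hx. hor (upair_inv _ _ _ _ _ H Hx) as E | E; exact E. Qed.

(** The definition quantifies over all sets. An equivalent bounded formula separates the two
    inclusions: [a] and [b] are members, and members of [p] are one of them. The same replacement
    recurs for the notions that follow. *)
Lemma D_upair b n s t u :
  tm n s -> tm n t -> tm n u -> D b n (fun r => upair (s r) (t r) (u r)).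
Proof.
  apply D_app3. apply D_equiv with
    (fun r => r 1 ∈ r 0 ∧ r 2 ∈ r 0 ∧ (all x ∈ (r 0), x ≐ r 1 ∨ x ≐ r 2))%H.
  - intros r w. split.
    + intros H. split; [|split].
      * exact (upair_l _ _ _ _ H).
      * exact (upair_r _ _ _ _ H).
      * hi x Hx. exact (upair_inv _ _ _ _ _ H Hx).
    + intros (H1 & H2 & H3). hi x. split.
      * exact (hall_elim H3 x).
      * hi E. hor E as E | E; hsubst_r E; assumption.
  - dtac.
Qed.

Lemma upair_exists a b w : w ⊩ ex p, upair p a b.
Proof. exact (pairing a b w). Qed.

Lemma comprehension_unique (P : nat -> hprop) x y w :
  w ⊩ all z, z ∈ x ⇔ P z -> w ⊩ all z, z ∈ y ⇔ P z -> w ⊩ x ≐ y.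
Proof.
  intros Hx Hy. apply extensionality. hi z. split; hi Hz.
  - hap Hy. hap Hx. exact Hz.
  - hap Hx. hap Hy. exact Hz.
Qed.

Lemma upair_unique p q a b w : w ⊩ upair p a b -> w ⊩ upair q a b -> w ⊩ p ≐ q.
Proof. apply comprehension_unique. Qed.

End Pairs.

Hint Resolve D_upair : definable.

Section OrderedPairs.
Context {T : theory}.

Lemma opair_exists a b w : w ⊩ ex p, opair p a b.
Proof.
  hex (upair_exists a a w) as c Hc. hex (upair_exists a b w) as d Hd.
  hex (upair_exists c d w) as p Hp.
  hexists p. hexists c. hexists d. hs.
Qed.

Lemma opair_unique p q a b w : w ⊩ opair p a b -> w ⊩ opair q a b -> w ⊩ p ≐ q.
Proof.
  intros Hp Hq. hex Hp as c H. hex H as d (Hc & Hd & Hp).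
  hex Hq as c' H. hex H as d' (Hc' & Hd' & Hq).
  hv (upair_unique _ _ _ _ _ Hc Hc') as E. hsubst E.
  hv (upair_unique _ _ _ _ _ Hd Hd') as E. hsubst E.
  exact (upair_unique _ _ _ _ _ Hp Hq).
Qed.

Lemma upair_single_inj p a c d w :
  w ⊩ upair p a a -> w ⊩ upair p c d -> w ⊩ (a ≐ c) ∧ (a ≐ d).
Proof.
  intros H1 H2. split; apply eqs_sym.
  - exact (single_inv _ _ _ _ H1 (upair_l _ _ _ _ H2)).
  - exact (single_inv _ _ _ _ H1 (upair_r _ _ _ _ H2)).
Qed.

Lemma upair_cancel p a b d w :
  w ⊩ upair p a b -> w ⊩ upair p a d -> w ⊩ b ≐ d.
Proof.
  intros H1 H2.
  hor (upair_inv _ _ _ _ _ H2 (upair_r _ _ _ _ H1)) as E | E; [|exact E].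
  hsubst_r E. exact (proj2 (upair_single_inj _ _ _ _ _ H1 H2)).
Qed.

(** Whether [a ≐ b] cannot be decided intuitionistically. Instead, [{a}] is [{c}] or [{c, d}],
    either of which yields [a ≐ c]; the second components then agree by cancelling twice in
    unordered pairs. *)
Lemma opair_inj p a b c d w :
  w ⊩ opair p a b -> w ⊩ opair p c d -> w ⊩ a ≐ c ∧ b ≐ d.
Proof.
  intros H1 H2. hex H1 as s H. hex H as t (Hs & Ht & Hp).
  hex H2 as s' H. hex H as t' (Hs' & Ht' & Hp').
  assert (E : w ⊩ a ≐ c).
  { hor (upair_inv _ _ _ _ _ Hp' (upair_l _ _ _ _ Hp)) as E | E; hsubst_r E.
    - exact (proj1 (upair_single_inj _ _ _ _ _ Hs Hs')).
    - exact (proj1 (upair_single_inj _ _ _ _ _ Hs Ht')). }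
  hsubst E. split; [heq|].
  hv (upair_unique _ _ _ _ _ Hs Hs') as E. hsubst E.
  hv (upair_cancel _ _ _ _ _ Hp Hp') as E. hsubst E.
  exact (upair_cancel _ _ _ _ _ Ht Ht').
Qed.

Lemma D_opair b n s t u :
  tm n s -> tm n t -> tm n u -> D b n (fun r => opair (s r) (t r) (u r)).
Proof.
  apply D_app3. apply D_equiv with
    (fun r => ex c ∈ (r 0), ex d ∈ (r 0),
       upair c (r 1) (r 1) ∧ upair d (r 1) (r 2) ∧ upair (r 0) c d)%H.
  - intros r w. split; intros H.
    + hex H as c H. hex H as d (H1 & H2 & H3). hexists c.
      split; [exact (upair_l _ _ _ _ H3)|]. hexists d.
      split; [exact (upair_r _ _ _ _ H3)|]. hs.
    + hex H as c [_ H]. hex H as d [_ H]. hexists c. hexists d. exact H.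
  - dtac.
Qed.

Lemma D_opin b n s t u :
  tm n s -> tm n t -> tm n u -> D b n (fun r => opin (s r) (t r) (u r)).
Proof.
  apply D_app3. unfold opin. apply D_bex; [dtac|].
  cbv beta. apply D_opair; dtac.
Qed.

(** The member [{a, b}] of the pair contains both components, so quantifiers over components can be
    bounded in terms of [p]. *)
Lemma opair_depth p a b w :
  w ⊩ opair p a b -> w ⊩ ex d ∈ p, a ∈ d ∧ b ∈ d.
Proof.
  intros H. hex H as c H. hex H as d (H1 & H2 & H3). hexists d.
  split; [exact (upair_r _ _ _ _ H3)|].
  split; [exact (upair_l _ _ _ _ H2)|exact (upair_r _ _ _ _ H2)].
Qed.

Lemma D_otriple b n s t u v :
  tm n s -> tm n t -> tm n u -> tm n v ->
  D b n (fun r => otriple (s r) (t r) (u r) (v r)).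
Proof.
  apply D_app4. apply D_equiv with
    (fun r => ex d ∈ (r 0), ex q ∈ d, opair q (r 2) (r 3) ∧ opair (r 0) (r 1) q)%H.
  - intros r w. split; intros H.
    + hex H as q (H1 & H2). hex (opair_depth _ _ _ _ H2) as d (Hd & _ & Hq).
      hexists d. split; [exact Hd|]. hexists q. split; [exact Hq|]. hs.
    + hex H as d [_ H]. hex H as q [_ H]. hexists q. exact H.
  - apply D_bex; [dtac|]. cbv beta. apply D_bex; [dtac|]. cbv beta.
    apply D_and; apply D_opair; dtac.
Qed.

Lemma otriple_exists a b c w : w ⊩ ex p, otriple p a b c.
Proof.
  hex (opair_exists b c w) as q Hq. hex (opair_exists a q w) as p Hp.
  hexists p. hexists q. hs.
Qed.

Lemma otriple_inj p a b c a' b' c' w :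
  w ⊩ otriple p a b c -> w ⊩ otriple p a' b' c' ->
  w ⊩ a ≐ a' ∧ b ≐ b' ∧ c ≐ c'.
Proof.
  intros H1 H2. hex H1 as q [Hq Hp]. hex H2 as q' [Hq' Hp'].
  destruct (opair_inj _ _ _ _ _ _ Hp Hp') as [E E']. hsubst E'.
  split; [exact E|exact (opair_inj _ _ _ _ _ _ Hq Hq')].
Qed.

Lemma D_succ b n s t : tm n s -> tm n t -> D b n (fun r => succ (s r) (t r)).
Proof.
  apply D_app2. apply D_equiv with
    (fun r => (all z ∈ (r 0), z ∈ r 1 ∨ z ≐ r 1) ∧ (all z ∈ (r 1), z ∈ r 0) ∧ r 1 ∈ r 0)%H.
  - intros r w. split; intros H.
    + split; [|split].
      * hi z Hz. hap H. exact Hz.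
      * hi z Hz. hap H. hleft. exact Hz.
      * hap H. hright. heq.
    + destruct H as (H1 & H2 & H3). hi z. split.
      * exact (hall_elim H1 z).
      * hi Hz. hor Hz as Hz | E; [hap H2; exact Hz|hsubst_r E; exact H3].
  - dtac.
Qed.

Lemma D_union b n s t : tm n s -> tm n t -> D b n (fun r => union (s r) (t r)).
Proof.
  apply D_app2. apply D_equiv with
    (fun r => (all z ∈ (r 0), ex y ∈ (r 1), z ∈ y) ∧ (all y ∈ (r 1), all z ∈ y, z ∈ r 0))%H.
  - intros r w. split; intros H.
    + split.
      * hi z Hz. hap H. exact Hz.
      * hi y Hy z Hz. hap H. hexists y. hs.
    + destruct H as (H1 & H2). hi z. split.
      * exact (hall_elim H1 z).
      * hi Hz. hex Hz as y [Hy Hz]. hap H2; eassumption.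
  - dtac.
Qed.

Lemma union_exists a w : w ⊩ ex u, union u a.
Proof. exact (unions a w). Qed.

Lemma succ_exists x w : w ⊩ ex s, succ s x.
Proof.
  hex (upair_exists x x w) as p Hp. hex (upair_exists x p w) as q Hq.
  hex (union_exists q w) as s Hs. hexists s. hi z. split; hi Hz.
  - hex (halliff_l Hs z Hz) as y [Hy Hzy].
    hor (upair_inv _ _ _ _ _ Hq Hy) as E | E; hsubst_r E.
    + hleft. exact Hzy.
    + hright. exact (single_inv _ _ _ _ Hp Hzy).
  - hap Hs. hor Hz as Hz | Hz.
    + hexists x. split; [exact (upair_l _ _ _ _ Hq)|exact Hz].
    + hexists p. split; [exact (upair_r _ _ _ _ Hq)|].
      hsubst Hz. exact (upair_l _ _ _ _ Hp).
Qed.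

End OrderedPairs.

Hint Resolve D_opair D_opin D_otriple D_succ D_union : definable.

(** * Sigma1 predicates *)

Section SigmaOne.
Context {T : theory}.

Definition S1 (n : nat) (F : (nat -> nat) -> hprop) : Prop :=
  exists A, Sigma0 A /\
    forall r, good n r -> forall w, w ⊩ F r <-> w ⊩ ex z, sem A (z .: r).

Lemma S1_equiv n F G :
  (forall r w, w ⊩ F r <-> w ⊩ G r) -> S1 n G -> S1 n F.
Proof.
  intros H (A & H1 & H2). exists A. split; [exact H1|].
  intros r Hr w. rewrite H. now apply H2.
Qed.

Lemma S1_D n F : D true n F -> S1 n F.
Proof.
  intros (A & H0 & HA). exists (ren S A). split; [now apply Sigma0_ren, H0|].
  intros r Hr w. rewrite HA by assumption. split.
  (* The shifted formula does not mention the added variable, so any name is a witness. *)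
  - intros H. hexists 0. apply sem_ren. exact H.
  - intros H. hex H as z H. apply -> sem_ren in H. exact H.
Qed.

Lemma sem_up A z y r w :
  w ⊩ sem (ren (up S) A) (z .: (y .: r)) <-> w ⊩ sem A (z .: r).
Proof. rewrite sem_ren. split; apply sem_ext; intros [|n]; reflexivity. Qed.

Lemma sem_upup A z y x r w :
  w ⊩ sem (ren (up (up S)) A) (z .: (y .: (x .: r))) <-> w ⊩ sem A (z .: (y .: r)).
Proof. rewrite sem_ren. split; apply sem_ext; intros [|[|n]]; reflexivity. Qed.

(** A single leading quantifier is recovered by letting it range over sets that contain both
    witnesses, such as their pair. *)
Lemma S1_and n F G : S1 n F -> S1 n G -> S1 n (fun r => hand (F r) (G r)).
Proof.
  intros (A & HA & HF) (B & HB & HG).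
  exists (And (Ex (And (Mem 0 1) (ren (up S) A))) (Ex (And (Mem 0 1) (ren (up S) B)))).
  split; [constructor; (apply (Sigma0_Ex 0)); now apply Sigma0_ren|].
  intros r Hr w. cbn [sem scons]. split.
  - intros [H1 H2]. apply HF in H1; [|exact Hr]. apply HG in H2; [|exact Hr].
    hex H1 as x Hx. hex H2 as y Hy. hex (upair_exists x y w) as p Hp.
    hexists p. split.
    + hexists x. split; [exact (upair_l _ _ _ _ Hp)|now apply sem_up].
    + hexists y. split; [exact (upair_r _ _ _ _ Hp)|now apply sem_up].
  - intros H. hex H as p [H1 H2]. hex H1 as x [_ Hx]. hex H2 as y [_ Hy].
    apply -> sem_up in Hx. apply -> sem_up in Hy. split.
    + apply HF; [exact Hr|]. hexists x. exact Hx.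
    + apply HG; [exact Hr|]. hexists y. exact Hy.
Qed.

Lemma S1_or n F G : S1 n F -> S1 n G -> S1 n (fun r => hor (F r) (G r)).
Proof.
  intros (A & HA & HF) (B & HB & HG). exists (Or A B).
  split; [now constructor|]. intros r Hr w. cbn [sem]. split; intros H.
  - hor H as H | H; [apply HF in H|apply HG in H]; try exact Hr; hex H as z H;
      hexists z; [hleft|hright]; exact H.
  - hex H as z H. hor H as H | H; [hleft; apply HF|hright; apply HG]; try exact Hr;
      hexists z; exact H.
Qed.

Lemma S1_ex n F :
  S1 (S n) (fun r => F (r 0) (fun k => r (S k))) ->
  S1 n (fun r => hex (fun x => F x r)).
Proof.
  intros (A & HA & HF).
  exists (Ex (And (Mem 0 1) (Ex (And (Mem 0 2) (ren (up (up S)) A))))).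
  split; [apply (Sigma0_Ex 0), (Sigma0_Ex 1); now apply Sigma0_ren|].
  intros r Hr w. cbn [sem scons]. split; intros H.
  - hex H as x Hx. apply (HF (x .: r)) in Hx; [|now apply good_scons].
    hex Hx as z Hz. hex (upair_exists x z w) as p Hp. hexists p.
    hexists x. split; [exact (upair_l _ _ _ _ Hp)|].
    hexists z. split; [exact (upair_r _ _ _ _ Hp)|]. now apply sem_upup.
  - hex H as p H. hex H as x [_ H]. hex H as z [_ H]. apply -> sem_upup in H.
    hexists x. apply (HF (x .: r)); [now apply good_scons|]. hexists z. exact H.
Qed.

Lemma S1_bex n t F :
  tm n t -> S1 (S n) (fun r => F (r 0) (fun k => r (S k))) ->
  S1 n (fun r => hex (fun x => hand (mem x (t r)) (F x r))).
Proof.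
  intros [j Hj] H.
  destruct (S1_ex n (fun x r => hand (mem x (r j)) (F x r))) as (A & HA & HF).
  - apply S1_and; [apply S1_D; dtac|exact H].
  - exists A. split; [exact HA|]. intros r Hr w. rewrite Hj by exact Hr. now apply HF.
Qed.

(** Collection gives one set with a witness for every member of the range, which brings the
    unbounded quantifier to the front. *)
Lemma S1_ball n t F :
  tm n t -> S1 (S n) (fun r => F (r 0) (fun k => r (S k))) ->
  S1 n (fun r => hall (fun x => himp (mem x (t r)) (F x r))).
Proof.
  intros [j Hj] (A & HA & HF).
  exists (All (Imp (Mem 0 (S (S j))) (Ex (And (Mem 0 2) (ren (up (up S)) A))))).
  split; [apply (Sigma0_All (S j)), (Sigma0_Ex 1); now apply Sigma0_ren|].
  intros r Hr w. cbn [sem scons]. rewrite Hj by exact Hr. split; intros H.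
  (* For fixed [r] the values [r k] are constants, found at index [2 + r k] of an environment for
     two variables. *)
  - assert (HS : D true 2 (fun s => sem A (s 0 .: (s 1 .: r)))).
    { exists (ren (fun i => match i with 0 => 0 | 1 => 1 | S (S k) => 2 + r k end) A).
      split; [intros _; now apply Sigma0_ren|]. intros s Hs v. rewrite sem_ren.
      split; apply sem_ext; intros [|[|k]]; simpl; auto;
        (apply (Hs (r k)) || (symmetry; apply (Hs (r k)))). }
    assert (Hc := collection (fun x z => sem A (z .: (x .: r))) (r j) HS).
    assert (H' : w ⊩ all x ∈ (r j), ex z, sem A (z .: (x .: r))).
    { hi x Hx. apply (HF (x .: r)); [now apply good_scons|]. exact (hball_elim H x Hx). }
    hex (Hc w H') as b Hb. hexists b. hi x Hx. hex (hball_elim Hb x Hx) as z [Hz1 Hz2].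
    hexists z. split; [exact Hz1|]. now apply sem_upup.
  - hex H as b Hb. hi x Hx. hex (hball_elim Hb x Hx) as z [_ Hz].
    apply -> sem_upup in Hz.
    apply (HF (x .: r)); [now apply good_scons|]. hexists z. exact Hz.
Qed.

(** Collection is applied to sets [s] holding a value together with a Sigma1 witness for it. Once
    the witnesses are bounded by the collected sets, bounded separation discards all other elements
    of the union. *)
Lemma strong_collection (R : nat -> nat -> hprop) a :
  S1 2 (fun r => R (r 1) (r 0)) ->
  forall w, w ⊩ all x ∈ a, ex y, R x y ->
  w ⊩ ex b, (all x ∈ a, ex y ∈ b, R x y) ∧ (all y ∈ b, ex x ∈ a, R x y).
Proof.
  intros (A & HA & HF) w H.
  set (M := fun z y x => sem A (z .: (y .: (x .: (fun n => n))))).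
  assert (HM : forall x y w, w ⊩ R x y <-> w ⊩ ex z, M z y x).
  { intros x y v. apply (HF (y .: (x .: (fun n => n)))). intros c; reflexivity. }
  assert (DM : D true 3 (fun r => M (r 0) (r 1) (r 2))).
  { exists A. split; [auto|]. intros r Hr v. unfold M.
    split; apply sem_ext; intros [|[|[|n]]]; simpl; auto;
        (apply (Hr n) || (symmetry; apply (Hr n))). }
  clearbody M. clear A HA HF.
  assert (H' : w ⊩ all x ∈ a, ex s, ex y ∈ s, ex z ∈ s, M z y x).
  { hi x Hx. hex (hball_elim H x Hx) as y Hy. apply HM in Hy. hex Hy as z Hz.
    hex (upair_exists y z w) as s Hs. hexists s. hexists y.
    split; [exact (upair_l _ _ _ _ Hs)|]. hexists z.
    split; [exact (upair_r _ _ _ _ Hs)|exact Hz]. }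
  apply collection in H'; [|dtac]. hex H' as b Hb. hex (union_exists b w) as u Hu.
  hex (separation (fun y => ex x ∈ a, ex s ∈ b, ex z ∈ s, M z y x)%H u ltac:(dtac) w)
    as c Hc.
  hexists c. split.
  - hi x Hx. hex (hball_elim Hb x Hx) as s [Hs H1]. hex H1 as y [Hy H1].
    hex H1 as z [Hz Hz']. hexists y. split.
    + hap Hc. split.
      * hap Hu. hexists s. hs.
      * hexists x. split; [exact Hx|]. hexists s. split; [exact Hs|].
        hexists z. hs.
    + apply HM. hexists z. exact Hz'.
  - hi y Hy. destruct (halliff_l Hc y Hy) as [_ H1]. hex H1 as x [Hx H1].
    hex H1 as s [_ H1]. hex H1 as z [_ H1]. hexists x. split; [exact Hx|].
    apply HM. hexists z. exact H1.
Qed.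

End SigmaOne.

Section SigmaOneComposition.
Context {T : theory}.

Lemma S1_app m n G t :
  S1 m G -> (forall i, i < m -> tm n (t i)) ->
  S1 n (fun r => G (fun i => if i <? m then t i r else i - m)).
Proof.
  intros (A & HA & HG) Ht. destruct (tm_choice n m t Ht) as [f Hf].
  exists (ren (up (fun i => if i <? m then f i else n + (i - m))) A).
  split; [now apply Sigma0_ren|].
  intros r Hr w. rewrite HG.
  - split; apply hex_mono; intros w' x _; rewrite sem_ren; apply sem_ext;
      (intros [|i]; [reflexivity|]); simpl; destruct (Nat.ltb_spec i m) as [Hi|Hi];
      rewrite ?Hf by assumption; rewrite ?Hr; reflexivity.
  - intros c. destruct (Nat.ltb_spec (m + c) m); lia.
Qed.

Lemma S1_app1 n F s :
  S1 1 (fun r => F (r 0)) -> tm n s -> S1 n (fun r => F (s r)).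
Proof. intros H Hs. apply (S1_app 1 n _ (fun _ => s) H). auto. Qed.

Lemma S1_app2 n F s t :
  S1 2 (fun r => F (r 0) (r 1)) -> tm n s -> tm n t ->
  S1 n (fun r => F (s r) (t r)).
Proof.
  intros H Hs Ht.
  apply (S1_app 2 n _ (fun i => match i with 0 => s | _ => t end) H).
  intros [|i]; auto.
Qed.

Lemma S1_app3 n F s t u :
  S1 3 (fun r => F (r 0) (r 1) (r 2)) -> tm n s -> tm n t -> tm n u ->
  S1 n (fun r => F (s r) (t r) (u r)).
Proof.
  intros H Hs Ht Hu.
  apply (S1_app 3 n _ (fun i => match i with 0 => s | 1 => t | _ => u end) H).
  intros [|[|i]]; auto.
Qed.

End SigmaOneComposition.

Ltac stac :=
  cbv beta;
  lazymatch goal with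
  | |- tm _ _ => tm_tac
  | |- S1 _ (fun r => hand _ _) => apply S1_and; stac
  | |- S1 _ (fun r => hor _ _) => apply S1_or; stac
  | |- S1 _ (fun r => hall (fun x => himp (mem x _) _)) => apply S1_ball; stac
  | |- S1 _ (fun r => hex (fun x => hand (mem x _) _)) => apply S1_bex; stac
  | |- S1 _ (fun r => hex (fun x : nat => _)) => apply S1_ex; stac
  | _ => first
    [ solve [eauto 3 with definable nocore]
    | match goal with H : S1 2 (fun r => ?R (r 1) (r 0)) |- _ =>
        refine (S1_app2 _ (fun y x => R x y) _ _ H _ _); tm_tac end
    | apply S1_D; solve [dtac]
    | lazymatch goal with |- S1 _ ?F =>
        let P := eval cbv beta in (F (fun n => n)) in
        let f := head P in unfold f; stac end ]
  end.

(** * The fundamental operations *)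

Section Operations.
Context {T : theory}.

Definition fiber (u a x : nat) : hprop := all v, v ∈ u ⇔ opin a v x.

Definition infund (i : fundop) (u x y : nat) : hprop :=
  match i with
  | F_pair => u ≐ x ∨ u ≐ y
  | F_inter => u ∈ x ∧ all z ∈ y, u ∈ z
  | F_union => ex z ∈ x, u ∈ z
  | F_diff => u ∈ x ∧ (u ∈ y ⇒ ⊥)
  | F_prod => ex a ∈ x, ex b ∈ y, opair u a b
  | F_imp => u ∈ x ∧ ex a, ex b, opair y a b ∧ (u ∈ a ⇒ u ∈ b)
  | F_all => ex a ∈ y, fiber u a x
  | F_dom => ex b, opin u b x
  | F_ran => ex a, opin a u x
  | F_123 => ex a, ex b, ex c, otriple u a b c ∧ opin a b x ∧ c ∈ y
  | F_132 => ex a, ex b, ex c, otriple u a c b ∧ opin a b x ∧ c ∈ y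
  | F_eq => ex v ∈ y, ex z ∈ x, opair u v z ∧ z ≐ v
  | F_mem => ex v ∈ y, ex z ∈ x, opair u v z ∧ z ∈ v
  end.

Definition isfund (i : fundop) (z x y : nat) : hprop :=
  all u, u ∈ z ⇔ infund i u x y.

Lemma sem_in_fundop i u x y r w :
  w ⊩ sem (in_fundop i u x y) r <-> w ⊩ infund i (r u) (r x) (r y).
Proof.
  destruct i; unfold in_fundop, otriple, opin, opair, upair, opair_in, is_otriple,
    is_opair, is_upair; cbn [sem scons Nat.add]; reflexivity.
Qed.

Lemma sem_is_fundop i z x y r w :
  w ⊩ sem (is_fundop i z x y) r <-> w ⊩ isfund i (r z) (r x) (r y).
Proof.
  unfold is_fundop, isfund. cbn [sem scons].
  split; intros H u; (split; [hi Hu|hi Hu]).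
  - apply (sem_in_fundop i 0 (S x) (S y) (u .: r)). exact (hiff_l (H u) Hu).
  - apply (hiff_r (H u)). apply (sem_in_fundop i 0 (S x) (S y) (u .: r)). exact Hu.
  - apply (sem_in_fundop i 0 (S x) (S y) (u .: r)). exact (hiff_l (H u) Hu).
  - apply (hiff_r (H u)). apply (sem_in_fundop i 0 (S x) (S y) (u .: r)). exact Hu.
Qed.

Lemma D_fiber b n s t u :
  tm n s -> tm n t -> tm n u -> D b n (fun r => fiber (s r) (t r) (u r)).
Proof.
  apply D_app3. apply D_equiv with
    (fun r => (all v ∈ (r 0), opin (r 1) v (r 2)) ∧
       (all p ∈ (r 2), all d ∈ p, all v ∈ d, opair p (r 1) v ⇒ v ∈ r 0))%H.
  - intros r w. split; intros H.
    + split.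
      * hi v Hv. hap H. exact Hv.
      * hi p Hp d Hd. hi v Hv Hvp. hap H. hexists p. hs.
    + destruct H as [H1 H2]. hi v. split; [exact (hall_elim H1 v)|].
      hi Hv. hex Hv as p [Hp Hv]. hex (opair_depth _ _ _ _ Hv) as d (Hd & _ & Hvd).
      exact (himp_elim (hball_elim (hball_elim (hball_elim H2 p Hp) d Hd) v Hvd) Hv).
  - dtac.
Qed.

Lemma fiber_exists a x w : w ⊩ ex u, fiber u a x.
Proof.
  hex (union_exists x w) as y Hy. hex (union_exists y w) as z Hz.
  hex (separation (fun v => opin a v x) z ltac:(dtac) w) as u Hu.
  hexists u. hi v. split; hi Hv.
  - exact (proj2 (halliff_l Hu v Hv)).
  - hap Hu. split; [|exact Hv].
    hex Hv as p [Hp Hv]. hex (opair_depth _ _ _ _ Hv) as d (Hd & _ & Hvd).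
    hap Hz. hexists d. split; [|exact Hvd]. hap Hy. hexists p. hs.
Qed.

Lemma fiber_unique u v a x w : w ⊩ fiber u a x -> w ⊩ fiber v a x -> w ⊩ u ≐ v.
Proof. apply comprehension_unique. Qed.

(* Bounded equivalents of [infund] and of the inclusion of F_i(x, y) in [z]. *)
Definition infund0 (i : fundop) (u x y : nat) : hprop :=
  match i with
  | F_imp => u ∈ x ∧ ex d ∈ y, ex a ∈ d, ex b ∈ d, opair y a b ∧ (u ∈ a ⇒ u ∈ b)
  | F_dom => ex p ∈ x, ex d ∈ p, ex b ∈ d, opair p u b
  | F_ran => ex p ∈ x, ex d ∈ p, ex a ∈ d, opair p a u
  | F_123 => ex p ∈ x, ex d ∈ p, ex a ∈ d, ex b ∈ d, opair p a b ∧
      ex c ∈ y, otriple u a b c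
  | F_132 => ex p ∈ x, ex d ∈ p, ex a ∈ d, ex b ∈ d, opair p a b ∧
      ex c ∈ y, otriple u a c b
  | _ => infund i u x y
  end.

Definition supfund0 (i : fundop) (z x y : nat) : hprop :=
  match i with
  | F_pair => x ∈ z ∧ y ∈ z
  | F_inter => all u ∈ x, (all v ∈ y, u ∈ v) ⇒ u ∈ z
  | F_union => all v ∈ x, all u ∈ v, u ∈ z
  | F_diff => all u ∈ x, (u ∈ y ⇒ ⊥) ⇒ u ∈ z
  | F_prod => all a ∈ x, all b ∈ y, ex u ∈ z, opair u a b
  | F_imp => all u ∈ x, infund0 F_imp u x y ⇒ u ∈ z
  | F_all => all a ∈ y, ex u ∈ z, fiber u a x
  | F_dom => all p ∈ x, all d ∈ p, all a ∈ d, all b ∈ d, opair p a b ⇒ a ∈ z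
  | F_ran => all p ∈ x, all d ∈ p, all a ∈ d, all b ∈ d, opair p a b ⇒ b ∈ z
  | F_123 => all p ∈ x, all d ∈ p, all a ∈ d, all b ∈ d, opair p a b ⇒
      all c ∈ y, ex u ∈ z, otriple u a b c
  | F_132 => all p ∈ x, all d ∈ p, all a ∈ d, all b ∈ d, opair p a b ⇒
      all c ∈ y, ex u ∈ z, otriple u a c b
  | F_eq => all a ∈ y, all b ∈ x, b ≐ a ⇒ ex u ∈ z, opair u a b
  | F_mem => all a ∈ y, all b ∈ x, b ∈ a ⇒ ex u ∈ z, opair u a b
  end.

Lemma infund0_iff i u x y w : w ⊩ infund i u x y <-> w ⊩ infund0 i u x y.
Proof.
  destruct i; try reflexivity; split; intros H.
  - destruct H as [H1 H]. split; [exact H1|]. hex H as a H. hex H as b [Hy H].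
    hex (opair_depth _ _ _ _ Hy) as d (Hd & Ha & Hb).
    hexists d. hs. hexists a. hs. hexists b. hs.
  - destruct H as [H1 H]. split; [exact H1|]. hex H as d [Hd H]. hex H as a [Ha H].
    hex H as b [Hb H]. hexists a. hexists b. exact H.
  - hex H as b H. hex H as p [Hp H].
    hex (opair_depth _ _ _ _ H) as d (Hd & Ha & Hb).
    hexists p. hs. hexists d. hs. hexists b. hs.
  - hex H as p [Hp H]. hex H as d [Hd H]. hex H as b [Hb H].
    hexists b. hexists p. hs.
  - hex H as a H. hex H as p [Hp H].
    hex (opair_depth _ _ _ _ H) as d (Hd & Ha & Hb).
    hexists p. hs. hexists d. hs. hexists a. hs.
  - hex H as p [Hp H]. hex H as d [Hd H]. hex H as a [Ha H].
    hexists a. hexists p. hs.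
  - hex H as a H. hex H as b H. hex H as c (Hu & H & Hc). hex H as p [Hp H].
    hex (opair_depth _ _ _ _ H) as d (Hd & Ha & Hb).
    hexists p. hs. hexists d. hs. hexists a. hs. hexists b. hs. hexists c. hs.
  - hex H as p [Hp H]. hex H as d [Hd H]. hex H as a [Ha H]. hex H as b (Hb & Hpab & H).
    hex H as c [Hc H]. hexists a. hexists b. hexists c. hs. hexists p. hs.
  - hex H as a H. hex H as b H. hex H as c (Hu & H & Hc). hex H as p [Hp H].
    hex (opair_depth _ _ _ _ H) as d (Hd & Ha & Hb).
    hexists p. hs. hexists d. hs. hexists a. hs. hexists b. hs. hexists c. hs.
  - hex H as p [Hp H]. hex H as d [Hd H]. hex H as a [Ha H]. hex H as b (Hb & Hpab & H).
    hex H as c [Hc H]. hexists a. hexists b. hexists c. hs. hexists p. hs.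
Qed.

End Operations.

Hint Resolve D_fiber : definable.

Section OperationsExist.
Context {T : theory}.

Lemma D_infund i b n s t u :
  tm n s -> tm n t -> tm n u -> D b n (fun r => infund i (s r) (t r) (u r)).
Proof.
  apply D_app3. apply D_equiv with (fun r => infund0 i (r 0) (r 1) (r 2)).
  - intros r w. apply infund0_iff.
  - destruct i; cbn [infund0 infund]; dtac.
Qed.

Lemma otriple_unique p q a b c w :
  w ⊩ otriple p a b c -> w ⊩ otriple q a b c -> w ⊩ p ≐ q.
Proof.
  intros H1 H2. hex H1 as r [Hr Hp]. hex H2 as s [Hs Hq].
  hv (opair_unique _ _ _ _ _ Hr Hs) as E. hsubst E.
  exact (opair_unique _ _ _ _ _ Hp Hq).
Qed.

Local Hint Resolve D_infund : definable.

(** Pairs, triples and fibers exist and are unique, so requiring that every such set lie in [z]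
    amounts to a bounded existential over [z]. *)
Lemma supfund0_iff i z x y w :
  w ⊩ all u, infund i u x y ⇒ u ∈ z <-> w ⊩ supfund0 i z x y.
Proof.
  destruct i; split; intros H.
  - split; hap H; [hleft|hright]; heq.
  - destruct H as [Hx Hy]. hi u Hu. hor Hu as E | E; hsubst_r E; assumption.
  - hi u Hu Hv. hap H. split; assumption.
  - hi u Hu. destruct Hu as [H1 H2].
    exact (himp_elim (hball_elim H u H1) H2).
  - hi v Hv u Hu. hap H. hexists v. hs.
  - hi u Hu. hex Hu as v [Hv Hu].
    exact (hball_elim (hball_elim H v Hv) u Hu).
  - hi u Hu Hv. hap H. split; assumption.
  - hi u Hu. destruct Hu as [H1 H2].
    exact (himp_elim (hball_elim H u H1) H2).
  - hi a Ha b Hb. hex (opair_exists a b w) as u Hu. hexists u. hs. hap H.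
    hexists a. hs. hexists b. hs.
  - hi u Hu. hex Hu as a [Ha Hu]. hex Hu as b [Hb Hu].
    hex (hball_elim (hball_elim H a Ha) b Hb) as v [Hv Hv'].
    hv (opair_unique _ _ _ _ _ Hv' Hu) as E. hsubst E. exact Hv.
  - hi u Hu Hv. hap H. apply infund0_iff. exact Hv.
  - hi u Hu. apply infund0_iff in Hu.
    exact (himp_elim (hball_elim H u (proj1 Hu)) Hu).
  - hi a Ha. hex (fiber_exists a x w) as u Hu. hexists u. hs. hap H. hexists a. hs.
  - hi u Hu. hex Hu as a [Ha Hu]. hex (hball_elim H a Ha) as v [Hv Hv'].
    hv (fiber_unique _ _ _ _ _ Hv' Hu) as E. hsubst E. exact Hv.
  - hi p Hp d Hd. hi a Ha b Hb. hi Hpab. hap H. hexists b. hexists p. hs.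
  - hi a Ha. hex Ha as b Hb. hex Hb as p [Hp Hpab].
    hex (opair_depth _ _ _ _ Hpab) as d (Hd & Ha & Hb).
    exact (himp_elim (hball_elim (hball_elim (hball_elim (hball_elim H p Hp) d Hd) a Ha) b Hb)
      Hpab).
  - hi p Hp d Hd. hi a Ha b Hb. hi Hpab. hap H. hexists a. hexists p. hs.
  - hi b Hb. hex Hb as a Ha. hex Ha as p [Hp Hpab].
    hex (opair_depth _ _ _ _ Hpab) as d (Hd & Ha & Hb).
    exact (himp_elim (hball_elim (hball_elim (hball_elim (hball_elim H p Hp) d Hd) a Ha) b Hb)
      Hpab).
  - hi p Hp d Hd. hi a Ha b Hb. hi Hpab c Hc. hex (otriple_exists a b c w) as u Hu.
    hexists u. hs. hap H. hexists a. hexists b. hexists c. hs. hexists p. hs.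
  - hi u Hu. hex Hu as a Hu. hex Hu as b Hu. hex Hu as c (Hu & Hab & Hc).
    hex Hab as p [Hp Hpab]. hex (opair_depth _ _ _ _ Hpab) as d (Hd & Ha & Hb).
    hv (himp_elim (hball_elim (hball_elim (hball_elim (hball_elim H p Hp) d Hd) a Ha) b Hb)
      Hpab) as H'.
    hex (hball_elim H' c Hc) as v [Hv Hv'].
    hv (otriple_unique _ _ _ _ _ _ Hv' Hu) as E. hsubst E. exact Hv.
  - hi p Hp d Hd. hi a Ha b Hb. hi Hpab c Hc. hex (otriple_exists a c b w) as u Hu.
    hexists u. hs. hap H. hexists a. hexists b. hexists c. hs. hexists p. hs.
  - hi u Hu. hex Hu as a Hu. hex Hu as b Hu. hex Hu as c (Hu & Hab & Hc).
    hex Hab as p [Hp Hpab]. hex (opair_depth _ _ _ _ Hpab) as d (Hd & Ha & Hb).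
    hv (himp_elim (hball_elim (hball_elim (hball_elim (hball_elim H p Hp) d Hd) a Ha) b Hb)
      Hpab) as H'.
    hex (hball_elim H' c Hc) as v [Hv Hv'].
    hv (otriple_unique _ _ _ _ _ _ Hv' Hu) as E. hsubst E. exact Hv.
  - hi a Ha b Hb. hi E. hex (opair_exists a b w) as u Hu. hexists u. hs. hap H.
    hexists a. hs. hexists b. hs.
  - hi u Hu. hex Hu as a [Ha Hu]. hex Hu as b (Hb & Hu & E).
    hex (himp_elim (hball_elim (hball_elim H a Ha) b Hb) E) as v [Hv Hv'].
    hv (opair_unique _ _ _ _ _ Hv' Hu) as E'. hsubst E'. exact Hv.
  - hi a Ha b Hb. hi E. hex (opair_exists a b w) as u Hu. hexists u. hs. hap H.
    hexists a. hs. hexists b. hs.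
  - hi u Hu. hex Hu as a [Ha Hu]. hex Hu as b (Hb & Hu & E).
    hex (himp_elim (hball_elim (hball_elim H a Ha) b Hb) E) as v [Hv Hv'].
    hv (opair_unique _ _ _ _ _ Hv' Hu) as E'. hsubst E'. exact Hv.
Qed.

Lemma D_isfund i b n s t u :
  tm n s -> tm n t -> tm n u -> D b n (fun r => isfund i (s r) (t r) (u r)).
Proof.
  apply D_app3. apply D_equiv with
    (fun r => (all v ∈ (r 0), infund i v (r 1) (r 2)) ∧ supfund0 i (r 0) (r 1) (r 2))%H.
  - intros r w. split; intros H.
    + split; [hi v Hv; hap H; exact Hv|].
      apply supfund0_iff. hi v Hv. hap H. exact Hv.
    + destruct H as [H1 H2]. apply supfund0_iff in H2.
      hi v. split; [exact (hall_elim H1 v)|exact (hall_elim H2 v)].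
  - apply D_and; [apply D_ball; [dtac|apply D_infund; dtac]|].
    destruct i; cbn [infund0 supfund0]; dtac.
Qed.

Local Hint Resolve D_isfund : definable.

Lemma isfund_unique i z z' x y w :
  w ⊩ isfund i z x y -> w ⊩ isfund i z' x y -> w ⊩ z ≐ z'.
Proof. apply comprehension_unique. Qed.

(** Without a power set, a bound for the product comes from collecting twice: pairs with a fixed
    first component, then the sets so obtained. *)
Lemma product_bound x y w :
  w ⊩ ex B, all a ∈ x, all b ∈ y, all u, opair u a b ⇒ u ∈ B.
Proof.
  assert (H : w ⊩ all a ∈ x, ex s, all b ∈ y, ex u ∈ s, opair u a b).
  { hi a Ha. apply (collection (fun b u => opair u a b)); [dtac|].
    hi b Hb. apply opair_exists. }
  apply collection in H; [|dtac]. hex H as B HB. hex (union_exists B w) as U HU.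
  hexists U. hi a Ha b Hb. hi u Hu. hex (hball_elim HB a Ha) as s [Hs H].
  hex (hball_elim H b Hb) as v [Hv Hv']. hv (opair_unique _ _ _ _ _ Hv' Hu) as E.
  hsubst E. hap HU. hexists s. hs.
Qed.

(** Each value is separated from a bound [B]. Where components of pairs in [x] are involved, the
    bound is built from [f], the double union of [x]. *)
Lemma isfund_exists i x y w : w ⊩ ex z, isfund i z x y.
Proof.
  assert (HB : w ⊩ ex B, all u, infund i u x y ⇒ u ∈ B).
  { assert (HF : w ⊩ ex f, all p ∈ x, all a, all b, opair p a b ⇒ a ∈ f ∧ b ∈ f).
    { hex (union_exists x w) as d Hd. hex (union_exists d w) as e He.
      hexists e. hi p Hp a b. hi Hpab.
      hex (opair_depth _ _ _ _ Hpab) as q (Hq & Ha & Hb).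
      assert (Hqd : w ⊩ q ∈ d) by (hap Hd; hexists p; hs).
      split; hap He; hexists q; hs. }
    hex HF as f Hf.
    destruct i.
    - hex (upair_exists x y w) as p Hp. hexists p. hi u Hu. exact (halliff_r Hp u Hu).
    - hexists x. hi u [Hu _]. exact Hu.
    - hex (union_exists x w) as v Hv. hexists v. hi u Hu. exact (halliff_r Hv u Hu).
    - hexists x. hi u [Hu _]. exact Hu.
    - hex (product_bound x y w) as B HB. hexists B. hi u Hu.
      hex Hu as a [Ha Hu]. hex Hu as b [Hb Hu].
      exact (himp_elim (hball_elim (hball_elim HB a Ha) b Hb u) Hu).
    - hexists x. hi u [Hu _]. exact Hu.
    - assert (H : w ⊩ all a ∈ y, ex u, fiber u a x) by (hi a Ha; apply fiber_exists).
      apply collection in H; [|dtac]. hex H as B HB. hexists B. hi u Hu.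
      hex Hu as a [Ha Hu]. hex (hball_elim HB a Ha) as v [Hv Hv'].
      hv (fiber_unique _ _ _ _ _ Hv' Hu) as E. hsubst E. exact Hv.
    - hexists f. hi u Hu. hex Hu as b Hu. hex Hu as p [Hp Hu].
      exact (proj1 (himp_elim (hball_elim Hf p Hp u b) Hu)).
    - hexists f. hi u Hu. hex Hu as a Hu. hex Hu as p [Hp Hu].
      exact (proj2 (himp_elim (hball_elim Hf p Hp a u) Hu)).
    - hex (product_bound f y w) as B HB. hex (product_bound f B w) as C HC.
      hexists C. hi u Hu. hex Hu as a Hu. hex Hu as b Hu. hex Hu as c (Hu & Hab & Hc).
      hex Hab as p [Hp Hab]. destruct (himp_elim (hball_elim Hf p Hp a b) Hab) as [Ha Hb].
      hex Hu as q [Hq Hu].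
      assert (HqB := himp_elim (hball_elim (hball_elim HB b Hb) c Hc q) Hq).
      exact (himp_elim (hball_elim (hball_elim HC a Ha) q HqB u) Hu).
    - hex (product_bound y f w) as B HB. hex (product_bound f B w) as C HC.
      hexists C. hi u Hu. hex Hu as a Hu. hex Hu as b Hu. hex Hu as c (Hu & Hab & Hc).
      hex Hab as p [Hp Hab]. destruct (himp_elim (hball_elim Hf p Hp a b) Hab) as [Ha Hb].
      hex Hu as q [Hq Hu].
      assert (HqB := himp_elim (hball_elim (hball_elim HB c Hc) b Hb q) Hq).
      exact (himp_elim (hball_elim (hball_elim HC a Ha) q HqB u) Hu).
    - hex (product_bound y x w) as B HB. hexists B. hi u Hu.
      hex Hu as a [Ha Hu]. hex Hu as b (Hb & Hu & _).
      exact (himp_elim (hball_elim (hball_elim HB a Ha) b Hb u) Hu).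
    - hex (product_bound y x w) as B HB. hexists B. hi u Hu.
      hex Hu as a [Ha Hu]. hex Hu as b (Hb & Hu & _).
      exact (himp_elim (hball_elim (hball_elim HB a Ha) b Hb u) Hu). }
  hex HB as B HB'. hex (separation (fun u => infund i u x y) B ltac:(dtac) w) as z Hz.
  hexists z. hi u. split; hi Hu.
  - exact (proj2 (halliff_l Hz u Hu)).
  - hap Hz. split; [hap HB'|]; exact Hu.
Qed.

End OperationsExist.

Hint Resolve D_infund D_isfund : definable.

(** * Congruence of the connectives *)

Section Congruence.
Context {T : theory}.

Definition hequiv (P Q : hprop) : Prop := forall w, w ⊩ P <-> w ⊩ Q.

Lemma hequiv_refl P : hequiv P P.
Proof. intros w. reflexivity. Qed.

Lemma hequiv_and P P' Q Q' :
  hequiv P P' -> hequiv Q Q' -> hequiv (P ∧ Q)%H (P' ∧ Q')%H.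
Proof.
  intros HP HQ w. split; intros [H1 H2]; (split; [apply HP|apply HQ]); assumption.
Qed.

Lemma hequiv_or P P' Q Q' :
  hequiv P P' -> hequiv Q Q' -> hequiv (P ∨ Q)%H (P' ∨ Q')%H.
Proof.
  intros HP HQ w. split; apply hor_mono; intros w' _; apply HP || apply HQ.
Qed.

Lemma hequiv_imp P P' Q Q' :
  hequiv P P' -> hequiv Q Q' -> hequiv (P ⇒ Q)%H (P' ⇒ Q')%H.
Proof.
  intros HP HQ w. split; intros H; hi H'; apply HQ, (himp_elim H), HP, H'.
Qed.

Lemma hequiv_all {I} (F G : I -> hprop) :
  (forall x, hequiv (F x) (G x)) -> hequiv (hall F) (hall G).
Proof. intros H w. split; intros H' x; apply H, H'. Qed.

Lemma hequiv_ex {I} (F G : I -> hprop) :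
  (forall x, hequiv (F x) (G x)) -> hequiv (hex F) (hex G).
Proof. intros H w. split; apply hex_mono; intros w' x _; apply H. Qed.

End Congruence.

Ltac hcongr :=
  cbv beta;
  lazymatch goal with
  | |- hequiv (hand _ _) (hand _ _) => apply hequiv_and; hcongr
  | |- hequiv (hor _ _) (hor _ _) => apply hequiv_or; hcongr
  | |- hequiv (himp _ _) (himp _ _) => apply hequiv_imp; hcongr
  | |- hequiv (hall _) (hall _) => apply hequiv_all; intros ?; hcongr
  | |- hequiv (hex _) (hex _) => apply hequiv_ex; intros ?; hcongr
  | |- hequiv ?P ?P => apply hequiv_refl
  | _ => idtac
  end.

(** * The closure under the operations *)

Section Closure.
Context {T : theory}.

Definition mem_cl0 (z s : nat) : hprop :=
  z ∈ s ∨ ex u ∈ s, ex v ∈ s, hex (fun i => isfund i z u v).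
Definition mem_cl (z b : nat) : hprop := ex s, succ s b ∧ mem_cl0 z s.
Definition iscl (c b : nat) : hprop := all z, z ∈ c ⇔ mem_cl z b.

Lemma sem_in_cl0 z s r : hequiv (sem (in_cl0 z s) r) (mem_cl0 (r z) (r s)).
Proof.
  unfold in_cl0, mem_cl0. cbn [sem scons]. hcongr; try apply hequiv_refl.
  intros w. rewrite hex_fundop_fold. revert w. generalize fundops.
  induction l as [|i l IH]; cbn [map fold_right sem]; [apply hequiv_refl|].
  apply hequiv_or; [|exact IH]. intros w. exact (sem_is_fundop i (2 + z) 1 0 (x0 .: (x .: r)) w).
Qed.

Lemma sem_in_cl z b r : hequiv (sem (in_cl z b) r) (mem_cl (r z) (r b)).
Proof.
  unfold in_cl, mem_cl. cbn [sem scons]. hcongr; [apply hequiv_refl|].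
  exact (sem_in_cl0 (S z) 0 (x .: r)).
Qed.

Lemma succ_unique s t x w : w ⊩ succ s x -> w ⊩ succ t x -> w ⊩ s ≐ t.
Proof. apply comprehension_unique. Qed.

Lemma mem_cl_succ z b s w : w ⊩ succ s b -> w ⊩ mem_cl z b -> w ⊩ mem_cl0 z s.
Proof.
  intros Hs H. hex H as t [Ht H]. hv (succ_unique _ _ _ _ Hs Ht) as E.
  hsubst E. exact H.
Qed.

Lemma all_fund_bound u v w :
  w ⊩ ex t, hall (fun i => ex z ∈ t, isfund i z u v)%H.
Proof.
  assert (H : w ⊩ ex t,
    fold_right (fun i P => hand (ex z ∈ t, isfund i z u v) P) (⊥ ⇒ ⊥) fundops).
  { generalize fundops. induction l as [|i l IH]; cbn [fold_right In].
    (* The empty conjunction holds for every [t]; the name [0] is an arbitrary choice. *)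
    - hexists 0. hi H. exact H.
    - hex IH as t Ht. hex (isfund_exists i u v w) as z Hz.
      hex (upair_exists z z w) as p Hp. hex (upair_exists t p w) as q Hq.
      hex (union_exists q w) as t' Ht'. hexists t'. split.
      + hexists z. split; [|exact Hz]. hap Ht'. hexists p.
        split; [exact (upair_r _ _ _ _ Hq)|exact (upair_l _ _ _ _ Hp)].
      + assert (Hsub : w ⊩ sub t t').
        { hi x Hx. hap Ht'. hexists t. split; [exact (upair_l _ _ _ _ Hq)|exact Hx]. }
        clear - Hsub Ht. revert Ht. induction l as [|i l IH]; cbn [fold_right In]; [auto|].
        intros [H1 H2]. split; [|auto]. hex H1 as z [Hz H1]. hexists z.
        split; [exact (hball_elim Hsub z Hz)|exact H1]. }
  hex H as t Ht. hexists t. apply hall_fundop_fold. exact Ht.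
Qed.

(** With [s] for [b ∪ {b}], collection over both arguments bounds all values of the operations on
    members of [s]; the closure is separated from [s] joined with that bound. *)
Lemma iscl_exists b w : w ⊩ ex c, iscl c b.
Proof.
  hex (succ_exists b w) as s Hs.
  assert (H : w ⊩ all u ∈ s, ex t, all v ∈ s, hall (fun i => ex z ∈ t, isfund i z u v)%H).
  { hi u Hu.
    assert (H : w ⊩ all v ∈ s, ex t, hall (fun i => ex z ∈ t, isfund i z u v)%H)
      by (hi v Hv; apply all_fund_bound).
    apply collection in H; [|dtac]. hex H as B HB. hex (union_exists B w) as t Ht.
    hexists t. hi v Hv. hi i. hex (hball_elim HB v Hv) as t' [Ht' H].
    hex (hall_elim H i) as z [Hz H']. hexists z. split; [|exact H']. hap Ht. hexists t'. hs. }
  apply collection in H; [|dtac]. hex H as B HB. hex (union_exists B w) as t Ht.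
  hex (upair_exists s t w) as p Hp. hex (union_exists p w) as U HU.
  hex (separation (fun z => mem_cl0 z s) U ltac:(dtac) w) as c Hc.
  hexists c. hi z. split; hi Hz.
  - hexists s. split; [exact Hs|]. exact (proj2 (halliff_l Hc z Hz)).
  - apply (mem_cl_succ _ _ s) in Hz; [|exact Hs]. hap Hc. split; [|exact Hz].
    hap HU. hor Hz as Hz | Hz.
    + hexists s. split; [exact (upair_l _ _ _ _ Hp)|exact Hz].
    + hex Hz as u [Hu Hz]. hex Hz as v [Hv Hz]. hex Hz as i Hi.
      hexists t. split; [exact (upair_r _ _ _ _ Hp)|].
      hex (hball_elim HB u Hu) as t' [Ht' H]. hv (hball_elim H v Hv) as H'.
      hex (hall_elim H' i) as z' [Hz' Hi'].
      hv (isfund_unique _ _ _ _ _ _ Hi' Hi) as E. hsubst E.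
      hap Ht. hexists t'. hs.
Qed.

Lemma S1_mem_cl n s t : tm n s -> tm n t -> S1 n (fun r => mem_cl (s r) (t r)).
Proof. apply S1_app2. stac. Qed.

(** In the definition the Sigma1 predicate [mem_cl] occurs as a premise. Values exist and are
    unique, so that half can say instead that [c] contains a value for every pair of arguments. *)
Lemma S1_iscl n f g : tm n f -> tm n g -> S1 n (fun r => iscl (f r) (g r)).
Proof.
  apply S1_app2. apply S1_equiv with (fun r => ex s, succ s (r 1) ∧
    (all z ∈ (r 0), mem_cl0 z s) ∧ (all z ∈ s, z ∈ r 0) ∧
    all u ∈ s, all v ∈ s, hall (fun i => ex z ∈ (r 0), isfund i z u v))%H.
  - intros r w. generalize (r 0) (r 1). intros c b. split; intros H.
    + hex (succ_exists b w) as s Hs. hexists s. hs.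
      * hi z Hz. apply (mem_cl_succ _ b); [exact Hs|]. hap H. exact Hz.
      * hi z Hz. hap H. hexists s. hs. hleft. exact Hz.
      * hi u Hu v Hv. hi i. hex (isfund_exists i u v w) as z Hz. hexists z. hs.
        hap H. hexists s. hs. hright. hexists u. hs. hexists v. hs. hexists i. exact Hz.
    + hex H as s (Hs & H1 & H2 & H3). hi z. split; hi Hz.
      * hexists s. hs. exact (hball_elim H1 z Hz).
      * apply (mem_cl_succ _ _ s) in Hz; [|exact Hs]. hor Hz as Hz | Hz.
        -- exact (hball_elim H2 z Hz).
        -- hex Hz as u [Hu Hz]. hex Hz as v [Hv Hz]. hex Hz as i Hi.
           hv (hball_elim (hball_elim H3 u Hu) v Hv) as H.
           hex (hall_elim H i) as z' [Hz' Hi'].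
           hv (isfund_unique _ _ _ _ _ _ Hi' Hi) as E. hsubst E. exact Hz'.
  - stac.
Qed.

Lemma D_mem_cl n s t : tm n s -> tm n t -> D false n (fun r => mem_cl (s r) (t r)).
Proof. apply D_app2. dtac. Qed.

End Closure.

Hint Resolve S1_mem_cl S1_iscl D_mem_cl : definable.

(** * The recursion defining the stages, in Sigma1 form *)

Section Recursion.
Context {T : theory}.

Definition trans (a : nat) : hprop := all x ∈ a, all y ∈ x, y ∈ a.
Definition ord (a : nat) : hprop := trans a ∧ all x ∈ a, trans x.

Definition isfun (f a : nat) : hprop :=
  (all p ∈ f, ex c ∈ a, ex v, opair p c v) ∧
  (all c ∈ a, ex v, opin c v f ∧ all u, opin c u f ⇒ u ≐ v).
Definition instep (z f a : nat) : hprop :=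
  ex c ∈ a, ex v, opin c v f ∧ mem_cl z v.
Definition isstep (y f a : nat) : hprop := all z, z ∈ y ⇔ instep z f a.
Definition Lseq (f a : nat) : hprop :=
  isfun f a ∧ all b ∈ a, ex v, opin b v f ∧ isstep v f b.
Definition Lstage (y a : nat) : hprop := ex f, Lseq f a ∧ isstep y f a.
Definition inL (x : nat) : hprop := ex a, ord a ∧ ex y, Lstage y a ∧ x ∈ y.

Lemma sem_in_step z f a r : hequiv (sem (in_step z f a) r) (instep (r z) (r f) (r a)).
Proof.
  unfold in_step, instep. cbn [sem scons]. hcongr; [apply hequiv_refl|].
  exact (sem_in_cl (2 + z) 0 (x0 .: (x .: r))).
Qed.

Lemma sem_is_step y f a r : hequiv (sem (is_step y f a) r) (isstep (r y) (r f) (r a)).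
Proof.
  unfold is_step, isstep. cbn [sem scons]. hcongr;
    exact (sem_in_step 0 (S f) (S a) (x .: r)).
Qed.

Lemma sem_is_Lstage y a r : hequiv (sem (is_Lstage y a) r) (Lstage (r y) (r a)).
Proof.
  unfold is_Lstage, Lstage, is_Lseq, Lseq. cbn [sem scons]. hcongr.
  - apply hequiv_refl.
  - apply hequiv_refl.
  - exact (sem_is_step 0 2 1 (x1 .: (x0 .: (x .: r)))).
  - exact (sem_is_step (S y) 0 (S a) (x .: r)).
Qed.

Lemma sem_in_L x r : hequiv (sem (in_L x) r) (inL (r x)).
Proof.
  unfold in_L, inL. cbn [sem scons]. hcongr.
  - apply hequiv_refl.
  - exact (sem_is_Lstage 0 1 (x1 .: (x0 .: r))).
  - apply hequiv_refl.
Qed.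

Lemma S1_isfun n f g : tm n f -> tm n g -> S1 n (fun r => isfun (f r) (g r)).
Proof.
  apply S1_app2. apply S1_equiv with (fun r =>
    (all p ∈ (r 0), ex c ∈ (r 1), ex v, opair p c v) ∧
    (all c ∈ (r 1), ex v, opin c v (r 0) ∧
       all p ∈ (r 0), all d ∈ p, all u ∈ d, opair p c u ⇒ u ≐ v))%H.
  - intros r. apply hequiv_and; [apply hequiv_refl|].
    apply hequiv_all; intros c. apply hequiv_imp; [apply hequiv_refl|].
    apply hequiv_ex; intros v. apply hequiv_and; [apply hequiv_refl|].
    intros w. split; intros H.
    + hi p Hp d Hd. hi u Hu Hpu. hap H. hexists p. hs.
    + hi u Hu. hex Hu as p [Hp Hu]. hex (opair_depth _ _ _ _ Hu) as d (Hd & _ & Hud).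
      exact (himp_elim (hball_elim (hball_elim (hball_elim H p Hp) d Hd) u Hud) Hu).
  - stac.
Qed.

Lemma S1_instep n y f a :
  tm n y -> tm n f -> tm n a -> S1 n (fun r => instep (y r) (f r) (a r)).
Proof. apply S1_app3. stac. Qed.

Lemma D_instep n y f a :
  tm n y -> tm n f -> tm n a -> D false n (fun r => instep (y r) (f r) (a r)).
Proof. apply D_app3. dtac. Qed.

Lemma D_isstep n y f a :
  tm n y -> tm n f -> tm n a -> D false n (fun r => isstep (y r) (f r) (a r)).
Proof. apply D_app3. dtac. Qed.

Lemma D_Lseq n f a : tm n f -> tm n a -> D false n (fun r => Lseq (f r) (a r)).
Proof. apply D_app2. dtac. Qed.

Lemma D_Lstage n y a : tm n y -> tm n a -> D false n (fun r => Lstage (y r) (a r)).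
Proof. apply D_app2. dtac. Qed.

Local Hint Resolve S1_instep : definable.

(** The half with [instep] as a premise becomes Sigma1 by naming the set [V] of values of [f] on [a]
    and, for each value, its closure, which exists by [iscl_exists]. *)
Lemma S1_isstep n y f a :
  tm n y -> tm n f -> tm n a -> S1 n (fun r => isstep (y r) (f r) (a r)).
Proof.
  apply S1_app3. apply S1_equiv with (fun r =>
    (all z ∈ (r 0), instep z (r 1) (r 2)) ∧
    (ex V, (all v ∈ V, ex c ∈ (r 2), opin c v (r 1)) ∧
       (all c ∈ (r 2), all p ∈ (r 1), all d ∈ p, all v ∈ d, opair p c v ⇒ v ∈ V) ∧
       all v ∈ V, ex C, iscl C v ∧ sub C (r 0)))%H.
  - intros r w. generalize (r 0) (r 1) (r 2). clear. intros y f a. split; intros H.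
    + split; [hi z Hz; hap H; exact Hz|].
      hex (union_exists f w) as u Hu. hex (union_exists u w) as t Ht.
      hex (separation (fun v => ex c ∈ a, opin c v f)%H t ltac:(dtac) w) as V HV.
      hexists V. hs.
      * hi v Hv. exact (proj2 (halliff_l HV v Hv)).
      * hi c Hc p Hp. hi d Hd v Hv. hi Hcv. hap HV. split.
        -- hap Ht. hexists d. hs. hap Hu. hexists p. hs.
        -- hexists c. hs. hexists p. hs.
      * hi v Hv. hex (iscl_exists v w) as C HC. hexists C. hs. hi z Hz.
        hap H. hex (proj2 (halliff_l HV v Hv)) as c [Hc Hcv].
        hexists c. hs. hexists v. hs. hap HC. exact Hz.
    + destruct H as [H1 H]. hex H as V (H2 & H3 & H4). hi z. split.
      * exact (hall_elim H1 z).
      * hi Hz. hex Hz as c [Hc Hz]. hex Hz as v [Hcv Hz]. hex Hcv as p [Hp Hcv].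
        hex (opair_depth _ _ _ _ Hcv) as d (Hd & _ & Hv).
        hv (himp_elim (hball_elim (hball_elim (hball_elim (hball_elim H3 c Hc) p Hp) d Hd) v
          Hv) Hcv) as HvV.
        hex (hball_elim H4 v HvV) as C [HC HCy]. hap HCy. hap HC. exact Hz.
  - stac.
Qed.

End Recursion.

Hint Resolve S1_isfun S1_instep S1_isstep D_instep D_isstep D_Lseq D_Lstage : definable.

(** * Existence and uniqueness of the stages *)

Section Stages.
Context {T : theory}.

Lemma S1_Lstage n y a : tm n y -> tm n a -> S1 n (fun r => Lstage (y r) (a r)).
Proof. apply S1_app2. stac. Qed.

Lemma isfun_functional f a b u v w :
  w ⊩ isfun f a -> w ⊩ b ∈ a -> w ⊩ opin b u f -> w ⊩ opin b v f -> w ⊩ u ≐ v.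
Proof.
  intros [_ H] Hb Hu Hv. hex (hball_elim H b Hb) as x [_ Hx].
  hv (himp_elim (hall_elim Hx u) Hu) as E. hsubst_r E.
  apply eqs_sym. exact (himp_elim (hall_elim Hx v) Hv).
Qed.

Lemma Lseq_value f a b v w :
  w ⊩ Lseq f a -> w ⊩ b ∈ a -> w ⊩ opin b v f -> w ⊩ isstep v f b.
Proof.
  intros [Hf H] Hb Hv. hex (hball_elim H b Hb) as u [Hu Hs].
  hv (isfun_functional _ _ _ _ _ _ Hf Hb Hu Hv) as E. hsubst_r E. exact Hs.
Qed.

Lemma instep_mono z f g b w :
  w ⊩ all c ∈ b, all v, opin c v f ⇒ opin c v g -> w ⊩ instep z f b -> w ⊩ instep z g b.
Proof.
  intros H Hz. hex Hz as c [Hc Hz]. hex Hz as v [Hv Hz].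
  hexists c. hs. hexists v. hs. exact (himp_elim (hball_elim H c Hc v) Hv).
Qed.

Lemma isstep_agree u v f g b w :
  w ⊩ all c ∈ b, all v, opin c v f ⇒ opin c v g ->
  w ⊩ all c ∈ b, all v, opin c v g ⇒ opin c v f ->
  w ⊩ isstep u f b -> w ⊩ isstep v g b -> w ⊩ u ≐ v.
Proof.
  intros H1 H2 Hu Hv. apply extensionality. hi z. split; hi Hz.
  - hap Hv. apply instep_mono with f; [exact H1|]. hap Hu. exact Hz.
  - hap Hu. apply instep_mono with g; [exact H2|]. hap Hv. exact Hz.
Qed.

(** Set induction on [b]: transitivity puts the members of [b] into both domains, where the values
    agree by hypothesis, so both steps at [b] start from the same data. *)
Lemma Lseq_agree f g a a' w :
  w ⊩ Lseq f a -> w ⊩ Lseq g a' -> w ⊩ trans a -> w ⊩ trans a' ->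
  w ⊩ all b, b ∈ a ⇒ b ∈ a' ⇒ all u, all v, opin b u f ⇒ opin b v g ⇒ u ≐ v.
Proof.
  intros Hf Hg Ha Ha'.
  apply hall_intro. apply set_induction; [dtac|].
  hi b IH Hb Hb'. hi u v. hi Hu Hv.
  hv (Lseq_value _ _ _ _ _ Hf Hb Hu) as Su. hv (Lseq_value _ _ _ _ _ Hg Hb' Hv) as Sv.
  apply (isstep_agree _ _ _ _ _ _) with (3 := Su) (4 := Sv); hi c Hc; hi x Hx;
    hv (hball_elim (hball_elim Ha b Hb) c Hc) as Hca;
    hv (hball_elim (hball_elim Ha' b Hb') c Hc) as Hca';
    hv (himp_elim (himp_elim (hball_elim IH c Hc) Hca) Hca') as H.
  - hex (hball_elim (proj2 Hg) c Hca') as y [Hy _].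
    hv (himp_elim (himp_elim (hall_elim (hall_elim H x) y) Hx) Hy) as E. hsubst E. exact Hy.
  - hex (hball_elim (proj2 Hf) c Hca) as y [Hy _].
    hv (himp_elim (himp_elim (hall_elim (hall_elim H y) x) Hy) Hx) as E. hsubst E. exact Hy.
Qed.

Lemma Lstage_unique y y' a w :
  w ⊩ trans a -> w ⊩ Lstage y a -> w ⊩ Lstage y' a -> w ⊩ y ≐ y'.
Proof.
  intros Ha H H'. hex H as f [Hf Sf]. hex H' as g [Hg Sg].
  hv (Lseq_agree _ _ _ _ _ Hf Hg Ha Ha) as HA.
  apply (isstep_agree _ _ _ _ _ _) with (3 := Sf) (4 := Sg); hi c Hc; hi x Hx.
  - hex (hball_elim (proj2 Hg) c Hc) as y1 [Hy _].
    hv (himp_elim (himp_elim (hall_elim (hall_elim (himp_elim (himp_elim (hall_elim HA c) Hc)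
      Hc) x) y1) Hx) Hy) as E.
    hsubst E. exact Hy.
  - hex (hball_elim (proj2 Hf) c Hc) as y1 [Hy _].
    hv (himp_elim (himp_elim (hall_elim (hall_elim (himp_elim (himp_elim (hall_elim HA c) Hc)
      Hc) y1) x) Hy) Hx) as E.
    hsubst E. exact Hy.
Qed.

Lemma ord_mem a b w : w ⊩ ord a -> w ⊩ b ∈ a -> w ⊩ ord b.
Proof.
  intros [H1 H2] Hb. split; [exact (hball_elim H2 b Hb)|].
  hi x Hx. hap H2. exact (hball_elim (hball_elim H1 b Hb) x Hx).
Qed.

(** The restriction [g] of [f] to [b] is again a sequence of stages, and its step at [b] is the
    value [v]. *)
Lemma Lseq_stage f a b v w :
  w ⊩ Lseq f a -> w ⊩ ord a -> w ⊩ b ∈ a -> w ⊩ opin b v f -> w ⊩ Lstage v b.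
Proof.
  intros Hf Ha Hb Hv.
  hex (separation (fun p => ex c ∈ b, ex d ∈ p, ex u ∈ d, opair p c u)%H f ltac:(dtac) w) as g Hg.
  assert (Hgf : w ⊩ all c, all u, opin c u g ⇒ opin c u f).
  { hi c u. hi Hu. hex Hu as p [Hp Hu]. hexists p. hs. exact (proj1 (halliff_l Hg p Hp)). }
  assert (Hfg : w ⊩ all c ∈ b, all u, opin c u f ⇒ opin c u g).
  { hi c Hc u. hi Hu. hex Hu as p [Hp Hu]. hexists p. hs. hap Hg. hs.
    hexists c. hs. hex (opair_depth _ _ _ _ Hu) as d (Hd & _ & Hud).
    hexists d. hs. hexists u. hs. }
  assert (Hba : w ⊩ sub b a) by exact (hball_elim (proj1 Ha) b Hb).
  assert (Hstep : w ⊩ all c, sub c b ⇒ all u, isstep u f c ⇒ isstep u g c).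
  { hi c Hc. hi u Hu. hi z. split; hi Hz.
    - apply instep_mono with f; [|hap Hu; exact Hz]. hi x Hx. hi y. hi Hy.
      exact (himp_elim (hball_elim Hfg x (hball_elim Hc x Hx) y) Hy).
    - hap Hu. apply instep_mono with g; [|exact Hz]. hi x Hx. exact (hall_elim Hgf x). }
  hexists g. split; [split; [split|]|].
  - hi p Hp. hex (proj2 (halliff_l Hg p Hp)) as c [Hc H]. hexists c. hs.
    hex H as d [_ H]. hex H as u [_ H]. hexists u. hs.
  - hi c Hc. hex (hball_elim (proj2 Hf) c (hball_elim Hba c Hc)) as u [Hu _].
    hexists u. split; [exact (himp_elim (hball_elim Hfg c Hc u) Hu)|].
    hi x Hx. hv (himp_elim (hall_elim Hgf c x) Hx) as Hx'.
    exact (isfun_functional _ _ _ _ _ _ (proj1 Hf) (hball_elim Hba c Hc) Hx' Hu).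
  - hi c Hc. hex (hball_elim (proj2 Hf) c (hball_elim Hba c Hc)) as u [Hu Su].
    hexists u. split; [exact (himp_elim (hball_elim Hfg c Hc u) Hu)|].
    exact (himp_elim (hall_elim (himp_elim (hall_elim Hstep c)
      (hball_elim (proj1 (ord_mem _ _ _ Ha Hb)) c Hc)) u) Su).
  - refine (himp_elim (hall_elim (himp_elim (hall_elim Hstep b) _) v) _).
    + hi x Hx. exact Hx.
    + exact (Lseq_value _ _ _ _ _ Hf Hb Hv).
Qed.

(** The recursion equation for the stages, freed from the sequence that witnesses a stage. *)
Lemma Lstage_unfold y a w :
  w ⊩ ord a -> w ⊩ Lstage y a ->
  w ⊩ all x, x ∈ y ⇔ (ex c ∈ a, ex v, Lstage v c ∧ mem_cl x v).
Proof.
  intros Ha H. hex H as f [Hf Sf]. hi x. split; hi Hx.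
  - hex (halliff_l Sf x Hx) as c [Hc H]. hex H as v [Hv H].
    hexists c. hs. hexists v. hs. exact (Lseq_stage _ _ _ _ _ Hf Ha Hc Hv).
  - hap Sf. hex Hx as c [Hc Hx]. hex Hx as v [Hv Hx]. hexists c. hs.
    hex (hball_elim (proj2 Hf) c Hc) as u [Hu _]. hexists u. hs.
    hv (Lseq_stage _ _ _ _ _ Hf Ha Hc Hu) as Hu'.
    hv (Lstage_unique _ _ _ _ (proj1 (ord_mem _ _ _ Ha Hc)) Hv Hu') as E.
    hsubst_r E. exact Hx.
Qed.

(** Strong collection for the Sigma1 relation [iscl] gathers closures of values of [f] and nothing
    else, so their union is exactly the step. *)
Lemma isstep_exists f a w : w ⊩ isfun f a -> w ⊩ ex y, isstep y f a.
Proof.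
  intros Hf.
  assert (H : w ⊩ all c ∈ a, ex C, ex v, opin c v f ∧ iscl C v).
  { hi c Hc. hex (hball_elim (proj2 Hf) c Hc) as v [Hv _].
    hex (iscl_exists v w) as C HC. hexists C. hexists v. hs. }
  apply strong_collection in H; [|stac]. hex H as B [H1 H2].
  hex (union_exists B w) as y Hy. hexists y. hi z. split; hi Hz.
  - hex (halliff_l Hy z Hz) as C [HC Hz']. hex (hball_elim H2 C HC) as c [Hc H].
    hex H as v [Hv H]. hexists c. hs. hexists v. hs. hap H. exact Hz'.
  - hex Hz as c [Hc Hz]. hex Hz as v [Hv Hz]. hap Hy.
    hex (hball_elim H1 c Hc) as C [HC H]. hex H as u [Hu H].
    hv (isfun_functional _ _ _ _ _ _ Hf Hc Hv Hu) as E. hsubst_r E.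
    hexists C. hs. hap H. exact Hz.
Qed.

(** The stages below [a] exist by the induction hypothesis. Being Sigma1 and unique, they are
    collected into a set [f] consisting exactly of the pairs of some [c ∈ a] with its stage, and
    this [f] is the required sequence. *)
Lemma Lstage_exists a w : w ⊩ ord a -> w ⊩ ex y, Lstage y a.
Proof.
  apply himp_elim. refine (set_induction (fun a => ord a ⇒ ex y, Lstage y a)%H _ w _ a).
  { dtac. }
  clear a. hi a IH Ha.
  assert (H : w ⊩ all c ∈ a, ex p, ex v, opair p c v ∧ Lstage v c).
  { hi c Hc. hex (himp_elim (hball_elim IH c Hc) (ord_mem _ _ _ Ha Hc)) as v Hv.
    hex (opair_exists c v w) as p Hp. hexists p. hexists v. hs. }
  apply strong_collection in H; [|stac]. hex H as f [H1 H2].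
  assert (Hval : w ⊩ all c, all v, opin c v f ⇔ (c ∈ a ∧ Lstage v c)).
  { hi c v. split; hi H.
    - hex H as p [Hp H]. hex (hball_elim H2 p Hp) as c' [Hc H'].
      hex H' as v' [Hp' H']. destruct (opair_inj _ _ _ _ _ _ Hp' H) as [E E'].
      hsubst_r E. hsubst_r E'. hs.
    - destruct H as [Hc Hv]. hex (hball_elim H1 c Hc) as p [Hp H].
      hex H as v' [Hp' Hv'].
      hv (Lstage_unique _ _ _ _ (proj1 (ord_mem _ _ _ Ha Hc)) Hv Hv') as E.
      hsubst E. hexists p. hs. }
  clear H1.
  assert (Hf : w ⊩ isfun f a).
  { split.
    - hi p Hp. hex (hball_elim H2 p Hp) as c [Hc H]. hex H as v [Hv _].
      hexists c. hs. hexists v. hs.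
    - hi c Hc. hex (himp_elim (hball_elim IH c Hc) (ord_mem _ _ _ Ha Hc)) as v Hv.
      hexists v. split; [apply (hiff_r (hall_elim Hval c v)); hs|].
      hi u Hu. destruct (hiff_l (hall_elim Hval c u) Hu) as [_ Hu'].
      exact (Lstage_unique _ _ _ _ (proj1 (ord_mem _ _ _ Ha Hc)) Hu' Hv). }
  hex (isstep_exists f a w Hf) as y Hy. hexists y. hexists f. split; [|exact Hy].
  split; [exact Hf|]. hi b Hb.
  hex (himp_elim (hball_elim IH b Hb) (ord_mem _ _ _ Ha Hb)) as v Hv.
  hexists v. split; [apply (hiff_r (hall_elim Hval b v)); hs|].
  hv (Lstage_unfold _ _ _ (ord_mem _ _ _ Ha Hb) Hv) as HU. hi x. split; hi Hx.
  - hex (halliff_l HU x Hx) as c [Hc H]. hex H as u [Hu H]. hexists c. hs.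
    hexists u. hs. apply (hiff_r (hall_elim Hval c u)). hs.
    exact (hball_elim (hball_elim (proj1 Ha) b Hb) c Hc).
  - hap HU. hex Hx as c [Hc H]. hex H as u [Hu H]. hexists c. hs. hexists u. hs.
    exact (proj2 (hiff_l (hall_elim Hval c u) Hu)).
Qed.

End Stages.

Hint Resolve S1_Lstage : definable.

(** * Closure of L under the fundamental operations *)

Section ClosureOfL.
Context {T : theory}.

Lemma S1_inL n x : tm n x -> S1 n (fun r => inL (x r)).
Proof. apply S1_app1. stac. Qed.

Lemma D_inL n x : tm n x -> D false n (fun r => inL (x r)).
Proof. apply D_app1. dtac. Qed.

Local Hint Resolve S1_inL D_inL : definable.

Lemma ord_succ s a w : w ⊩ ord a -> w ⊩ succ s a -> w ⊩ ord s.
Proof.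
  intros [H1 H2] Hs. split.
  - hi x Hx. hi y Hy. hap Hs. hleft. hor (halliff_l Hs x Hx) as Hxa | E.
    + exact (hball_elim (hball_elim H1 x Hxa) y Hy).
    + hsubst_r E. exact Hy.
  - hi x Hx. hor (halliff_l Hs x Hx) as Hxa | E.
    + exact (hball_elim H2 x Hxa).
    + hsubst_r E. exact H1.
Qed.

Lemma ord_union u A w : w ⊩ all x ∈ A, ord x -> w ⊩ union u A -> w ⊩ ord u.
Proof.
  intros H Hu. split; hi x Hx; hex (halliff_l Hu x Hx) as a [Ha Hxa];
    hv (hball_elim H a Ha) as [H1 H2].
  - hi y Hy. hap Hu. hexists a. split; [exact Ha|].
    exact (hball_elim (hball_elim H1 x Hxa) y Hy).
  - exact (hball_elim H2 x Hxa).
Qed.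

Lemma Lstage_mono a b y z w :
  w ⊩ ord a -> w ⊩ ord b -> w ⊩ sub a b -> w ⊩ Lstage y a -> w ⊩ Lstage z b ->
  w ⊩ sub y z.
Proof.
  intros Ha Hb Hab Hy Hz. hi x Hx.
  hex (halliff_l (Lstage_unfold _ _ _ Ha Hy) x Hx) as c [Hc H].
  hv (Lstage_unfold _ _ _ Hb Hz) as HU. hap HU. hexists c.
  split; [exact (hball_elim Hab c Hc)|exact H].
Qed.

Lemma inL_cl a y x w : w ⊩ ord a -> w ⊩ Lstage y a -> w ⊩ mem_cl x y -> w ⊩ inL x.
Proof.
  intros Ha Hy Hx. hex (succ_exists a w) as s Hs. hv (ord_succ _ _ _ Ha Hs) as Hso.
  hex (Lstage_exists s w Hso) as z Hz. hexists s. hs. hexists z. hs.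
  hv (Lstage_unfold _ _ _ Hso Hz) as HU. hap HU. hexists a. split.
  - hap Hs. hright. heq.
  - hexists y. hs.
Qed.

Lemma inL_stage a y w : w ⊩ ord a -> w ⊩ Lstage y a -> w ⊩ inL y.
Proof.
  intros Ha Hy. apply (inL_cl a y); [exact Ha|exact Hy|].
  hex (succ_exists y w) as s Hs. hexists s. hs. hleft. hap Hs. hright. heq.
Qed.

Lemma inL_common x y w :
  w ⊩ inL x -> w ⊩ inL y -> w ⊩ ex a, ord a ∧ ex z, Lstage z a ∧ x ∈ z ∧ y ∈ z.
Proof.
  intros Hx Hy. hex Hx as a [Ha Hx]. hex Hx as u [Hu Hx].
  hex Hy as b [Hb Hy]. hex Hy as v [Hv Hy].
  hex (upair_exists a b w) as p Hp. hex (union_exists p w) as c Hc.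
  assert (Ho : w ⊩ ord c).
  { apply (ord_union c p); [|exact Hc]. hi x' Hx'.
    hor (upair_inv _ _ _ _ _ Hp Hx') as E | E; hsubst_r E; assumption. }
  hex (Lstage_exists c w Ho) as z Hz. hexists c. hs. hexists z. hs.
  - refine (hball_elim (Lstage_mono a c u z _ Ha Ho _ Hu Hz) x Hx).
    hi k Hk. hap Hc. hexists a. split; [exact (upair_l _ _ _ _ Hp)|exact Hk].
  - refine (hball_elim (Lstage_mono b c v z _ Hb Ho _ Hv Hz) y Hy).
    hi k Hk. hap Hc. hexists b. split; [exact (upair_r _ _ _ _ Hp)|exact Hk].
Qed.

Lemma inL_fund i z x y w :
  w ⊩ inL x -> w ⊩ inL y -> w ⊩ isfund i z x y -> w ⊩ inL z.
Proof.
  intros Hx Hy Hz. hex (inL_common x y w Hx Hy) as a [Ha H].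
  hex H as u (Hu & Hxu & Hyu). apply (inL_cl a u); [exact Ha|exact Hu|].
  hex (succ_exists u w) as s Hs. hexists s. hs. hright.
  hexists x. split; [hap Hs; hleft; exact Hxu|].
  hexists y. split; [hap Hs; hleft; exact Hyu|]. hexists i. exact Hz.
Qed.

Lemma fund_exists_L i x y w :
  w ⊩ inL x -> w ⊩ inL y -> w ⊩ ex z, inL z ∧ isfund i z x y.
Proof.
  intros Hx Hy. hex (isfund_exists i x y w) as z Hz. hexists z. hs.
  exact (inL_fund i z x y w Hx Hy Hz).
Qed.

Lemma inL_upair p a b w :
  w ⊩ inL a -> w ⊩ inL b -> w ⊩ upair p a b -> w ⊩ inL p.
Proof. intros Ha Hb Hp. exact (inL_fund F_pair p a b w Ha Hb Hp). Qed.

Lemma inL_union u x w : w ⊩ inL x -> w ⊩ union u x -> w ⊩ inL u.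
Proof. intros Hx Hu. exact (inL_fund F_union u x x w Hx Hx Hu). Qed.

Lemma inL_opair p a b w :
  w ⊩ inL a -> w ⊩ inL b -> w ⊩ opair p a b -> w ⊩ inL p.
Proof.
  intros Ha Hb Hp. hex Hp as c Hp. hex Hp as d (Hc & Hd & Hp).
  hv (inL_upair _ _ _ _ Ha Ha Hc) as Hc'. hv (inL_upair _ _ _ _ Ha Hb Hd) as Hd'.
  exact (inL_upair _ _ _ _ Hc' Hd' Hp).
Qed.

(** A single fiber is the union of [F_all] applied to [x] and [{a}], a set whose only member is that
    fiber. *)
Lemma inL_fiber u a x w :
  w ⊩ inL a -> w ⊩ inL x -> w ⊩ fiber u a x -> w ⊩ inL u.
Proof.
  intros Ha Hx Hu. hex (upair_exists a a w) as p Hp.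
  hv (inL_upair _ _ _ _ Ha Ha Hp) as HpL.
  hex (fund_exists_L F_all x p w Hx HpL) as q [HqL Hq].
  hex (union_exists q w) as v Hv. hv (inL_union _ _ _ HqL Hv) as HvL.
  assert (E : w ⊩ v ≐ u); [|hsubst_r E; exact HvL].
  apply extensionality. hi z. split; hi Hz.
  - hex (halliff_l Hv z Hz) as u' [Hu' Hz'].
    hex (halliff_l Hq u' Hu') as a' [Ha' Hf].
    hv (single_inv _ _ _ _ Hp Ha') as E. hsubst_r E.
    hv (fiber_unique _ _ _ _ _ Hu Hf) as E. hsubst E. exact Hz'.
  - hap Hv. hexists u. hs. hap Hq. hexists a.
    split; [exact (upair_l _ _ _ _ Hp)|exact Hu].
Qed.

Lemma empty_in_L w : w ⊩ ex e, inL e ∧ is_empty e.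
Proof.
  hex (empty_set w) as o Ho.
  assert (Hoo : w ⊩ ord o) by (split; hi x Hx; hbot (hball_elim Ho x Hx)).
  hex (Lstage_exists o w Hoo) as y Hy. hv (inL_stage _ _ _ Hoo Hy) as HyL.
  hex (fund_exists_L F_diff y y w HyL HyL) as e [He H]. hexists e. hs.
  hi x Hx. destruct (halliff_l H x Hx) as [H1 H2]. exact (himp_elim H2 H1).
Qed.

(** * Transitivity of L *)

Definition hered (u : nat) : hprop :=
  ex t, trans t ∧ u ∈ t ∧ all x ∈ t, inL x.

Lemma D_hered n x : tm n x -> D false n (fun r => hered (x r)).
Proof. apply D_app1. dtac. Qed.

Local Hint Resolve D_hered : definable.

Lemma hered_inL u w : w ⊩ hered u -> w ⊩ inL u.
Proof. intros H. hex H as t (_ & Hu & H). exact (hball_elim H u Hu). Qed.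

Lemma hered_mem u v w : w ⊩ hered u -> w ⊩ v ∈ u -> w ⊩ hered v.
Proof.
  intros H Hv. hex H as t (Ht & Hu & H). hexists t. hs.
  exact (hball_elim (hball_elim Ht u Hu) v Hv).
Qed.

(** The union of transitive sets witnessing [hered] for the members of [u], with [u] added, is a
    witness for [u]. Strong collection ensures that every set gathered is such a witness, so that
    the union is transitive and lies within L. *)
Lemma hered_intro u w : w ⊩ inL u -> w ⊩ all v ∈ u, hered v -> w ⊩ hered u.
Proof.
  intros Hu H. apply strong_collection in H; [|stac]. hex H as B [H1 H2].
  hex (union_exists B w) as U HU. hex (upair_exists u u w) as p Hp.
  hex (upair_exists U p w) as q Hq. hex (union_exists q w) as t Ht.
  assert (Hin : w ⊩ all x, x ∈ t ⇔ (x ∈ U ∨ x ≐ u)).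
  { hi x. split; hi Hx.
    - hex (halliff_l Ht x Hx) as k [Hk Hxk].
      hor (upair_inv _ _ _ _ _ Hq Hk) as E | E; hsubst_r E.
      + hleft. exact Hxk.
      + hright. exact (single_inv _ _ _ _ Hp Hxk).
    - hap Ht. hor Hx as Hx | E.
      + hexists U. split; [exact (upair_l _ _ _ _ Hq)|exact Hx].
      + hexists p. split; [exact (upair_r _ _ _ _ Hq)|].
        hsubst_r E. exact (upair_l _ _ _ _ Hp). }
  hexists t. split; [|split].
  - hi x Hx y Hy. hap Hin. hleft. hap HU. hor (halliff_l Hin x Hx) as Hx' | E.
    + hex (halliff_l HU x Hx') as k [Hk Hxk]. hexists k. hs.
      hex (hball_elim H2 k Hk) as v (_ & Htr & _).
      exact (hball_elim (hball_elim Htr x Hxk) y Hy).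
    + hsubst_r E. hex (hball_elim H1 y Hy) as k (Hk & _ & Hyk & _). hexists k. hs.
  - hap Hin. hright. heq.
  - hi x Hx. hor (halliff_l Hin x Hx) as Hx' | E.
    + hex (halliff_l HU x Hx') as k [Hk Hxk].
      hex (hball_elim H2 k Hk) as v (_ & _ & _ & HL). exact (hball_elim HL x Hxk).
    + hsubst_r E. exact Hu.
Qed.

Lemma hered_upair p a b w :
  w ⊩ hered a -> w ⊩ hered b -> w ⊩ upair p a b -> w ⊩ hered p.
Proof.
  intros Ha Hb Hp. apply hered_intro.
  - exact (inL_upair _ _ _ _ (hered_inL _ _ Ha) (hered_inL _ _ Hb) Hp).
  - hi x Hx. hor (upair_inv _ _ _ _ _ Hp Hx) as E | E; hsubst_r E; assumption.
Qed.

Lemma hered_opair p a b w :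
  w ⊩ hered a -> w ⊩ hered b -> w ⊩ opair p a b -> w ⊩ hered p.
Proof.
  intros Ha Hb Hp. hex Hp as c Hp. hex Hp as d (Hc & Hd & Hp).
  hv (hered_upair _ _ _ _ Ha Ha Hc) as Hc'. hv (hered_upair _ _ _ _ Ha Hb Hd) as Hd'.
  exact (hered_upair _ _ _ _ Hc' Hd' Hp).
Qed.

Lemma hered_otriple p a b c w :
  w ⊩ hered a -> w ⊩ hered b -> w ⊩ hered c -> w ⊩ otriple p a b c -> w ⊩ hered p.
Proof.
  intros Ha Hb Hc Hp. hex Hp as q [Hq Hp].
  exact (hered_opair _ _ _ _ Ha (hered_opair _ _ _ _ Hb Hc Hq) Hp).
Qed.

Lemma hered_opin a b x w : w ⊩ hered x -> w ⊩ opin a b x -> w ⊩ hered a ∧ hered b.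
Proof.
  intros Hx H. hex H as p [Hp H]. hex (opair_depth _ _ _ _ H) as d (Hd & Ha & Hb).
  hv (hered_mem _ _ _ (hered_mem _ _ _ Hx Hp) Hd) as Hd'.
  split; eapply hered_mem; eassumption.
Qed.

Lemma hered_fund i z x y w :
  w ⊩ hered x -> w ⊩ hered y -> w ⊩ isfund i z x y -> w ⊩ hered z.
Proof.
  intros Hx Hy Hz. apply hered_intro.
  { exact (inL_fund i z x y w (hered_inL _ _ Hx) (hered_inL _ _ Hy) Hz). }
  hi u Hu. hv (halliff_l Hz u Hu) as H. clear Hz Hu. destruct i; expose_in H.
  - hor H as E | E; hsubst_r E; assumption.
  - exact (hered_mem _ _ _ Hx (proj1 H)).
  - hex H as v [Hv H]. exact (hered_mem _ _ _ (hered_mem _ _ _ Hx Hv) H).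
  - exact (hered_mem _ _ _ Hx (proj1 H)).
  - hex H as a [Ha H]. hex H as b [Hb H].
    exact (hered_opair _ _ _ _ (hered_mem _ _ _ Hx Ha) (hered_mem _ _ _ Hy Hb) H).
  - exact (hered_mem _ _ _ Hx (proj1 H)).
  (* A fiber need not lie in the transitive sets given for [x] and [y]; it is in L by [inL_fiber],
     and its members are components of pairs in [x]. *)
  - hex H as a [Ha H]. hv (hered_mem _ _ _ Hy Ha) as Ha'. apply hered_intro.
    + exact (inL_fiber _ _ _ _ (hered_inL _ _ Ha') (hered_inL _ _ Hx) H).
    + hi v Hv. exact (proj2 (hered_opin _ _ _ _ Hx (halliff_l H v Hv))).
  - hex H as b H. exact (proj1 (hered_opin _ _ _ _ Hx H)).
  - hex H as a H. exact (proj2 (hered_opin _ _ _ _ Hx H)).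
  - hex H as a H. hex H as b H. hex H as c (Hu & Hab & Hc).
    destruct (hered_opin _ _ _ _ Hx Hab) as [Ha Hb].
    exact (hered_otriple _ _ _ _ _ Ha Hb (hered_mem _ _ _ Hy Hc) Hu).
  - hex H as a H. hex H as b H. hex H as c (Hu & Hab & Hc).
    destruct (hered_opin _ _ _ _ Hx Hab) as [Ha Hb].
    exact (hered_otriple _ _ _ _ _ Ha (hered_mem _ _ _ Hy Hc) Hb Hu).
  - hex H as a [Ha H]. hex H as b (Hb & H & _).
    exact (hered_opair _ _ _ _ (hered_mem _ _ _ Hy Ha) (hered_mem _ _ _ Hx Hb) H).
  - hex H as a [Ha H]. hex H as b (Hb & H & _).
    exact (hered_opair _ _ _ _ (hered_mem _ _ _ Hy Ha) (hered_mem _ _ _ Hx Hb) H).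
Qed.

Lemma stage_hered a w :
  w ⊩ ord a -> w ⊩ all y, Lstage y a ⇒ all x ∈ y, hered x.
Proof.
  apply himp_elim.
  refine (set_induction (fun a => ord a ⇒ all y, Lstage y a ⇒ all x ∈ y, hered x)%H
    _ w _ a).
  { dtac. }
  clear a. hi a IH Ha y. hi Hy x Hx.
  hex (halliff_l (Lstage_unfold _ _ _ Ha Hy) x Hx) as c [Hc H].
  hex H as v [Hv H]. hv (ord_mem _ _ _ Ha Hc) as Hco.
  hv (himp_elim (hall_elim (himp_elim (hball_elim IH c Hc) Hco) v) Hv) as HvH.
  (* The closure also applies the operations to the stage [v] itself, so [v] has to be hereditary
     too. *)
  hv (hered_intro _ _ (inL_stage _ _ _ Hco Hv) HvH) as Hv'.
  hex H as s [Hs H].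
  assert (Hs' : w ⊩ all u ∈ s, hered u).
  { hi u Hu. hor (halliff_l Hs u Hu) as Huv | E.
    - exact (hball_elim HvH u Huv).
    - hsubst_r E. exact Hv'. }
  hor H as H | H.
  - exact (hball_elim Hs' x H).
  - hex H as u [Hu H]. hex H as u' [Hu' H]. hex H as i H.
    exact (hered_fund i x u u' _ (hball_elim Hs' u Hu) (hball_elim Hs' u' Hu') H).
Qed.

Lemma L_transitive x y w : w ⊩ inL x -> w ⊩ y ∈ x -> w ⊩ inL y.
Proof.
  intros Hx Hy. hex Hx as a [Ha Hx]. hex Hx as z [Hz Hx]. apply hered_inL.
  refine (hered_mem x y _ _ Hy).
  exact (hball_elim (himp_elim (hall_elim (stage_hered a _ Ha) z) Hz) x Hx).
Qed.

(* The bound is the stage of the union of the ordinals collected for the members of [a]. *)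
Lemma stage_collection (R : nat -> nat -> hprop) a w :
  S1 2 (fun r => R (r 1) (r 0)) ->
  w ⊩ all x ∈ a, ex y, inL y ∧ R x y ->
  w ⊩ ex b, inL b ∧ all x ∈ a, ex y ∈ b, R x y.
Proof.
  intros HS H.
  assert (H' : w ⊩ all x ∈ a, ex c, ord c ∧ ex v, Lstage v c ∧ ex y ∈ v, R x y).
  { hi x Hx. hex (hball_elim H x Hx) as y [Hy HR]. hex Hy as c [Hc Hy].
    hex Hy as v [Hv Hy]. hexists c. hs. hexists v. hs. hexists y. hs. }
  apply strong_collection in H'; [|stac].
  hex H' as B [H1 H2]. hex (union_exists B w) as d Hd.
  assert (Hdo : w ⊩ ord d).
  { apply (ord_union d B); [|exact Hd]. hi c Hc. hex (hball_elim H2 c Hc) as x [_ H3].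
    exact (proj1 H3). }
  hex (Lstage_exists d w Hdo) as b Hb. hexists b. split; [exact (inL_stage _ _ _ Hdo Hb)|].
  hi x Hx. hex (hball_elim H1 x Hx) as c [HcB [Hc H3]]. hex H3 as v [Hv H3].
  hex H3 as y [Hy H3]. hexists y. hs.
  refine (hball_elim (Lstage_mono c d v b _ Hc Hdo _ Hv Hb) y Hy).
  hi k Hk. hap Hd. hexists c. hs.
Qed.

End ClosureOfL.

Hint Resolve S1_inL D_inL : definable.

(** * Bounded separation in L *)

Section SeparationInL.
Context {T : theory}.

Lemma inter_L x y w :
  w ⊩ inL x -> w ⊩ inL y -> w ⊩ ex z, inL z ∧ all u, u ∈ z ⇔ (u ∈ x ∧ u ∈ y).
Proof.
  intros Hx Hy. hex (upair_exists y y w) as p Hp.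
  hex (fund_exists_L F_inter x p w Hx (inL_upair _ _ _ _ Hy Hy Hp)) as z [Hz H].
  hexists z. hs. hi u. split; hi Hu.
  - destruct (halliff_l H u Hu) as [H1 H2]. hs.
    exact (hball_elim H2 y (upair_l _ _ _ _ Hp)).
  - destruct Hu as [H1 H2]. hap H. split; [exact H1|]. hi k Hk.
    hv (single_inv _ _ _ _ Hp Hk) as E. hsubst_r E. exact H2.
Qed.

Lemma union2_L x y w :
  w ⊩ inL x -> w ⊩ inL y -> w ⊩ ex z, inL z ∧ all u, u ∈ z ⇔ (u ∈ x ∨ u ∈ y).
Proof.
  intros Hx Hy. hex (upair_exists x y w) as p Hp. hex (union_exists p w) as z Hz.
  hexists z. split; [exact (inL_union _ _ _ (inL_upair _ _ _ _ Hx Hy Hp) Hz)|].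
  hi u. split; hi Hu.
  - hex (halliff_l Hz u Hu) as k [Hk Huk].
    hor (upair_inv _ _ _ _ _ Hp Hk) as E | E; hsubst_r E; [hleft|hright]; exact Huk.
  - hap Hz. hor Hu as Hu | Hu; [hexists x|hexists y]; hs.
    + exact (upair_l _ _ _ _ Hp).
    + exact (upair_r _ _ _ _ Hp).
Qed.

Lemma dom_L a w :
  w ⊩ inL a -> w ⊩ ex d, inL d ∧ all x, x ∈ d ⇔ (ex y, opin x y a).
Proof. intros Ha. exact (fund_exists_L F_dom a a w Ha Ha). Qed.

Lemma ran_L a w :
  w ⊩ inL a -> w ⊩ ex d, inL d ∧ all y, y ∈ d ⇔ (ex x, opin x y a).
Proof. intros Ha. exact (fund_exists_L F_ran a a w Ha Ha). Qed.

Lemma prod_L x y w :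
  w ⊩ inL x -> w ⊩ inL y ->
  w ⊩ ex d, inL d ∧ all p, all a, all b, opair p a b ⇒ (p ∈ d ⇔ (a ∈ x ∧ b ∈ y)).
Proof.
  intros Hx Hy. hex (fund_exists_L F_prod x y w Hx Hy) as d [Hd H]. hexists d. hs.
  hi p a b. hi Hp. split; hi Hpd.
  - hex (halliff_l H p Hpd) as a' [Ha Hq]. hex Hq as b' [Hb Hq].
    destruct (opair_inj _ _ _ _ _ _ Hq Hp) as [E E']. hsubst E. hsubst E'. hs.
  - destruct Hpd as [Ha Hb]. hap H. hexists a. hs. hexists b. hs.
Qed.

(* [e] codes the first [n] values of [r] as [⟨r 0, ⟨r 1, ... ⟨r (n-1), t⟩⟩⟩] for an
   arbitrary tail [t], so that a new variable is added by pairing on the left. *)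
Fixpoint code (n : nat) (r : nat -> nat) (e : nat) : hprop :=
  match n with
  | 0 => ⊥ ⇒ ⊥
  | S n => ex t, opair e (r 0) t ∧ code n (fun k => r (S k)) t
  end.

(** The quantifier over environments stands inside the existential, so that one [b] serves all
    tuples at once. Nothing is asked about elements of [b] that are not codes. *)
Definition Sep (n : nat) (F : (nat -> nat) -> hprop) : Prop :=
  forall a w, w ⊩ inL a -> w ⊩ ex b, inL b ∧
    hall (fun r => all e, code n r e ⇒ (e ∈ b ⇔ (e ∈ a ∧ F r)))%H.

Lemma D_code n r m t : tm m t -> D false m (fun s => code n r (t s)).
Proof.
  apply (D_app1 false m (code n r)). revert r.
  induction n as [|n IH]; intros r; cbn [code].
  - dtac.
  - apply D_ex. apply D_and; [dtac|].
    apply (D_app1 false 2 (code n (fun k => r (S k))) (fun s => s 0)); [apply IH|dtac].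
Qed.

Local Hint Resolve D_code : definable.

Lemma code_cons n r x e p w :
  w ⊩ opair p x e -> w ⊩ code n r e -> w ⊩ code (S n) (x .: r) p.
Proof. intros Hp He. apply (hex_intro _ e). split; [exact Hp|exact He]. Qed.

Lemma code_exists n r w :
  w ⊩ hall (fun i => inL (r i)) -> w ⊩ ex e, inL e ∧ code n r e.
Proof.
  revert r w. induction n as [|n IH]; intros r w H.
  - hex (empty_in_L w) as e [He _]. hexists e. hs. hi K. exact K.
  - assert (H' : w ⊩ hall (fun i => inL (r (S i)))) by (hi i; exact (hall_elim H (S i))).
    hex (IH _ _ H') as t [Ht Hc]. hex (opair_exists (r 0) t w) as e He. hexists e. split.
    + exact (inL_opair _ _ _ _ (hall_elim H 0) Ht He).
    + hexists t. hs.
Qed.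

(** Taking ranges [i] times strips the earlier coordinates from the tuples in [a]; the domain of the
    result then bounds coordinate [i]. *)
Lemma code_bound n i : i < n -> forall a w, w ⊩ inL a ->
  w ⊩ ex c, inL c ∧ hall (fun r => all e ∈ a, code n r e ⇒ r i ∈ c)%H.
Proof.
  revert i. induction n as [|n IH]; intros i Hi a w Ha; [lia|].
  destruct i as [|i].
  - hex (dom_L a w Ha) as d [Hd H]. hexists d. hs. hi r e. hi He Hc.
    hex Hc as t [Ht _]. hap H. hexists t. hexists e. hs.
  - hex (ran_L a w Ha) as d [Hd H].
    hex (IH i (proj2 (Nat.succ_lt_mono _ _) Hi) d w Hd) as c [Hc H']. hexists c. hs.
    hi r e. hi He Hce. hex Hce as t [Ht Hct].
    assert (Htd : w ⊩ t ∈ d) by (hap H; hexists (r 0); hexists e; hs).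
    exact (himp_elim (hball_elim (hall_elim H' (fun k => r (S k))) t Htd) Hct).
Qed.

Lemma Sep_iff n F G : (forall r w, w ⊩ F r <-> w ⊩ G r) -> Sep n G -> Sep n F.
Proof.
  intros H HG a w Ha. hex (HG a w Ha) as b [Hb H']. hexists b. hs.
  hi r e. hi He. hv (himp_elim (hall_elim (hall_elim H' r) e) He) as Hi.
  split; hi K.
  - destruct (hiff_l Hi K). hs. now apply H.
  - apply (hiff_r Hi). destruct K. hs. now apply H.
Qed.

Lemma Sep_bot n : Sep n (fun _ => ⊥)%H.
Proof.
  intros a w Ha. hex (empty_in_L w) as b [Hb H]. hexists b. hs.
  hi r e. hi He. split; hi K.
  - hbot (hball_elim H e K).
  - hbot (proj2 K).
Qed.

Lemma Sep_and n F G : Sep n F -> Sep n G -> Sep n (fun r => F r ∧ G r)%H.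
Proof.
  intros HF HG a w Ha. hex (HF a w Ha) as b [Hb H]. hex (HG b w Hb) as c [Hc H'].
  hexists c. hs. hi r e. hi He.
  hv (himp_elim (hall_elim (hall_elim H r) e) He) as Hi.
  hv (himp_elim (hall_elim (hall_elim H' r) e) He) as Hi'.
  split; hi K.
  - destruct (hiff_l Hi' K) as [K1 K2]. destruct (hiff_l Hi K1) as [K3 K4]. hs.
  - destruct K as (K1 & K2 & K3). apply (hiff_r Hi'). hs. apply (hiff_r Hi). hs.
Qed.

Lemma Sep_or n F G : Sep n F -> Sep n G -> Sep n (fun r => F r ∨ G r)%H.
Proof.
  intros HF HG a w Ha. hex (HF a w Ha) as b [Hb H]. hex (HG a w Ha) as c [Hc H'].
  hex (union2_L b c w Hb Hc) as d [Hd HU]. hexists d. hs. hi r e. hi He.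
  hv (himp_elim (hall_elim (hall_elim H r) e) He) as Hi.
  hv (himp_elim (hall_elim (hall_elim H' r) e) He) as Hi'.
  split; hi K.
  - hor (halliff_l HU e K) as K1 | K1.
    + destruct (hiff_l Hi K1). hs. hleft. assumption.
    + destruct (hiff_l Hi' K1). hs. hright. assumption.
  - destruct K as [K1 K2]. hap HU. hor K2 as K2 | K2.
    + hleft. apply (hiff_r Hi). hs.
    + hright. apply (hiff_r Hi'). hs.
Qed.

(** For codes in [a], membership in [b] and [c] expresses [F] and [G], so [F_imp] at the ordered
    pair of [b] and [c] selects exactly the codes satisfying the implication. *)
Lemma Sep_imp n F G : Sep n F -> Sep n G -> Sep n (fun r => F r ⇒ G r)%H.
Proof.
  intros HF HG a w Ha. hex (HF a w Ha) as b [Hb H]. hex (HG a w Ha) as c [Hc H'].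
  hex (opair_exists b c w) as q Hq.
  hex (fund_exists_L F_imp a q w Ha (inL_opair _ _ _ _ Hb Hc Hq)) as d [Hd HI].
  hexists d. hs. hi r e. hi He.
  hv (himp_elim (hall_elim (hall_elim H r) e) He) as Hi.
  hv (himp_elim (hall_elim (hall_elim H' r) e) He) as Hi'.
  split; hi K.
  - destruct (halliff_l HI e K) as [K1 K2]. hs. hi K3. hex K2 as b' K2. hex K2 as c' [Hq' K2].
    destruct (opair_inj _ _ _ _ _ _ Hq Hq') as [E E'].
    assert (Kb : w ⊩ e ∈ b) by (apply (hiff_r Hi); hs). hsubst_r E.
    refine (proj2 (hiff_l Hi' _)). apply eqs_sym in E'.
    refine (eqs_subst (fun c => e ∈ c)%H c' c w _ E' _); [dtac|]. exact (himp_elim K2 Kb).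
  - destruct K as [K1 K2]. hap HI. split; [exact K1|]. hexists b. hexists c. hs. hi K3.
    destruct (hiff_l Hi K3) as [_ K4]. apply (hiff_r Hi'). hs. exact (himp_elim K2 K4).
Qed.

(** The hypothesis bounds all witnesses by a set [c] of L. The tuples satisfying [G] are separated
    from [c × a], and the range drops the new first coordinate. *)
Lemma Sep_ex n G :
  (forall a w, w ⊩ inL a -> w ⊩ ex c, inL c ∧
     hall (fun r => all e ∈ a, code n r e ⇒ all x, G (x .: r) ⇒ x ∈ c)%H) ->
  Sep (S n) G -> Sep n (fun r => ex x, G (x .: r))%H.
Proof.
  intros HC HG a w Ha. hex (HC a w Ha) as c [Hc Hbd].
  hex (prod_L c a w Hc Ha) as d [Hd HP]. hex (HG d w Hd) as b' [Hb' HS].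
  hex (ran_L b' w Hb') as b [Hb HR]. hexists b. hs. hi r e. hi He. split; hi K.
  - hex (halliff_l HR e K) as x H. hex H as p [Hp Hpx].
    hv (code_cons _ _ _ _ _ _ Hpx He) as Hcode.
    destruct (hiff_l (himp_elim (hall_elim (hall_elim HS (x .: r)) p) Hcode) Hp) as [K1 K2].
    split; [|hexists x; exact K2].
    exact (proj2 (hiff_l (himp_elim (hall_elim (hall_elim (hall_elim HP p) x) e) Hpx) K1)).
  - destruct K as [K1 K2]. hex K2 as x Hx. hap HR. hexists x.
    hex (opair_exists x e w) as p Hpx. hexists p. hs.
    hv (code_cons _ _ _ _ _ _ Hpx He) as Hcode.
    apply (hiff_r (himp_elim (hall_elim (hall_elim HS (x .: r)) p) Hcode)). hs.
    apply (hiff_r (himp_elim (hall_elim (hall_elim (hall_elim HP p) x) e) Hpx)). hs.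
    exact (himp_elim (hall_elim (himp_elim (hball_elim (hall_elim Hbd r) e K1) He) x) Hx).
Qed.

Lemma code_member_bound n i : i < n -> forall a w, w ⊩ inL a ->
  w ⊩ ex c, inL c ∧ hall (fun r => all e ∈ a, code n r e ⇒ all x ∈ (r i), x ∈ c)%H.
Proof.
  intros Hi a w Ha. hex (code_bound n i Hi a w Ha) as d [Hd H].
  hex (union_exists d w) as c Hc. hexists c. split; [exact (inL_union _ _ _ Hd Hc)|].
  hi r e. hi He Hce. hi x Hx. hap Hc. hexists (r i). hs.
  exact (himp_elim (hball_elim (hall_elim H r) e He) Hce).
Qed.

(** The members of coordinate [i] are bounded by [c], and [a] is intersected with the fibers of [b']
    over all [x ∈ c]. The guard is part of the separated formula, so that a fiber over [x] also
    keeps the tuples whose coordinate [i] omits [x]. *)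
Lemma Sep_ball n i G : i < n ->
  Sep (S n) (fun s => s 0 ∈ s (S i) ⇒ G s)%H -> Sep n (fun r => all x ∈ (r i), G (x .: r))%H.
Proof.
  intros Hi HG a w Ha. hex (code_member_bound n i Hi a w Ha) as c [Hc Hbd].
  hex (prod_L c a w Hc Ha) as d [Hd HP]. hex (HG d w Hd) as b' [Hb' HS].
  hex (fund_exists_L F_all b' c w Hb' Hc) as f [Hf HF].
  hex (fund_exists_L F_inter a f w Ha Hf) as b [Hb HI].
  hexists b. hs. hi r e. hi He. split; hi K.
  - destruct (halliff_l HI e K) as [K1 K2]. hs. hi x Hx.
    hv (hball_elim (himp_elim (hball_elim (hall_elim Hbd r) e K1) He) x Hx) as Hxc.
    hex (fiber_exists x b' w) as u Hu.
    assert (Huf : w ⊩ u ∈ f) by (hap HF; hexists x; hs).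
    hex (halliff_l Hu e (hball_elim K2 u Huf)) as p [Hp Hpx].
    hv (code_cons _ _ _ _ _ _ Hpx He) as Hcode.
    destruct (hiff_l (himp_elim (hall_elim (hall_elim HS (x .: r)) p) Hcode) Hp) as [_ K3].
    exact (himp_elim K3 Hx).
  - destruct K as [K1 K2]. hap HI. split; [exact K1|]. hi u Hu.
    hex (halliff_l HF u Hu) as x [Hx Hux]. hap Hux.
    hex (opair_exists x e w) as p Hpx. hexists p. hs.
    hv (code_cons _ _ _ _ _ _ Hpx He) as Hcode.
    apply (hiff_r (himp_elim (hall_elim (hall_elim HS (x .: r)) p) Hcode)). hs.
    + apply (hiff_r (himp_elim (hall_elim (hall_elim (hall_elim HP p) x) e) Hpx)). hs.
    + exact (hall_elim K2 x).
Qed.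

(* The operations F_eq, F_mem and F_123 yield the base relations between the first two
   coordinates; F_132 then skips the second coordinate. *)
Lemma Sep_base n i (Q : nat -> nat -> hprop) :
  D false 2 (fun r => Q (r 0) (r 1)) ->
  (forall u x y, infund i u x y = (ex v ∈ y, ex z ∈ x, opair u v z ∧ Q v z)%H) ->
  Sep (S (S n)) (fun s => Q (s 0) (s 1)).
Proof.
  intros HQ Hop a w Ha.
  hex (dom_L a w Ha) as X [HX HdX]. hex (ran_L a w Ha) as R [HR HrR].
  hex (dom_L R w HR) as Y [HY HdY]. hex (ran_L R w HR) as Z [HZ HrZ].
  (* [F_eq] and [F_mem] form subsets of [y × x], so [X], which bounds the first coordinate, is the
     second argument. *)
  hex (fund_exists_L i Y X w HY HX) as q [Hq Hqi].
  hex (fund_exists_L F_123 q Z w Hq HZ) as t [Ht Hti].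
  hex (inter_L a t w Ha Ht) as b [Hb HI]. hexists b. hs.
  hi r e. hi He. hex He as e1 [He He1]. hex He1 as e2 [He1 _].
  assert (Htr : w ⊩ otriple e (r 0) (r 1) e2) by (hexists e1; hs).
  split; hi K.
  - destruct (halliff_l HI e K) as [K1 K2]. hs.
    hex (halliff_l Hti e K2) as a1 H. hex H as b1 H. hex H as c1 (H & Hab & _).
    hex Hab as p [Hp Hab]. hv (halliff_l Hqi p Hp) as H1. rewrite Hop in H1.
    hex H1 as v [Hv H1]. hex H1 as z (Hz & H1 & HQ1).
    destruct (opair_inj _ _ _ _ _ _ H1 Hab) as [E1 E2].
    destruct (otriple_inj _ _ _ _ _ _ _ _ H Htr) as (E3 & E4 & _).
    assert (E5 := E1). apply (eqs_subst (fun y => v ≐ y)%H _ _ _ ltac:(dtac) E3) in E1.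
    apply (eqs_subst (fun y => z ≐ y)%H _ _ _ ltac:(dtac) E4) in E2.
    apply (eqs_subst (fun y => Q y (r 1)) _ _ _ ltac:(dtac) E1).
    apply (eqs_subst (fun y => Q v y) _ _ _ ltac:(dtac) E2). exact HQ1.
  - destruct K as [K1 K2]. hap HI. hs. hap Hti.
    hexists (r 0). hexists (r 1). hexists e2.
    assert (He1R : w ⊩ e1 ∈ R) by (hap HrR; hexists (r 0); hexists e; hs). hs.
    + hex (opair_exists (r 0) (r 1) w) as p Hp. hexists p. hs. hap Hqi. rewrite Hop.
      hexists (r 0). split; [hap HdX; hexists e1; hexists e; hs|].
      hexists (r 1). split; [hap HdY; hexists e2; hexists e1; hs|]. hs.
    + hap HrZ. hexists (r 1). hexists e1. hs.
Qed.

Lemma Sep_skip n F :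
  Sep (S n) F -> Sep (S (S n)) (fun s => F (s 0 .: fun k => s (S (S k)))).
Proof.
  intros HF a w Ha.
  hex (dom_L a w Ha) as X [HX HdX]. hex (ran_L a w Ha) as R [HR HrR].
  hex (dom_L R w HR) as Y [HY HdY]. hex (ran_L R w HR) as Z [HZ HrZ].
  hex (prod_L X Z w HX HZ) as d [Hd HP]. hex (HF d w Hd) as q [Hq HS].
  hex (fund_exists_L F_132 q Y w Hq HY) as t [Ht Hti].
  hex (inter_L a t w Ha Ht) as b [Hb HI]. hexists b. hs.
  hi r e. hi He. hex He as e1 [He He1]. hex He1 as e2 [He1 Hc2].
  assert (Htr : w ⊩ otriple e (r 0) (r 1) e2) by (hexists e1; hs).
  hex (opair_exists (r 0) e2 w) as p Hp.
  hv (code_cons _ _ _ _ _ _ Hp Hc2) as Hcode.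
  hv (himp_elim (hall_elim (hall_elim HS (r 0 .: fun k => r (S (S k)))) p) Hcode) as Hi.
  split; hi K.
  - destruct (halliff_l HI e K) as [K1 K2]. hs.
    hex (halliff_l Hti e K2) as a1 H. hex H as b1 H. hex H as c1 (H & Hab & _).
    hex Hab as p' [Hp' Hab].
    destruct (otriple_inj _ _ _ _ _ _ _ _ Htr H) as (E1 & E2 & E3).
    apply (eqs_subst (fun y => opair p' y b1) _ _ _ ltac:(dtac) (eqs_sym _ _ _ E1)) in Hab.
    apply (eqs_subst (fun y => opair p' (r 0) y) _ _ _ ltac:(dtac) (eqs_sym _ _ _ E3)) in Hab.
    hv (opair_unique _ _ _ _ _ Hp Hab) as E. apply eqs_sym in E.
    apply (eqs_subst (fun y => y ∈ q)%H _ _ _ ltac:(dtac) E) in Hp'.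
    exact (proj2 (hiff_l Hi Hp')).
  - destruct K as [K1 K2]. hap HI. hs. hap Hti.
    hexists (r 0). hexists e2. hexists (r 1).
    assert (He1R : w ⊩ e1 ∈ R) by (hap HrR; hexists (r 0); hexists e; hs). hs.
    + hexists p. hs. apply (hiff_r Hi). hs.
      apply (hiff_r (himp_elim (hall_elim (hall_elim (hall_elim HP p) (r 0)) e2) Hp)). hs.
      * hap HdX. hexists e1. hexists e. hs.
      * hap HrZ. hexists (r 1). hexists e1. hs.
    + hap HdY. hexists e2. hexists e1. hs.
Qed.

(** Adjacent coordinates are the base case; each induction step inserts one more coordinate between
    the two related ones. *)
Lemma Sep_relate i (Q : nat -> nat -> hprop) :
  D false 2 (fun r => Q (r 0) (r 1)) ->
  (forall u x y, infund i u x y = (ex v ∈ y, ex z ∈ x, opair u v z ∧ Q v z)%H) ->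
  forall j n, j < n -> Sep (S n) (fun s => Q (s 0) (s (S j))).
Proof.
  intros HQ Hop. induction j as [|j IH]; intros n Hj; (destruct n as [|n]; [lia|]).
  - exact (Sep_base n i Q HQ Hop).
  - exact (Sep_skip n _ (IH n (proj2 (Nat.succ_lt_mono _ _) Hj))).
Qed.

Lemma Sep_eq_head j n : j < n -> Sep (S n) (fun s => s (S j) ≐ s 0)%H.
Proof.
  intros Hj. apply (Sep_relate F_eq (fun v z => z ≐ v)%H); [dtac|reflexivity|exact Hj].
Qed.

Lemma Sep_mem_head j n : j < n -> Sep (S n) (fun s => s (S j) ∈ s 0)%H.
Proof.
  intros Hj. apply (Sep_relate F_mem (fun v z => z ∈ v)%H); [dtac|reflexivity|exact Hj].
Qed.

Lemma head_bound j n (G : (nat -> nat) -> hprop) :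
  j < n -> (forall s w, w ⊩ G s -> w ⊩ s (S j) ≐ s 0) ->
  forall a w, w ⊩ inL a -> w ⊩ ex c, inL c ∧
    hall (fun r => all e ∈ a, code n r e ⇒ all x, G (x .: r) ⇒ x ∈ c)%H.
Proof.
  intros Hj HG a w Ha. hex (code_bound n j Hj a w Ha) as c [Hc H]. hexists c. hs.
  hi r e. hi He Hce. hi x Hx. hv (HG _ _ Hx) as E. cbn [scons] in E.
  apply (eqs_subst (fun y => y ∈ c)%H _ _ _ ltac:(dtac) E).
  exact (himp_elim (hball_elim (hall_elim H r) e He) Hce).
Qed.

(** Only relations with the head coordinate are available so far. Copying [r j] to a new head [x],
    bounded by [head_bound], handles the coordinates in either order as well as [i = j]. *)
Lemma Sep_mem i j n : i < n -> j < n -> Sep n (fun r => r i ∈ r j)%H.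
Proof.
  intros Hi Hj.
  apply Sep_iff with (fun r => ex x, r j ≐ x ∧ r i ∈ x)%H.
  - intros r w. cbn [scons]. split; intros H.
    + hexists (r j). split; [heq|exact H].
    + hex H as x [E H]. apply eqs_sym in E.
      exact (eqs_subst (fun y => r i ∈ y)%H _ _ _ ltac:(dtac) E H).
  - apply (Sep_ex n (fun s => s (S j) ≐ s 0 ∧ s (S i) ∈ s 0)%H).
    + refine (head_bound j n (fun s => s (S j) ≐ s 0 ∧ s (S i) ∈ s 0)%H Hj _).
      intros s w H. exact (proj1 H).
    + apply Sep_and; [now apply Sep_eq_head|now apply Sep_mem_head].
Qed.

Lemma Sep_eq i j n : i < n -> j < n -> Sep n (fun r => r i ≐ r j)%H.
Proof.
  intros Hi Hj.
  apply Sep_iff with (fun r => ex x, r j ≐ x ∧ r i ≐ x)%H.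
  - intros r w. cbn [scons]. split; intros H.
    + hexists (r j). split; [heq|exact H].
    + hex H as x [E H]. apply eqs_sym in E.
      exact (eqs_subst (fun y => r i ≐ y)%H _ _ _ ltac:(dtac) E H).
  - apply (Sep_ex n (fun s => s (S j) ≐ s 0 ∧ s (S i) ≐ s 0)%H).
    + refine (head_bound j n (fun s => s (S j) ≐ s 0 ∧ s (S i) ≐ s 0)%H Hj _).
      intros s w H. exact (proj1 H).
    + apply Sep_and; now apply Sep_eq_head.
Qed.

Lemma Sep_Sigma0 A : Sigma0 A -> forall n, fvbound A <= n -> Sep n (sem A).
Proof.
  induction 1 as [x y|x y| |A B HA IHA HB IHB|A B HA IHA HB IHB|A B HA IHA HB IHB
    |x A HA IHA|x A HA IHA]; intros n Hn; cbn [fvbound] in Hn.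
  - apply Sep_mem; lia.
  - apply Sep_eq; lia.
  - apply Sep_bot.
  - apply Sep_and; [apply IHA|apply IHB]; lia.
  - apply Sep_or; [apply IHA|apply IHB]; lia.
  - apply Sep_imp; [apply IHA|apply IHB]; lia.
  - apply (Sep_ball n x (sem A)); [lia|].
    apply Sep_imp; [apply Sep_mem; lia|apply IHA; lia].
  - apply (Sep_ex n (fun s => s 0 ∈ s (S x) ∧ sem A s)%H).
    + intros a w Ha. assert (Hx : x < n) by lia.
      hex (code_member_bound n x Hx a w Ha) as c [Hc H]. hexists c. hs.
      hi r e. hi He Hce. hi k [Hk _].
      exact (hball_elim (himp_elim (hball_elim (hall_elim H r) e He) Hce) k Hk).
    + apply Sep_and; [apply Sep_mem; lia|apply IHA; lia].
Qed.

(** The parameters are packed into a single code [e]; separating from [a × {e}] and taking the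
    domain leaves the required subset of [a]. *)
Lemma separation_L A r a w :
  Sigma0 A -> w ⊩ hall (fun i => inL (r i)) -> w ⊩ inL a ->
  w ⊩ ex y, inL y ∧ all x, x ∈ y ⇔ (x ∈ a ∧ sem A (x .: r)).
Proof.
  intros HA Hr Ha. set (n := fvbound A).
  assert (HS : Sep (S n) (sem A)) by (apply Sep_Sigma0; [exact HA|unfold n; lia]).
  clearbody n. hex (code_exists n r w Hr) as e [He Hc].
  hex (upair_exists e e w) as s Hs. hv (inL_upair _ _ _ _ He He Hs) as HsL.
  hex (prod_L a s w Ha HsL) as d [Hd HP]. hex (HS d w Hd) as b [Hb HB].
  (* [b] is controlled only on codes, so it is cut down to [a × {e}] before its domain is taken. *)
  hex (inter_L b d w Hb Hd) as b' [Hb' HI]. hex (dom_L b' w Hb') as y [Hy HD].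
  hexists y. hs. hi x. split; hi Hx.
  - hex (halliff_l HD x Hx) as e' H. hex H as p [Hp Hpx].
    destruct (halliff_l HI p Hp) as [K1 K2].
    destruct (hiff_l (himp_elim (hall_elim (hall_elim (hall_elim HP p) x) e') Hpx) K2) as [K3 K4].
    hs. hv (single_inv _ _ _ _ Hs K4) as E. apply eqs_sym in E.
    hv (eqs_subst (code n r) _ _ _ ltac:(dtac) E Hc) as Hc'.
    hv (code_cons _ _ _ _ _ _ Hpx Hc') as Hcode.
    exact (proj2 (hiff_l (himp_elim (hall_elim (hall_elim HB (x .: r)) p) Hcode) K1)).
  - destruct Hx as [K1 K2]. hap HD. hexists e. hex (opair_exists x e w) as p Hpx.
    hexists p. hs. hap HI.
    assert (Kd : w ⊩ p ∈ d).
    { apply (hiff_r (himp_elim (hall_elim (hall_elim (hall_elim HP p) x) e) Hpx)). hs.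
      exact (upair_l _ _ _ _ Hs). }
    hs. hv (code_cons _ _ _ _ _ _ Hpx Hc) as Hcode.
    apply (hiff_r (himp_elim (hall_elim (hall_elim HB (x .: r)) p) Hcode)). hs.
Qed.

End SeparationInL.

(** * The axioms in L *)

Section Relativization.
Context {T : theory}.

Fixpoint rel (A : form) (r : nat -> nat) : hprop :=
  match A with
  | Mem x y => mem (r x) (r y)
  | Eq x y => eqs (r x) (r y)
  | Bot => hbot
  | And A B => hand (rel A r) (rel B r)
  | Or A B => hor (rel A r) (rel B r)
  | Imp A B => himp (rel A r) (rel B r)
  | All A => hall (fun x => himp (inL x) (rel A (x .: r)))
  | Ex A => hex (fun x => hand (inL x) (rel A (x .: r)))
  end.

Lemma sem_relativize A : forall r, hequiv (sem (relativize in_L A) r) (rel A r).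
Proof.
  induction A; intros r; cbn [relativize sem rel].
  - apply hequiv_refl.
  - apply hequiv_refl.
  - apply hequiv_refl.
  - apply hequiv_and; auto.
  - apply hequiv_or; auto.
  - apply hequiv_imp; auto.
  - apply hequiv_all. intros x. apply hequiv_imp; [exact (sem_in_L 0 (x .: r))|auto].
  - apply hequiv_ex. intros x. apply hequiv_and; [exact (sem_in_L 0 (x .: r))|auto].
Qed.

Lemma rel_ext_fv A : forall r s,
  (forall n, n < fvbound A -> r n = s n) -> hequiv (rel A r) (rel A s).
Proof.
  assert (Hup : forall r s k x, (forall n, n < pred k -> r n = s n) ->
            forall n, n < k -> (x .: r) n = (x .: s) n).
  { intros r s k x H [|n] Hn; simpl; [reflexivity|]. apply H. lia. }
  induction A as [x y|x y| |A IHA B IHB|A IHA B IHB|A IHA B IHB|A IHA|A IHA];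
    intros r s H; cbn [rel fvbound] in *.
  - rewrite !H by lia. apply hequiv_refl.
  - rewrite !H by lia. apply hequiv_refl.
  - apply hequiv_refl.
  - apply hequiv_and; [apply IHA|apply IHB]; intros; apply H; lia.
  - apply hequiv_or; [apply IHA|apply IHB]; intros; apply H; lia.
  - apply hequiv_imp; [apply IHA|apply IHB]; intros; apply H; lia.
  - apply hequiv_all. intros x. apply hequiv_imp; [apply hequiv_refl|].
    apply IHA. now apply Hup.
  - apply hequiv_ex. intros x. apply hequiv_and; [apply hequiv_refl|].
    apply IHA. now apply Hup.
Qed.

Lemma rel_ext A r s : (forall n, r n = s n) -> hequiv (rel A r) (rel A s).
Proof. intros H. apply rel_ext_fv. auto. Qed.

Lemma rel_ren A : forall r s, hequiv (rel (ren r A) s) (rel A (fun n => s (r n))).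
Proof.
  assert (Hup : forall x r s n, (x .: s) (up r n) = (x .: fun n => s (r n)) n)
    by (intros x r s [|n]; reflexivity).
  induction A; intros r s; cbn [ren rel].
  - apply hequiv_refl.
  - apply hequiv_refl.
  - apply hequiv_refl.
  - apply hequiv_and; auto.
  - apply hequiv_or; auto.
  - apply hequiv_imp; auto.
  - apply hequiv_all. intros x. apply hequiv_imp; [apply hequiv_refl|].
    intros w. rewrite (IHA _ _ w). apply rel_ext, Hup.
  - apply hequiv_ex. intros x. apply hequiv_and; [apply hequiv_refl|].
    intros w. rewrite (IHA _ _ w). apply rel_ext, Hup.
Qed.

Lemma L_env_cons x r w :
  w ⊩ inL x -> w ⊩ hall (fun i => inL (r i)) -> w ⊩ hall (fun i => inL ((x .: r) i)).
Proof. intros Hx Hr. hi i. destruct i; [exact Hx|exact (hall_elim Hr i)]. Qed.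

(* Bounded formulas are absolute because L is transitive. *)
Lemma absoluteness A : Sigma0 A ->
  forall r w, w ⊩ hall (fun i => inL (r i)) -> (w ⊩ rel A r <-> w ⊩ sem A r).
Proof.
  induction 1 as [x y|x y| |A B HA IHA HB IHB|A B HA IHA HB IHB|A B HA IHA HB IHB
    |x A HA IHA|x A HA IHA]; intros r w Hr; cbn [rel sem scons]; try reflexivity.
  - split; intros [H1 H2]; (split; [apply IHA|apply IHB]); assumption.
  - split; intros H; (hor H as H | H; [hleft; apply IHA|hright; apply IHB]); assumption.
  - split; intros H; hi H'; apply IHB; try assumption; apply (himp_elim H);
      apply IHA; assumption.
  - split; intros H.
    + hi y Hy. hv (L_transitive _ _ _ (hall_elim Hr x) Hy) as HyL.
      apply IHA; [exact (L_env_cons _ _ _ HyL Hr)|].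
      exact (himp_elim (himp_elim (hall_elim H y) HyL) Hy).
    + hi y HyL Hy. apply IHA; [exact (L_env_cons _ _ _ HyL Hr)|].
      exact (hball_elim H y Hy).
  - split; intros H.
    + hex H as y (HyL & Hy & H). hexists y. hs.
      apply IHA; [exact (L_env_cons _ _ _ HyL Hr)|exact H].
    + hex H as y [Hy H]. hv (L_transitive _ _ _ (hall_elim Hr x) Hy) as HyL.
      hexists y. hs. apply IHA; [exact (L_env_cons _ _ _ HyL Hr)|exact H].
Qed.

Lemma rel_closure A :
  (forall r w, w ⊩ hall (fun i => inL (r i)) -> w ⊩ rel A r) ->
  forall r w, w ⊩ rel (closure A) r.
Proof.
  intros H r w. hex (empty_in_L w) as e [He _].
  (* [k] counts the quantifiers already opened: their variables lie in L, and all later entries are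
     replaced by [e], so that the hypothesis on environments applies. Once [n] is 0, no free
     variable of [A] is affected. *)
  assert (Hn : forall n k r w, fvbound A <= n + k ->
    w ⊩ inL e -> w ⊩ hall (fun i => inL (if i <? k then r i else e)) ->
    w ⊩ rel (Nat.iter n All A) r).
  { clear r w He. induction n as [|n IH]; intros k r w Hk He Hr; cbn [Nat.iter nat_rect].
    - apply rel_ext_fv with (fun i => if i <? k then r i else e); [|now apply H].
      intros i Hi. rewrite (proj2 (Nat.ltb_lt i k)); [reflexivity|lia].
    - cbn [rel]. hi x Hx. apply (IH (S k)); [lia|exact He|]. hi i. destruct i as [|i].
      + exact Hx.
      + exact (hall_elim Hr i). }
  apply (Hn _ 0); [lia|exact He|]. hi i. exact He.
Qed.

Lemma D_sem A r : D false 1 (fun s => sem A (s 0 .: r)).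
Proof.
  exists (ren (fun i => match i with 0 => 0 | S k => S (r k) end) A).
  split; [discriminate|]. intros s Hs w. rewrite sem_ren.
  split; apply sem_ext; intros [|k]; simpl; auto;
    (apply (Hs (r k)) || (symmetry; apply (Hs (r k)))).
Qed.

Lemma D_sem2 A r : Sigma0 A -> D true 2 (fun s => sem A (s 0 .: (s 1 .: r))).
Proof.
  intros HA.
  exists (ren (fun i => match i with 0 => 0 | 1 => 1 | S (S k) => S (S (r k)) end) A).
  split; [intros _; now apply Sigma0_ren|]. intros s Hs w. rewrite sem_ren.
  split; apply sem_ext; intros [|[|k]]; simpl; auto;
    (apply (Hs (r k)) || (symmetry; apply (Hs (r k)))).
Qed.

Lemma rel_extensionality r w : w ⊩ rel Extensionality r.
Proof.
  unfold Extensionality. cbn [rel scons]. hi x Hx y Hy. hi H.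
  apply extensionality. hi z. split; hi Hz.
  - exact (hiff_l (himp_elim (hall_elim H z) (L_transitive _ _ _ Hx Hz)) Hz).
  - exact (hiff_r (himp_elim (hall_elim H z) (L_transitive _ _ _ Hy Hz)) Hz).
Qed.

Lemma rel_empty_set r w : w ⊩ rel EmptySet r.
Proof.
  unfold EmptySet. cbn [rel scons]. hex (empty_in_L w) as e [He H]. hexists e. hs.
  hi x _. exact (hall_elim H x).
Qed.

Lemma rel_pairing r w : w ⊩ rel Pairing r.
Proof.
  unfold Pairing. cbn [rel scons]. hi a Ha b Hb. hex (upair_exists a b w) as p Hp.
  hexists p. split; [exact (inL_upair _ _ _ _ Ha Hb Hp)|].
  hi x _. exact (hall_elim Hp x).
Qed.

Lemma rel_unions r w : w ⊩ rel Unions r.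
Proof.
  unfold Unions. cbn [rel scons]. hi a Ha. hex (union_exists a w) as u Hu.
  hexists u. split; [exact (inL_union _ _ _ Ha Hu)|].
  hi x Hx. split; hi H.
  - hex (halliff_l Hu x H) as y [Hy Hxy]. hexists y. hs.
    exact (L_transitive _ _ _ Ha Hy).
  - hap Hu. hex H as y (_ & Hy & Hxy). hexists y. hs.
Qed.

Lemma rel_set_induction A r w : w ⊩ rel (SetInduction A) r.
Proof.
  unfold SetInduction. cbn [rel scons]. hi H.
  apply hall_intro. apply (set_induction (fun a => inL a ⇒ rel A (a .: r))%H).
  (* Set induction has no restriction on complexity, so the relativized formula itself can be used,
     although membership in L is not bounded. *)
  - apply D_imp; [dtac|]. apply D_equiv with (fun s => sem (relativize in_L A) (s 0 .: r)).
    + intros s v. symmetry. apply sem_relativize.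
    + apply D_sem.
  - hi a IH Ha. refine (himp_elim (himp_elim (hall_elim H a) Ha) _).
    hi x HxL Hx. apply rel_ren.
    hv (himp_elim (hball_elim IH x Hx) HxL) as H'.
    eapply rel_ext; [|exact H']. intros [|n]; reflexivity.
Qed.

Lemma rel_separation A r w :
  Sigma0 A -> w ⊩ hall (fun i => inL (r i)) -> w ⊩ rel (Separation A) r.
Proof.
  intros HA Hr. unfold Separation. cbn [rel scons]. hi a Ha.
  hv (L_env_cons _ _ _ Ha Hr) as Hr'.
  hex (separation_L A (a .: r) a w HA Hr' Ha) as y [Hy H]. hexists y. hs. hi x HxL.
  assert (HE : forall v, v ⊩ rel (ren (up S) A) (x .: (y .: (a .: r))) <->
                         v ⊩ rel A (x .: (a .: r))).
  { intros v. rewrite (rel_ren A _ _ v). apply rel_ext. intros [|n]; reflexivity. }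
  hv (L_env_cons _ _ _ HxL Hr') as Hrx.
  split; hi K.
  - destruct (halliff_l H x K) as [K1 K2]. hs. apply HE.
    apply (absoluteness A HA); [exact Hrx|exact K2].
  - destruct K as [K1 K2]. hap H. hs. apply (absoluteness A HA); [exact Hrx|].
    now apply HE.
Qed.

Lemma rel_collection A r w :
  Sigma0 A -> w ⊩ hall (fun i => inL (r i)) -> w ⊩ rel (Collection A) r.
Proof.
  intros HA Hr. unfold Collection. cbn [rel scons]. hi a Ha H.
  hv (L_env_cons _ _ _ Ha Hr) as Hr'.
  assert (H' : w ⊩ all x ∈ a, ex y, inL y ∧ sem A (y .: (x .: (a .: r)))).
  { hi x Hx. hv (L_transitive _ _ _ Ha Hx) as HxL.
    hex (himp_elim (himp_elim (hall_elim H x) HxL) Hx) as y [Hy HR]. hexists y. hs.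
    apply (absoluteness A HA);
      [exact (L_env_cons _ _ _ Hy (L_env_cons _ _ _ HxL Hr'))|exact HR]. }
  apply (stage_collection (fun x y => sem A (y .: (x .: (a .: r))))) in H';
    [|apply S1_D, D_sem2, HA].
  hex H' as b [Hb H']. hexists b. hs. hi x HxL Hx.
  hex (hball_elim H' x Hx) as y [Hy HR]. hv (L_transitive _ _ _ Hb Hy) as HyL.
  hexists y. hs. apply rel_ren. apply rel_ext with (y .: (x .: (a .: r))).
  { intros [|[|n]]; reflexivity. }
  apply (absoluteness A HA);
    [exact (L_env_cons _ _ _ HyL (L_env_cons _ _ _ HxL Hr'))|exact HR].
Qed.

Lemma rel_axiom A : IKP_noInf A -> forall r w, w ⊩ rel A r.
Proof.
  intros [| | | |B|B HB|B HB] r w.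
  - apply rel_extensionality.
  - apply rel_empty_set.
  - apply rel_pairing.
  - apply rel_unions.
  - apply rel_closure. intros. apply rel_set_induction.
  - apply rel_closure. intros. now apply rel_separation.
  - apply rel_closure. intros. now apply rel_collection.
Qed.

(** * Strong Infinity in L *)

Definition isInd (a : nat) : hprop :=
  (ex e ∈ a, is_empty e) ∧ all x ∈ a, ex s ∈ a, succ s x.

(* The natural numbers are the ordinals [x] such that every member of [x ∪ {x}] is
   empty or a successor; this is a bounded formula. *)
Definition zero_or_succ (z : nat) : form :=
  ((∀∈ z, ⊥) ∨ ∃∈ z, ((∀∈ (S z), (0 ∈ 1 ∨ 0 ≐ 1)) ∧ (∀∈ 0, 0 ∈ 2 + z)))%form.

Definition natural : form :=
  (is_ord 0 ∧ zero_or_succ 0 ∧ ∀∈ 0, zero_or_succ 0)%form.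

Definition iszs (z : nat) : hprop := is_empty z ∨ ex y ∈ z, succ z y.
Definition isnat (x : nat) : hprop := ord x ∧ iszs x ∧ all z ∈ x, iszs z.

Lemma sem_zero_or_succ z r : hequiv (sem (zero_or_succ z) r) (iszs (r z)).
Proof.
  unfold zero_or_succ, iszs. cbn [sem scons]. apply hequiv_or; [apply hequiv_refl|].
  apply hequiv_ex. intros y w. split; intros [Hy H]; hs.
  - destruct H as [H1 H2]. hi k. split.
    + exact (hall_elim H1 k).
    + hi K. hor K as K | E; [exact (hball_elim H2 k K)|hsubst_r E; exact Hy].
  - hi k Hk. hap H. exact Hk.
  - hi k Hk. hap H. hleft. exact Hk.
Qed.

Lemma sem_natural x r : hequiv (sem natural (x .: r)) (isnat x).
Proof.
  unfold natural, isnat. cbn [sem]. apply hequiv_and; [apply hequiv_refl|].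
  apply hequiv_and; [exact (sem_zero_or_succ 0 (x .: r))|].
  apply hequiv_all. intros z. apply hequiv_imp; [apply hequiv_refl|].
  exact (sem_zero_or_succ 0 (z .: (x .: r))).
Qed.

Lemma Sigma0_natural : Sigma0 natural.
Proof.
  unfold natural, zero_or_succ, is_ord, is_trans.
  repeat first [apply Sigma0_Mem | apply Sigma0_Eq | apply Sigma0_Bot
    | apply Sigma0_And | apply Sigma0_Or | apply Sigma0_All | apply Sigma0_Ex].
Qed.

Lemma isnat_mem x y w : w ⊩ isnat x -> w ⊩ y ∈ x -> w ⊩ isnat y.
Proof.
  intros (H1 & _ & H3) Hy. split; [exact (ord_mem _ _ _ H1 Hy)|].
  split; [exact (hball_elim H3 y Hy)|]. hi z Hz. hap H3.
  exact (hball_elim (hball_elim (proj1 H1) y Hy) z Hz).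
Qed.

Lemma isnat_empty x w : w ⊩ is_empty x -> w ⊩ isnat x.
Proof.
  intros H. split; [split|split]; try (hi y Hy; hbot (hball_elim H y Hy)).
  hleft. exact H.
Qed.

Lemma isnat_succ x y w : w ⊩ succ x y -> w ⊩ isnat y -> w ⊩ isnat x.
Proof.
  intros Hs (H1 & H2 & H3). split; [exact (ord_succ _ _ _ H1 Hs)|]. split.
  - hright. hexists y. hs. hap Hs. hright. heq.
  - hi z Hz. hor (halliff_l Hs z Hz) as K | E.
    + exact (hball_elim H3 z K).
    + hsubst_r E. exact H2.
Qed.

(** A natural number is empty or the successor of one of its members, which is again natural, so
    this reduces to set induction. *)
Lemma nat_induction (F : nat -> hprop) w :
  D false 1 (fun r => F (r 0)) ->
  w ⊩ all x, is_empty x ⇒ F x -> w ⊩ all x, all y, succ x y ⇒ F y ⇒ F x ->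
  w ⊩ all x, isnat x ⇒ F x.
Proof.
  intros HF H0 HS. apply hall_intro. apply set_induction; [dtac|].
  hi x IH Hx. hor (proj1 (proj2 Hx)) as H | H.
  - exact (himp_elim (hall_elim H0 x) H).
  - hex H as y [Hy H].
    exact (himp_elim (himp_elim (hall_elim (hall_elim HS x) y) H)
      (himp_elim (hball_elim IH y Hy) (isnat_mem _ _ _ Hx Hy))).
Qed.

Lemma empty_unique x y w : w ⊩ is_empty x -> w ⊩ is_empty y -> w ⊩ x ≐ y.
Proof.
  intros Hx Hy. apply extensionality. hi z. split; hi Hz.
  - hbot (hball_elim Hx z Hz).
  - hbot (hball_elim Hy z Hz).
Qed.

Lemma inL_succ x y w : w ⊩ inL y -> w ⊩ succ x y -> w ⊩ inL x.
Proof.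
  intros Hy Hs. hex (upair_exists y y w) as p Hp. hv (inL_upair _ _ _ _ Hy Hy Hp) as HpL.
  hex (union2_L y p w Hy HpL) as z [Hz H].
  assert (E : w ⊩ z ≐ x); [|hsubst_r E; exact Hz].
  apply extensionality. hi k. split; hi Hk.
  - hap Hs. hor (halliff_l H k Hk) as K | K; [hleft; exact K|hright].
    exact (single_inv _ _ _ _ Hp K).
  - hap H. hor (halliff_l Hs k Hk) as K | E; [hleft; exact K|hright].
    hsubst_r E. exact (upair_l _ _ _ _ Hp).
Qed.

Lemma isnat_inL w : w ⊩ all x, isnat x ⇒ inL x.
Proof.
  apply nat_induction; [dtac| |].
  - hi x Hx. hex (empty_in_L w) as e [He H]. hv (empty_unique _ _ _ H Hx) as E.
    hsubst E. exact He.
  - hi x y. hi Hs Hy. exact (inL_succ _ _ _ Hy Hs).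
Qed.

Lemma isnat_Ind a w : w ⊩ isInd a -> w ⊩ all x, isnat x ⇒ x ∈ a.
Proof.
  intros [H0 HS]. apply nat_induction; [dtac| |].
  - hi x Hx. hex H0 as e [He H]. hv (empty_unique _ _ _ H Hx) as E. hsubst E. exact He.
  - hi x y. hi Hs Hy. hex (hball_elim HS y Hy) as s [Hsa H].
    hv (succ_unique _ _ _ _ H Hs) as E. hsubst E. exact Hsa.
Qed.

(** The natural numbers in [a] form an inductive set, and [a] is contained in every inductive
    set. *)
Lemma omega_isnat a w :
  w ⊩ isInd a -> w ⊩ all b, isInd b ⇒ all x ∈ a, x ∈ b -> w ⊩ all x ∈ a, isnat x.
Proof.
  intros [H0 HS] Hmin.
  hex (separation isnat a ltac:(dtac) w) as b Hb.
  assert (Hind : w ⊩ isInd b).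
  { split.
    - hex H0 as e [He H]. hexists e. hs. hap Hb. hs. exact (isnat_empty _ _ H).
    - hi x Hx. destruct (halliff_l Hb x Hx) as [Hxa Hxn].
      hex (hball_elim HS x Hxa) as s [Hs H]. hexists s. hs. hap Hb. hs.
      exact (isnat_succ _ _ _ H Hxn). }
  hi x Hx. refine (proj2 (halliff_l Hb x _)).
  exact (hball_elim (himp_elim (hall_elim Hmin b) Hind) x Hx).
Qed.

Lemma omega_inL a w :
  w ⊩ isInd a -> w ⊩ all x ∈ a, isnat x -> w ⊩ inL a.
Proof.
  intros Ha Hn.
  assert (H : w ⊩ all x ∈ a, ex y, inL y ∧ y ≐ x).
  { hi x Hx. hexists x. split; [|heq].
    exact (himp_elim (hall_elim (isnat_inL w) x) (hball_elim Hn x Hx)). }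
  (* Collecting along equality turns membership in L of each [x ∈ a] into a single [b] in L that
     contains all of [a]. *)
  apply (stage_collection (fun x y => y ≐ x)%H) in H; [|stac].
  hex H as b [Hb H].
  assert (Hr : w ⊩ hall (fun i : nat => inL ((fun _ => b) i))) by (hi i; exact Hb).
  hex (separation_L natural (fun _ => b) b w Sigma0_natural Hr Hb) as y [Hy HS].
  assert (E : w ⊩ y ≐ a); [|hsubst_r E; exact Hy].
  apply extensionality. hi x. split; hi Hx.
  - destruct (halliff_l HS x Hx) as [_ K]. apply (proj1 (sem_natural x _ _)) in K.
    exact (himp_elim (hall_elim (isnat_Ind _ _ Ha) x) K).
  - hap HS. split.
    + hex (hball_elim H x Hx) as y' [Hy' E]. hsubst_r E. exact Hy'.
    + apply sem_natural. exact (hball_elim Hn x Hx).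
Qed.

(** [is_succ] has an unbounded quantifier, so [absoluteness] does not apply; transitivity of L gives
    the equivalence directly. *)
Lemma rel_is_Ind a r w : w ⊩ inL (r a) -> (w ⊩ rel (is_Ind a) r <-> w ⊩ isInd (r a)).
Proof.
  intros Ha. unfold is_Ind, is_succ. cbn [rel scons]. split; intros [H1 H2]; split.
  - hex H1 as e (HeL & He & H). hexists e. hs. hi x Hx.
    exact (himp_elim (himp_elim (hall_elim H x) (L_transitive _ _ _ HeL Hx)) Hx).
  - hi x Hx. hv (L_transitive _ _ _ Ha Hx) as HxL.
    hex (himp_elim (himp_elim (hall_elim H2 x) HxL) Hx) as s (HsL & Hs & H).
    hexists s. hs. hi z. split; hi Hz.
    + exact (hiff_l (himp_elim (hall_elim H z) (L_transitive _ _ _ HsL Hz)) Hz).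
    + refine (hiff_r (himp_elim (hall_elim H z) _) Hz). hor Hz as Hz | E.
      * exact (L_transitive _ _ _ HxL Hz).
      * hsubst_r E. exact HxL.
  - hex H1 as e [He H]. hexists e. hs. { exact (L_transitive _ _ _ Ha He). }
    hi x _. exact (hall_elim H x).
  - hi x _ Hx. hex (hball_elim H2 x Hx) as s [Hs H]. hexists s. hs.
    { exact (L_transitive _ _ _ Ha Hs). }
    hi z _. exact (hall_elim H z).
Qed.

Lemma rel_strong_infinity r w : ax StrongInfinity -> w ⊩ rel StrongInfinity r.
Proof.
  intros HI. hv (sem_ax StrongInfinity r w HI) as H. expose_in H.
  assert (H' : w ⊩ ex a, isInd a ∧ all b, isInd b ⇒ all x ∈ a, x ∈ b) by exact H.
  clear H. hex H' as a [Ha Hmin].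
  hv (omega_isnat _ _ Ha Hmin) as Hn. hv (omega_inL _ _ Ha Hn) as HL.
  unfold StrongInfinity. cbn [rel]. hexists a. hs.
  - apply (rel_is_Ind 0 (a .: r)); assumption.
  - hi b Hb H. apply (rel_is_Ind 0 (b .: (a .: r)) _ Hb) in H.
    hi x _ Hx. exact (hball_elim (himp_elim (hall_elim Hmin b) H) x Hx).
Qed.

(** The return to derivability: at the empty context, with the identity as environment, forcing a
    formula is deriving it. *)
Lemma proves_relativized A : (forall r w, w ⊩ rel A r) -> proves ax (relativize in_L A).
Proof.
  intros H. unfold proves.
  rewrite <- (ren_id (relativize in_L A) (fun n => n)) by reflexivity.
  apply sem_prv, sem_relativize, H.
Qed.

End Relativization.

Definition IKP_theory : theory :=
  {| ax := IKP_noInf; ax_sentence := IKP_noInf_closed; ax_ikp := fun A H => H |}.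

Lemma add_axiom_closed A : add_axiom IKP_noInf StrongInfinity A -> fvbound A = 0.
Proof. intros [H| ->]; [now apply IKP_noInf_closed|reflexivity]. Qed.

Definition IKP_infinity_theory : theory :=
  {| ax := add_axiom IKP_noInf StrongInfinity; ax_sentence := add_axiom_closed;
     ax_ikp := fun A H => or_introl H |}.

Theorem mainTheorem9 :
  (forall A : form, IKP_noInf A -> proves IKP_noInf (relativize in_L A)) /\
  proves (add_axiom IKP_noInf StrongInfinity) (relativize in_L StrongInfinity).
Proof.
  split.
  - intros A HA. apply (@proves_relativized IKP_theory). now apply rel_axiom.
  - apply (@proves_relativized IKP_infinity_theory). intros r w.
    apply rel_strong_infinity. right. reflexivity.
Qed.
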